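(* Let $a\neq0$, $b\neq0$, $c>0$, $d>0$ be constants, and let $u_d(t),r_d(t),v_d(t)$ be reference surge, yaw and sway velocities satisfying $\dot v_d=-a\dot r_d-br_d-cu_dr_d-dv_d$. Consider the error system with state $(z_e,\psi_e,r_e,\bar u_e)\in\mathbb{R}^4$ and control inputs $(\bar\tau_{1e},\tau_{2e})\in\mathbb{R}^2$ $$\begin{aligned}\dot z_e&=(d\beta+c\dot u_d+0.5\,d\,v_d\psi_e+d\,u_d)\psi_e-\bar u_e(r_e+r_d),\\ \dot\psi_e&=r_e,\\ \dot r_e&=\tau_{2e},\\ \dot{\bar u}_e&=\bar\tau_{1e},\end{aligned}$$ where $$\beta=\begin{cases}\dfrac{-v_d(\cos\psi_e-1+0.5\psi_e^2)+u_d(\sin\psi_e-\psi_e)}{\psi_e},&\psi_e\neq0,\\[2mm]0,&\psi_e=0.\end{cases}$$ Suppose that the reference surge and yaw velocities $(u_d,r_d)$ satisfy the persistent exciting conditions $$(u_d,\dot u_d,\ddot u_d,r_d,\dot r_d)\in L_\infty,\qquad \lim_{t\to\infty}\bigl(|u_d|+|r_d|\bigr)\neq0 .$$ Then, for any positive constants $k_1,k_2,k_3,k_4$, the control law $$\begin{aligned} r_{ed}&=-k_1z_e(d\beta+c\dot u_d+0.5\,d\,v_d\psi_e+d\,u_d)-k_2\psi_e,\\ \bar\tau_{1e}&=k_1z_e r-k_3\bar u_e,\\ \tau_{2e}&=\dot r_{ed}-\psi_e-k_4(r_e-r_{ed}),\end{aligned}$$ where $r=r_e+r_d$, makes the origin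 of the closed-loop system globally $\kappa$-exponentially stable (GKES).
   Context: A continuous function $\rho:[0,a)\to[0,\infty)$ is of class $\kappa$ if it is strictly increasing and $\rho(0)=0$ (for global properties, $a=\infty$). A system $\dot x=f(t,x)$, $f(t,0)=0$ for all $t\ge t_0$ (with $x\in\mathbb{R}^n$, $f$ piecewise continuous in $t$ and locally Lipschitz in $x$) is called globally $\kappa$-exponentially stable (GKES) if there exist a class $\kappa$ function $\rho$ and a positive constant $\gamma$ such that the trajectory starting from any initial state $x(t_0)\in\mathbb{R}^n$ satisfies $\|x(t)\|\le\rho(\|x(t_0)\|)e^{-\gamma(t-t_0)}$ for all $t\ge t_0$. $L_\infty$ denotes uniformly bounded functions of time. In the control law, $r_{ed}$ is an auxiliary variable and $\dot r_{ed}$ is its total time derivative along the trajectories of the error system (with $\dot\beta$ the total time derivative of $\beta$, equal to $0$ when $\psi_e=0$). *)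

(* Defs.v *)
From HB Require Import structures.
From mathcomp Require Import all_boot all_order all_algebra.
From mathcomp Require Import all_classical all_reals all_analysis.
Set Implicit Arguments.
Unset Strict Implicit.
Unset Printing Implicit Defensive.
Import Order.TTheory GRing.Theory Num.Theory.
Import numFieldNormedType.Exports.
Local Open Scope classical_set_scope.
Local Open Scope ring_scope.

Section GlobalKappaExponentialStability.
Context {R : realType}.

Definition locally_finite (E : set R) : Prop :=
  forall p q : R, finite_set (E `&` `[p, q]).

(* Finitely many discontinuities on every bounded subinterval of [t0, +oo[,
   all of them finite jumps. *)
Definition piecewise_continuous (t0 : R) (g : R -> R) : Prop :=
  exists2 E : set R, locally_finite E &
    [/\ forall t, t0 <= t -> ~ E t ->
          g s @[s --> within `[t0, +oo[ (nbhs t)] --> g t,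
        forall t, t0 <= t -> cvg (g s @[s --> t^'+]) &
        forall t, t0 < t -> cvg (g s @[s --> t^'-])].

(* g is continuous on I and g' is its derivative, except at isolated instants.
   This is the notion of derivative that goes with right-hand sides which are
   only piecewise continuous in time.  An endpoint of I may be regarded as one
   of the exceptional instants, so only interior points are constrained. *)
Definition piecewise_derivative (I : set R) (g g' : R -> R) : Prop :=
  {within I, continuous g} /\
  exists2 E : set R, locally_finite E &
    forall t, I° t -> ~ E t -> is_derive t (1 : R) g (g' t).

Definition L_infty (t0 : R) (g : R -> R) : Prop :=
  exists M : R, forall t, t0 <= t -> `|g t| <= M.

(* The canonical norm of 'rV[R]_n is the sup norm; this is the Euclidean one. *)
Definition enorm n (x : 'rV[R]_n) : R := Num.sqrt (\sum_i x 0 i ^+ 2).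

Definition locally_lipschitz_in_state n (t0 : R)
    (f : R -> 'rV[R]_n -> 'rV[R]_n) : Prop :=
  forall (x0 : 'rV[R]_n) (T : R), exists2 e : R, 0 < e &
    exists L : R, forall t x y, t0 <= t <= T ->
      enorm (x - x0) < e -> enorm (y - x0) < e ->
      enorm (f t x - f t y) <= L * enorm (x - y).

Definition system n (t0 : R) (f : R -> 'rV[R]_n -> 'rV[R]_n) : Prop :=
  [/\ forall t, t0 <= t -> f t 0 = 0,
      forall x i, piecewise_continuous t0 (fun t => f t x 0 i) &
      locally_lipschitz_in_state t0 f].

Definition trajectory n (f : R -> 'rV[R]_n -> 'rV[R]_n) (I : set R)
    (x : R -> 'rV[R]_n) : Prop :=
  forall i, piecewise_derivative I (fun t => x t 0 i) (fun t => f t (x t) 0 i).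

Definition class_kappa (rho : R -> R) : Prop :=
  [/\ {within `[0, +oo[, continuous rho},
      forall s s', 0 <= s -> s < s' -> rho s < rho s' &
      rho 0 = 0].

(* The first clause on x0 says that the trajectory issued from x0 does not
   escape in finite time; the second one bounds it.  A trajectory on
   [t0, +oo[ restricts to one on [t0, T[ for every T, so it is covered. *)
Definition GKES n (t0 : R) (f : R -> 'rV[R]_n -> 'rV[R]_n) : Prop :=
  system t0 f /\
  exists (rho : R -> R) (gamma : R),
    [/\ class_kappa rho, 0 < gamma &
    forall x0 : 'rV[R]_n,
      (exists2 x, x t0 = x0 & trajectory f `[t0, +oo[ x) /\
      (forall (T : R) (x : R -> 'rV[R]_n),
         t0 < T -> x t0 = x0 -> trajectory f `[t0, T[ x ->
         forall t, t0 <= t -> t < T ->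
           enorm (x t) <= rho (enorm x0) * expR (- gamma * (t - t0)))].

End GlobalKappaExponentialStability.

(* du_d, ddu_d, dr_d, dv_d stand for the time derivatives of the reference
   velocities; nothing in the record itself relates them to u_d, r_d, v_d. *)
Record reference (R : realType) := Reference {
  u_d : R -> R; du_d : R -> R; ddu_d : R -> R;
  r_d : R -> R; dr_d : R -> R;
  v_d : R -> R; dv_d : R -> R }.

(* lim (|u_d| + |r_d|) <> 0, with the lower limit so that |u_d| + |r_d| need not
   converge: it must stay away from 0 for large times.  Merely not tending to 0
   would be too weak: if u_d = 0 and r_d consists of short pulses separated by
   longer and longer gaps, z_e does not decay exponentially. *)
Definition persistent_excitation (R : realType) (ref : reference R) : Prop :=
  limf_einf (fun t : R => (`|u_d ref t| + `|r_d ref t|)%:E)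
    (pinfty_nbhs R) != 0%E.

Section TrackingErrorSystem.
Context {R : realType}.
Variables (c d : R) (ref : reference R).

Let u := u_d ref.
Let du := du_d ref.
Let ddu := ddu_d ref.
Let r := r_d ref.
Let dr := dr_d ref.
Let v := v_d ref.
Let dv := dv_d ref.

(* The state is x = (z_e, psi_e, r_e, ubar_e). *)
Definition z_e (x : 'rV[R]_4) : R := x 0 (@Ordinal 4 0 isT).
Definition psi_e (x : 'rV[R]_4) : R := x 0 (@Ordinal 4 1 isT).
Definition r_e (x : 'rV[R]_4) : R := x 0 (@Ordinal 4 2 isT).
Definition ubar_e (x : 'rV[R]_4) : R := x 0 (@Ordinal 4 3 isT).

Definition beta_num (t psi : R) : R :=
  - v t * (cos psi - 1 + 2^-1 * psi ^+ 2) + u t * (sin psi - psi).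

Definition beta (t psi : R) : R :=
  if psi == 0 then 0 else beta_num t psi / psi.

(* The factor d beta + c u_d' + 0.5 d v_d psi_e + d u_d, which occurs both in
   the z_e equation and in the control law. *)
Definition sigma (t psi : R) : R :=
  d * beta t psi + c * du t + 2^-1 * d * v t * psi + d * u t.

Definition dz_e (t : R) (x : 'rV[R]_4) : R :=
  sigma t (psi_e x) * psi_e x - ubar_e x * (r_e x + r t).

Definition error_system (t : R) (x : 'rV[R]_4) (tau1 tau2 : R) : 'rV[R]_4 :=
  \row_(i < 4) nth 0 [:: dz_e t x; r_e x; tau2; tau1] i.

(* Total time derivatives along the error system: dpsi is the time derivative
   of psi, to be instantiated with r_e. *)
Definition dbeta_num (t psi dpsi : R) : R :=
  - dv t * (cos psi - 1 + 2^-1 * psi ^+ 2)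
  - v t * (- sin psi * dpsi + psi * dpsi)
  + du t * (sin psi - psi) + u t * (cos psi * dpsi - dpsi).

Definition dbeta (t psi dpsi : R) : R :=
  if psi == 0 then 0
  else (dbeta_num t psi dpsi * psi - beta_num t psi * dpsi) / psi ^+ 2.

Definition dsigma (t psi dpsi : R) : R :=
  d * dbeta t psi dpsi + c * ddu t
  + 2^-1 * d * (dv t * psi + v t * dpsi) + d * du t.

Variables (k1 k2 k3 k4 : R).

Definition r_ed (t : R) (x : 'rV[R]_4) : R :=
  - k1 * z_e x * sigma t (psi_e x) - k2 * psi_e x.

Definition dr_ed (t : R) (x : 'rV[R]_4) : R :=
  - k1 * (dz_e t x * sigma t (psi_e x)
          + z_e x * dsigma t (psi_e x) (r_e x))
  - k2 * r_e x.

Definition tau1_e (t : R) (x : 'rV[R]_4) : R :=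
  k1 * z_e x * (r_e x + r t) - k3 * ubar_e x.

Definition tau2_e (t : R) (x : 'rV[R]_4) : R :=
  dr_ed t x - psi_e x - k4 * (r_e x - r_ed t x).

Definition closed_loop (t : R) (x : 'rV[R]_4) : 'rV[R]_4 :=
  error_system t x (tau1_e t x) (tau2_e t x).

End TrackingErrorSystem.

(* Main.v *)
(** Put e = r_e - r_ed.  In the coordinates (z_e, psi_e, e, ubar_e) the closed loop
    is skew-symmetric up to damping: V = (k1 z_e^2 + psi_e^2 + e^2 + ubar_e^2) / 2
    satisfies V' = - k2 psi_e^2 - k4 e^2 - k3 ubar_e^2.  The missing damping of z_e
    comes from the cross term
      U = A w z_e psi_e - r_d z_e ubar_e + (k1 / 2) c d u_d^2 z_e^2,
    where w = c u_d' + d u_d.  Up to terms containing psi_e, e or ubar_e, its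
    derivative is at most (- w^2 - r_d^2 / 2 + c d u_d u_d') k1 z_e^2, and expanding
    half of w^2 bounds this by - (k1 / 2) (d^2 u_d^2 + r_d^2) z_e^2, which persistent
    excitation makes negative definite in z_e.  Hence W = K m^10 V + U is a strict
    Lyapunov function where all coordinates are at most m, with W' <= - mu V and mu
    independent of m.  Since V does not increase, this forces V <= 1 after a time
    depending only on V(t0); from then on m is fixed and the exponential rate is
    universal.

    For the existence of trajectories, the right-hand side is multiplied by a cutoff
    with values in [0, 1]: V still does not increase, so the cutoff never acts and
    Picard iteration for bounded Lipschitz fields suffices. *)
Require Import Defs.
From mathcomp Require Import all_boot all_order all_algebra.
From mathcomp Require Import all_classical all_reals all_analysis.
From mathcomp Require Import ring lra.
Import Order.TTheory GRing.Theory Num.Theory.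
Import numFieldNormedType.Exports.
Local Open Scope classical_set_scope.
Local Open Scope ring_scope.

(** * Differentiation and monotonicity off isolated instants *)

(** Three obstacles shape the proof. Excitation concerns [|u_d| + |r_d|], whereas z_e acts on psi_e
    through w, which may vanish while u_d does not. The cross terms grow with the state, at worst
    like m^5 times a quadratic form; Young's inequality squares that factor, hence m^10. Finally
    GKES asks for one rate for all initial states: the time spent before V <= 1 must therefore go
    into rho, as a factor exp (gamma * delay). The delay is polynomial in a bound on the initial
    energy, which keeps rho continuous and increasing. Passing between r_e and e is nonlinear,
    because r_ed grows cubically; each direction costs a factor (1 + a)^2 but stays linear near 0,
    so rho (s) is s times a positive nondecreasing function. Since u_d'' and v_d' are only piecewise
    continuous, the monotonicity arguments along closed-loop trajectories tolerate isolated
    exceptional instants. Bounds on v_d and v_d' are derived from the sway equation. *)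

Section DerivativeRules.
Context {R : realType}.
Implicit Types (f g : R -> R) (t a b : R).

Lemma deriv_add {f g t a b} : is_derive t (1 : R) f a -> is_derive t (1 : R) g b ->
  is_derive t (1 : R) (fun s => f s + g s) (a + b).
Proof. exact: is_deriveD. Qed.

Lemma deriv_opp {f t a} : is_derive t (1 : R) f a ->
  is_derive t (1 : R) (fun s => - f s) (- a).
Proof. exact: is_deriveN. Qed.

Lemma deriv_mul {f g t a b} : is_derive t (1 : R) f a -> is_derive t (1 : R) g b ->
  is_derive t (1 : R) (fun s => f s * g s) (a * g t + f t * b).
Proof.
move=> fa gb; have h := is_deriveM fa gb.
by apply: (is_derive_eq h); rewrite /GRing.scale /=; ring.
Qed.

Lemma deriv_sqr {f t a} : is_derive t (1 : R) f a ->
  is_derive t (1 : R) (fun s => f s ^+ 2) (2 * f t * a).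
Proof.
move=> fa; have h := deriv_mul fa fa.
rewrite (_ : (fun s => f s ^+ 2) = (fun s => f s * f s)); last first.
  by apply/funext => s; rewrite expr2.
by apply: (is_derive_eq h); ring.
Qed.

Lemma deriv_cst a t : is_derive t (1 : R) (fun=> a) 0.
Proof. exact: is_derive_cst. Qed.

Lemma deriv_id t : is_derive t (1 : R) (fun s : R => s) 1.
Proof. exact: is_derive_id. Qed.

Lemma deriv_eq {f t a b} : is_derive t (1 : R) f a -> a = b ->
  is_derive t (1 : R) f b.
Proof. by move=> + <-. Qed.

Lemma deriv_comp {f g t a b} : is_derive t (1 : R) f a ->
  is_derive (f t) (1 : R) g b -> is_derive t (1 : R) (fun s => g (f s)) (b * a).
Proof.
move=> fa gb; have h := is_derive1_comp gb fa.
by apply: (is_derive_eq h).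
Qed.

Lemma deriv_cont {f t a} : is_derive t (1 : R) f a -> {for t, continuous f}.
Proof. by move=> [h _]; apply/differentiable_continuous/derivable1_diffP. Qed.

Lemma deriv_cont_within (A : set R) (f df : R -> R) :
  (forall t, A t -> is_derive t (1 : R) f (df t)) -> {within A, continuous f}.
Proof.
move=> h; apply: continuous_in_subspaceT => t /set_mem At.
exact: deriv_cont (h t At).
Qed.

End DerivativeRules.

(* [is_derive] is a class: without [notypeclasses], the instances of the library
   solve some premises, with derivatives in terms of [*:]. *)
Ltac deriv_step := first
  [ eassumption | notypeclasses refine (deriv_cst _ _)
  | notypeclasses refine (deriv_id _) | notypeclasses refine (deriv_add _ _)
  | notypeclasses refine (deriv_opp _) | notypeclasses refine (deriv_sqr _)
  | notypeclasses refine (deriv_mul _ _) ].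
Ltac deriv := notypeclasses refine (deriv_eq _ _); [repeat deriv_step|cbv beta].

Section ContinuityRules.
Context {R : realType} {T : topologicalType}.
Implicit Types f g : T -> R.

Lemma cont_cst (a : R) : continuous (fun _ : T => a).
Proof. exact: cst_continuous. Qed.

Lemma cont_add f g : continuous f -> continuous g -> continuous (fun x => f x + g x).
Proof. by move=> hf hg x; apply: continuousD; [exact: hf|exact: hg]. Qed.

Lemma cont_opp f : continuous f -> continuous (fun x => - f x).
Proof. by move=> hf x; apply: continuousN; exact: hf. Qed.

Lemma cont_mul f g : continuous f -> continuous g -> continuous (fun x => f x * g x).
Proof. by move=> hf hg x; apply: continuousM; [exact: hf|exact: hg]. Qed.

Lemma cont_exp f n : continuous f -> continuous (fun x => f x ^+ n).
Proof.
move=> hf; elim: n => [|n ih]; first exact: cont_cst.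
rewrite (_ : (fun x => _) = (fun x => f x * f x ^+ n)); first exact: cont_mul.
by apply/funext => x; rewrite exprS.
Qed.

Lemma cont_comp (h : R -> R) f : continuous h -> continuous f ->
  continuous (fun x => h (f x)).
Proof. by move=> hh hf x; apply: continuous_comp; [exact: hf|exact: hh]. Qed.

End ContinuityRules.

Ltac cont_step := match goal with
  | |- forall x, @continuous_at ?T _ x (fun s => GRing.add (@?F s) (@?G s)) =>
    refine (@cont_add _ T F G _ _)
  | |- forall x, @continuous_at ?T _ x (fun s => GRing.opp (@?F s)) =>
    refine (@cont_opp _ T F _)
  | |- forall x, @continuous_at ?T _ x (fun s => GRing.mul (@?F s) (@?G s)) =>
    refine (@cont_mul _ T F G _ _)
  | |- forall x, @continuous_at ?T _ x (fun s => GRing.exp (@?F s) ?n) =>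
    refine (@cont_exp _ T F n _)
  | |- forall x, @continuous_at ?T _ x (fun _ => ?a) => refine (@cont_cst _ T a)
  | _ => assumption
  end.
Ltac cont := try unfold from_subspace; repeat cont_step.

Section PiecewiseMonotone.
Context {R : realType}.

(** Induction on the exceptional instants: an instant inside the interval cuts it in two, and
    continuity there lets the two inequalities be chained. With none left, the mean value theorem
    applies. *)
Lemma nonincreasing_off_seq (s : seq R) (g dg : R -> R) p q : p <= q ->
  {within `[p, q], continuous g} ->
  (forall t, p < t < q -> t \notin s ->
     is_derive t (1 : R) g (dg t) /\ dg t <= 0) ->
  g q <= g p.
Proof.
elim: s p q => [|e s ih] p q pq cg dgP.
  move: pq; rewrite le_eqVlt => /predU1P[->//|pq].
  have [|c] := MVT pq _ cg (df := dg).
    by move=> t; rewrite in_itv /= => /dgP -/(_ isT)[].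
  rewrite in_itv /= => /dgP -/(_ isT)[_ le0] /eqP.
  rewrite subr_eq => /eqP ->; rewrite -subr_le0 addrK.
  by rewrite mulr_le0_ge0// subr_ge0 ltW.
have [/andP[pe eq]|nin] := boolP (p < e < q).
  apply: (@le_trans _ _ (g e)); apply: ih.
  - exact: ltW.
  - apply: continuous_subspaceW cg => t /=; rewrite !in_itv /= => /andP[h ->].
    by rewrite (le_trans (ltW pe)).
  - move=> t /andP[et tq] ts; apply: dgP; first by rewrite (lt_trans pe).
    by rewrite in_cons negb_or ts gt_eqF.
  - exact: ltW.
  - apply: continuous_subspaceW cg => t /=; rewrite !in_itv /= => /andP[-> h].
    by rewrite (le_trans h (ltW eq)).
  - move=> t /andP[pt te] ts; apply: dgP; first by rewrite pt (lt_trans te).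
    by rewrite in_cons negb_or ts lt_eqF.
apply: ih => // t tpq ts; apply: dgP => //.
by rewrite in_cons negb_or ts andbT; apply: contraNneq nin => <-.
Qed.

Lemma nonincreasing_off (E : set R) (g dg : R -> R) p q : p <= q ->
  locally_finite E -> {within `[p, q], continuous g} ->
  (forall t, p < t < q -> ~ E t -> is_derive t (1 : R) g (dg t) /\ dg t <= 0) ->
  g q <= g p.
Proof.
move=> pq /(_ p q)/finite_seqP[s Es] cg dgP.
apply: (@nonincreasing_off_seq s g dg) => // t tpq ts; apply: dgP => // Et.
have : (E `&` `[p, q]) t.
  by split=> //=; rewrite in_itv /=; case/andP: tpq => /ltW -> /ltW ->.
by rewrite Es /= => h; move: ts; rewrite h.
Qed.

Lemma locally_finiteU (E F : set R) : locally_finite E -> locally_finite F ->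
  locally_finite (E `|` F).
Proof. by move=> hE hF p q; rewrite setIUl finite_setU. Qed.

Lemma locally_finite0 : locally_finite (@set0 R).
Proof. by move=> p q; rewrite set0I. Qed.

(** Both [f - h] and [- f - h] are nonincreasing. Mean value estimates below use this with an
    explicit majorant [h]. *)
Lemma le_deriv_bound (f df h dh : R -> R) p q : p <= q ->
  {within `[p, q], continuous f} -> {within `[p, q], continuous h} ->
  (forall t, p < t < q -> is_derive t (1 : R) f (df t)) ->
  (forall t, p < t < q -> is_derive t (1 : R) h (dh t)) ->
  (forall t, p < t < q -> `|df t| <= dh t) ->
  `|f q - f p| <= h q - h p.
Proof.
move=> pq cf ch Df Dh b; rewrite ler_norml; apply/andP; split.
- suff : - f q - h q <= - f p - h p by lra.
  apply: (@nonincreasing_off set0 (fun t => - f t - h t) (fun t => - df t - dh t)) => //.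
  + exact: locally_finite0.
  + by cont.
  + move=> t tpq _; have [? ?] := (Df t tpq, Dh t tpq); split; first by deriv.
    by have := b t tpq; rewrite ler_norml => /andP[]; lra.
- suff : f q - h q <= f p - h p by lra.
  apply: (@nonincreasing_off set0 (fun t => f t - h t) (fun t => df t - dh t)) => //.
  + exact: locally_finite0.
  + by cont.
  + move=> t tpq _; have [? ?] := (Df t tpq, Dh t tpq); split; first by deriv.
    by have := b t tpq; rewrite ler_norml => /andP[]; lra.
Qed.

(** Integrating from [t0 - 1] makes [G] differentiable, hence continuous, at [t0] too. Freezing it
    to the left of [t0] keeps continuity on the whole line but may break the derivative at [t0]
    itself, whence [t0 < t]. *)
Lemma antiderivative (f : R -> R) (t0 : R) : continuous f ->
  exists F : R -> R, [/\ forall t, t <= t0 -> F t = 0, continuous F &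
    forall t, t0 < t -> is_derive t (1 : R) F (f t)].
Proof.
move=> cf; pose a := t0 - 1.
pose G y := \int[lebesgue_measure]_(s in `[a, y]) f s.
have DG t : a < t -> is_derive t (1 : R) G (f t).
  move=> at_; have [||] := @continuous_FTC1_closed R f a t (t + 1) _ _ at_ (cf t).
  - by rewrite ltrDl.
  - apply: continuous_compact_integrable; first exact: segment_compact.
    exact: continuous_subspaceT.
  - by move=> h1 h2; apply: (DeriveDef h1); rewrite -derive1E; exact: h2.
have a0 : a < t0 by rewrite /a; lra.
exists (fun t => G (Num.max t t0) - G t0); split.
- by move=> t tt0; rewrite (max_idPr tt0) subrr.
- apply: cont_add; last exact: cont_cst.
  move=> t; apply: (@continuous_comp _ _ _ (fun t => Num.max t t0) G).
    by apply: continuous_max; [exact: cvg_id|exact: cst_continuous].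
  by apply: (deriv_cont (DG _ _)); rewrite lt_max a0 orbT.
- move=> t t0t.
  have h : is_derive t (1 : R) (fun s => G s - G t0) (f t).
    by have := DG t (lt_trans a0 t0t) => hG; deriv; ring.
  have e : \near t, G t - G t0 = G (Num.max t t0) - G t0.
    near=> s; congr (G _ - _); apply/esym/max_idPl/ltW.
    by near: s; apply: lt_nbhsr.
  exact: near_eq_is_derive e h.
Unshelve. all: by end_near. Qed.

End PiecewiseMonotone.

(** * The function beta *)

Section Quotient.
Context {R : realType}.

(** Between 0 and [x] the derivative is at most the constant [|x| ^+ n]; the factor 1/(n+1) that
    integration would give is sacrificed. *)
Lemma norm_le_pow (f df : R -> R) n : f 0 = 0 ->
  (forall x, is_derive x (1 : R) f (df x)) ->
  (forall x, `|df x| <= `|x| ^+ n) -> forall x, `|f x| <= `|x| ^+ n.+1.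
Proof.
move=> f0 Df b x; pose h t := `|x| ^+ n * t.
have Dh t : is_derive t (1 : R) h (`|x| ^+ n) by rewrite /h; deriv; ring.
have bd t : `|t| <= `|x| -> `|df t| <= `|x| ^+ n.
  by move=> tx; apply: (le_trans (b t)); rewrite lerXn2r// nnegrE.
have [x0|x0] := leP 0 x.
- have := @le_deriv_bound R f df h (fun=> `|x| ^+ n) 0 x x0.
  rewrite f0 subr0 /h mulr0 subr0 => bound.
  apply: (@le_trans _ _ (`|x| ^+ n * x)); last first.
    by rewrite exprSr ler_wpM2l ?exprn_ge0// ler_norm.
  apply: bound.
  + by apply: deriv_cont_within => t _; exact: Df.
  + by apply: deriv_cont_within => t _; exact: Dh.
  + move=> t /andP[t0 tx]; apply: bd.
    by rewrite (ger0_norm x0) ger0_norm ltW.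
- have := @le_deriv_bound R f df h (fun=> `|x| ^+ n) x 0 (ltW x0).
  rewrite f0 sub0r normrN /h mulr0 sub0r -mulrN => bound.
  apply: (@le_trans _ _ (`|x| ^+ n * - x)); last first.
    by rewrite exprSr ler_wpM2l ?exprn_ge0// -normrN ler_norm.
  apply: bound.
  + by apply: deriv_cont_within => t _; exact: Df.
  + by apply: deriv_cont_within => t _; exact: Dh.
  + move=> t /andP[xt t0]; apply: bd.
    by rewrite (ltr0_norm x0) ltr0_norm// lerN2 ltW.
Qed.

(** As division by 0 yields 0, both functions are 0 at 0. This is the correct continuous extension
    here: the hypotheses below make [N] of order x^3 and [dN] of order x^2. *)
Definition quot (N : R -> R) x := N x / x.
Definition dquot (N dN : R -> R) x := (dN x * x - N x) / x ^+ 2.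

Lemma deriv_inv {f : R -> R} {t a} : f t != 0 -> is_derive t (1 : R) f a ->
  is_derive t (1 : R) (fun s => (f s)^-1) (- a / f t ^+ 2).
Proof.
move=> ft0 fa; have h := is_deriveV ft0 fa.
by apply: (is_derive_eq h); rewrite /GRing.scale /= !mulNr mulrC.
Qed.

Variables (N dN ddN : R -> R).
Hypothesis N0 : N 0 = 0.
Hypothesis dN0 : dN 0 = 0.
Hypothesis DN : forall x, is_derive x (1 : R) N (dN x).
Hypothesis DdN : forall x, is_derive x (1 : R) dN (ddN x).
Hypothesis ddN_le : forall x, `|ddN x| <= `|x|.

Let dN_le x : `|dN x| <= `|x| ^+ 2.
Proof. by apply: (@norm_le_pow dN ddN 1%N) => // y; rewrite expr1. Qed.

Let N_le x : `|N x| <= `|x| ^+ 3.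
Proof. exact: (@norm_le_pow N dN 2%N). Qed.

Lemma quot_le x : `|quot N x| <= `|x| ^+ 2.
Proof.
rewrite /quot; have [->|x0] := eqVneq x 0.
  by rewrite invr0 mulr0 normr0 expr0n.
by rewrite normrM normfV ler_pdivrMr ?normr_gt0// -exprSr.
Qed.

Lemma dquot_le x : `|dquot N dN x| <= 2 * `|x|.
Proof.
rewrite /dquot; have [->|x0] := eqVneq x 0.
  by rewrite expr0n invr0 mulr0 normr0 mulr0.
rewrite normrM normfV ler_pdivrMr ?normr_gt0 ?expf_neq0// normrX.
apply: (le_trans (ler_normB _ _)); rewrite normrM.
have := ler_wpM2r (normr_ge0 x) (dN_le x); have := N_le x.
by rewrite !exprS expr0; lra.
Qed.

Lemma deriv_quot x : is_derive x (1 : R) (quot N) (dquot N dN x).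
Proof.
have [->|x0] := eqVneq x 0.
  (* The quotient rule fails at 0. The slope of [quot N] from 0 to [z] is [N z / z ^+ 2], which
     tends to 0 because [N] is of third order. *)
  apply/is_derive1_caratheodory; exists (fun z => N z / z ^+ 2); split.
  - move=> z; rewrite /quot N0 mul0r !subr0.
    by have [->|z0] := eqVneq z 0; [rewrite N0 !mul0r|field].
  - rewrite /prop_for /continuous_at; cbv beta; rewrite N0 mul0r; apply/cvgr0Pnorm_le => e e0.
    near=> z; have ze : `|z| <= e by near: z; exact: (@nbhs0_le R R^o e e0).
    have [->|z0] := eqVneq z 0.
      by rewrite N0 mul0r normr0 ltW.
    rewrite normrM normfV ler_pdivrMr ?normr_gt0 ?expf_neq0// normrX.
    apply: (le_trans (N_le z)); rewrite exprS ler_wpM2r ?exprn_ge0//.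
  - by rewrite /dquot dN0 N0 !mul0r subrr mul0r.
have := DN x => DNx; have i := deriv_inv x0 (deriv_id x).
by rewrite /quot; deriv; rewrite /dquot; field.
Unshelve. all: by end_near. Qed.

Let ddquot x := ddN x / x - 2 * dN x / x ^+ 2 + 2 * N x / x ^+ 3.

Let deriv_dquot x : x != 0 -> is_derive x (1 : R) (dquot N dN) (ddquot x).
Proof.
move=> x0; have := DN x => DNx; have DdNx := DdN x.
have x20 : x ^+ 2 != 0 by rewrite expf_neq0.
have i := deriv_inv (f := fun s => s ^+ 2) (t := x) x20 (deriv_sqr (deriv_id x)).
by rewrite /dquot /ddquot; deriv; rewrite /GRing.scale /=; field.
Qed.

Let ddquot_le x : `|ddquot x| <= 5.
Proof.
rewrite /ddquot; have [->|x0] := eqVneq x 0.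
  by rewrite !expr0n /= invr0 !mulr0 subrr addr0 normr0.
have h (a : R) n : `|a| <= `|x| ^+ n -> `|a / x ^+ n| <= 1.
  move=> an; rewrite normrM normfV ler_pdivrMr ?normr_gt0 ?expf_neq0//.
  by rewrite mul1r normrX.
have := h _ _ (dN_le x); have := h _ _ (N_le x).
have := h (ddN x) 1%N; rewrite !expr1 => /(_ (ddN_le x)).
rewrite -!mulrA; move: (ddN x / x) (dN x / _) (N x / _) => p q r.
by rewrite !ler_norml; lra.
Qed.

(** On a segment avoiding 0 the second derivative is at most 5 = 1 + 2 + 2, one summand for each
    term of [ddquot]. If 0 lies between [x] and [y], then [|x| + |y| = |x - y|] and [dquot_le]
    already gives the constant 2. *)
Lemma dquot_lip x y : `|dquot N dN x - dquot N dN y| <= 5 * `|x - y|.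
Proof.
wlog xy : x y / x <= y.
  have [xy|/ltW yx] := leP x y; first exact.
  by move=> /(_ _ _ yx); rewrite distrC [`|y - x|]distrC.
have samesign : (forall t, x <= t <= y -> t != 0) ->
    `|dquot N dN x - dquot N dN y| <= 5 * `|x - y|.
  move=> nz; rewrite distrC (distrC x) (ger0_norm (x := y - x)) ?subr_ge0//.
  rewrite mulrBr.
  have D5 t : is_derive t (1 : R) (fun s => 5 * s) 5 by deriv; ring.
  apply: (@le_deriv_bound R _ ddquot (fun s => 5 * s) (fun=> 5)) => //.
  - apply: (@deriv_cont_within _ _ _ ddquot) => t /=; rewrite in_itv /= => txy.
    by apply: deriv_dquot; exact: nz.
  - by apply: (@deriv_cont_within _ _ _ (fun=> 5)).
  - by move=> t /andP[/ltW h1 /ltW h2]; apply: deriv_dquot; rewrite nz// h1.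
have [x0|x0] := ltP 0 x.
  by apply: samesign => t /andP[xt _]; rewrite gt_eqF// (lt_le_trans x0).
have [y0|y0] := ltP y 0.
  by apply: samesign => t /andP[_ ty]; rewrite lt_eqF// (le_lt_trans ty).
apply: (le_trans (ler_normB _ _)).
have := dquot_le x; have := dquot_le y.
rewrite (ger0_norm y0) (ler0_norm x0) (ler0_norm (x := x - y)); last lra.
by lra.
Qed.

(** The last clause serves the control law: r_ed' contains the derivative of beta, and the closed
    loop has to be locally Lipschitz in the state. *)
Definition flat_at_0 (g dg : R -> R) : Prop :=
  [/\ forall x, `|g x| <= `|x| ^+ 2, forall x, `|dg x| <= 2 * `|x|,
    forall x, is_derive x (1 : R) g (dg x) &
    forall x y, `|dg x - dg y| <= 5 * `|x - y| ].

Lemma quot_flat : flat_at_0 (quot N) (dquot N dN).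
Proof.
split; [exact: quot_le|exact: dquot_le|exact: deriv_quot|exact: dquot_lip].
Qed.

End Quotient.

Section BetaParts.
Context {R : realType}.

(** The numerator of beta is [- v_d * num_v + u_d * num_u]. This split separates time from psi_e, so
    all questions about the singularity at psi_e = 0 concern functions of one real variable. *)
Definition num_v (x : R) := cos x - 1 + 2^-1 * x ^+ 2.
Definition num_u (x : R) := sin x - x.
Definition dnum_v (x : R) := - sin x + x.
Definition dnum_u (x : R) := cos x - 1.

Lemma sin_le_norm (x : R) : `|sin x| <= `|x|.
Proof.
rewrite -[leRHS]expr1; apply: (@norm_le_pow R sin cos 0%N); first exact: sin0.
by move=> y; rewrite expr0 ler_norml cos_geN1 cos_le1.
Qed.

Lemma cos_sub1_le_norm (x : R) : `|cos x - 1| <= `|x|.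
Proof.
rewrite -[leRHS]expr1.
apply: (@norm_le_pow R (fun y => cos y - 1) (fun y => - sin y) 0%N).
- by rewrite cos0 subrr.
- by move=> y; have := is_derive_cos y => h; deriv; ring.
- by move=> y; rewrite expr0 normrN ler_norml sin_geN1 sin_le1.
Qed.

Definition gv := quot num_v.
Definition gu := quot num_u.
Definition dgv := dquot num_v dnum_v.
Definition dgu := dquot num_u dnum_u.

Lemma gv_flat : flat_at_0 gv dgv.
Proof.
apply: (@quot_flat R num_v dnum_v (fun x => - cos x + 1)).
- by rewrite /num_v cos0; ring.
- by rewrite /dnum_v sin0; ring.
- move=> x; have := is_derive_cos x => ?; rewrite /num_v /dnum_v.
  by deriv; rewrite /GRing.scale /=; field.
- by move=> x; rewrite -normrN opprD opprK cos_sub1_le_norm.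
Qed.

Lemma gu_flat : flat_at_0 gu dgu.
Proof.
apply: (@quot_flat R num_u dnum_u (fun x => - sin x)).
- by rewrite /num_u sin0 subrr.
- by rewrite /dnum_u cos0 subrr.
- by move=> x; have := is_derive_cos x => ?; rewrite /dnum_u; deriv; ring.
- by move=> x; rewrite normrN sin_le_norm.
Qed.

End BetaParts.

(** * Existence of solutions *)

Section Picard.
Context {R : realType}.

(** The intervals of radius 2c/2^k around [a k] are nested, since c/2^k + 2c/2^(k+1) = 2c/2^k; the
    limit is the supremum of their left ends. The explicit rate later makes convergence locally
    uniform in time. *)
Lemma geometric_limit (a : nat -> R) (c : R) :
  (forall k, `|a k.+1 - a k| <= c * 2^-1 ^+ k) ->
  exists l, forall k, `|a k - l| <= 2 * c * 2^-1 ^+ k.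
Proof.
move=> h; pose lo k := a k - 2 * c * 2^-1 ^+ k; pose hi k := a k + 2 * c * 2^-1 ^+ k.
have step k : lo k <= lo k.+1 /\ hi k.+1 <= hi k.
  have := h k; rewrite /lo /hi ler_norml exprS.
  by move: (2^-1 ^+ k) (a k) (a k.+1) => e x y /andP[]; split; lra.
have c0 : 0 <= c by have := h 0%N; rewrite expr0 mulr1; apply: le_trans.
have lohi k : lo k <= hi k.
  by have : 0 <= c * 2^-1 ^+ k; [rewrite mulr_ge0// exprn_ge0|rewrite /lo /hi; lra].
have mono j k : lo j <= hi k.
  have lomono i n : lo i <= lo (i + n)%N.
    elim: n => [|n ih]; first by rewrite addn0.
    by rewrite addnS (le_trans ih)//; case: (step (i + n)%N).
  have himono i n : hi (i + n)%N <= hi i.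
    elim: n => [|n ih]; first by rewrite addn0.
    by rewrite addnS (le_trans _ ih)//; case: (step (i + n)%N).
  by rewrite (le_trans (lomono j k))// (le_trans (lohi _))// addnC himono.
have ubs k : ubound (range lo) (hi k) by move=> _ [j _ <-].
exists (sup (range lo)) => k; rewrite ler_norml.
have : lo k <= sup (range lo).
  by apply: ub_le_sup; [exists (hi 0%N); exact: ubs|exists k].
have : sup (range lo) <= hi k by apply: ge_sup => //; exists (lo 0%N), 0%N.
by rewrite /lo /hi; lra.
Qed.

Lemma half_expr_small (c e : R) : 0 <= c -> 0 < e -> exists k, c * 2^-1 ^+ k < e.
Proof.
move=> c0 e0; exists (Num.truncn (c / e)).+1.
have h := truncnS_gt (c / e).
have h2 k : k%:R <= 2 ^+ k :> R.
  by rewrite -natrX ler_nat; apply/ltnW/ltn_expl.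
rewrite exprVn ltr_pdivrMr ?exprn_gt0//.
rewrite -ltr_pdivrMl// mulrC (lt_le_trans h)//.
Qed.

Variables (n : nat) (t0 L K : R) (y0 : 'rV[R]_n) (F : R -> 'rV[R]_n -> 'rV[R]_n).
Hypothesis L0 : 0 < L.
Hypothesis F_cont : forall (y : 'rV[R]_n) i, continuous (fun s => F s y 0 i).
Hypothesis F_lip : forall t (x y : 'rV[R]_n) (e : R), (forall j, `|x 0 j - y 0 j| <= e) ->
  forall i, `|F t x 0 i - F t y 0 i| <= L * e.
Hypothesis F_bound : forall t i, `|F t y0 0 i| <= K.

(** Continuity in time for each frozen state is enough, because the Lipschitz constant in the state
    is uniform in time. *)
Lemma F_curve_cont (y : R -> 'rV[R]_n) i :
  (forall j, continuous (fun s => y s 0 j)) -> continuous (fun s => F s (y s) 0 i).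
Proof.
move=> cy t; apply/cvgrPdist_le => e e0.
pose e' := e / (2 * (L + 1)).
have L10 : 0 < 2 * (L + 1) by have := L0; lra.
have e'0 : 0 < e' by rewrite divr_gt0.
have e2 : 0 < e / 2 by lra.
near=> s.
have ys j : `|y t 0 j - y s 0 j| <= e'.
  by move: j; near: s; apply: filter_forall => j; exact: ((cvgrPdist_le _ _).1 (cy j t)).
have Fs : `|F t (y t) 0 i - F s (y t) 0 i| <= e / 2.
  near: s; exact: ((cvgrPdist_le _ _).1 (F_cont (y t) i t)).
have := F_lip s _ _ _ ys i.
have : L * e' <= e / 2.
  by rewrite /e' mulrA ler_pdivrMr//; have : 0 <= e * L; [rewrite mulr_ge0// ltW|lra].
rewrite -[F t _ _ _](subrK (F s (y t) 0 i)) -addrA => h1 h2.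
by apply: (le_trans (ler_normD _ _)); lra.
Unshelve. all: by end_near. Qed.

(* In the sup norm weighted by [1 / E], integration of an [L]-Lipschitz field is a
   contraction with ratio 1/2. *)
Let E (t : R) := expR (2 * L * (t - t0)).

Let DE t : is_derive t (1 : R) E (2 * L * E t).
Proof.
rewrite /E; have h : is_derive t (1 : R) (fun s => 2 * L * (s - t0)) (2 * L).
  by deriv; ring.
have i := deriv_comp (g := expR) h (is_derive_expR _).
by apply: (is_derive_eq i); rewrite mulrC.
Qed.

(** The derivative of [c * E] is exactly the assumed bound [2 * L * c * E]. Hence an [L]-Lipschitz
    field loses a factor 2 under integration. *)
Let antideriv_lip (f g If Ig : R -> R) c : 0 <= c ->
  If t0 = 0 -> Ig t0 = 0 -> continuous If -> continuous Ig ->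
  (forall t, t0 < t -> is_derive t (1 : R) If (f t)) ->
  (forall t, t0 < t -> is_derive t (1 : R) Ig (g t)) ->
  (forall t, t0 < t -> `|f t - g t| <= 2 * L * c * E t) ->
  forall t, t0 <= t -> `|If t - Ig t| <= c * E t.
Proof.
move=> c0 If0 Ig0 cI cJ DI DJ b t tt0.
have := @le_deriv_bound R (fun s => If s - Ig s) (fun s => f s - g s)
  (fun s => c * E s) (fun s => 2 * L * c * E s) t0 t tt0.
rewrite If0 Ig0 subrr subr0 => h.
have Et0 : E t0 = 1 by rewrite /E subrr mulr0 expR0.
apply: (le_trans (h _ _ _ _ _)).
- by apply: continuous_subspaceT; cont.
- apply: (@deriv_cont_within _ _ _ (fun s => 2 * L * c * E s)) => s _.
  by have := DE s => ?; deriv; ring.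
- by move=> s /andP[t0s _]; have := DI s t0s => ?; have := DJ s t0s => ?; deriv.
- by move=> s _; have := DE s => ?; deriv; ring.
- by move=> s /andP[t0s _]; exact: b.
- by rewrite Et0 mulr1 lerBlDr lerDl.
Qed.

Lemma picard : exists y : R -> 'rV[R]_n,
  [/\ y t0 = y0, forall i, continuous (fun s => y s 0 i) &
   forall t, t0 < t -> forall i,
     is_derive t (1 : R) (fun s => y s 0 i) (F t (y t) 0 i)].
Proof.
pose spec (f If : R -> R) := continuous f -> [/\ forall t, t <= t0 -> If t = 0, continuous If &
  forall t, t0 < t -> is_derive t (1 : R) If (f t)].
(* An antiderivative operator obtained by choice; [spec] asks nothing of it on discontinuous
   functions, where the value is arbitrary. *)
have [I IP] : {I : (R -> R) -> R -> R & forall f, spec f (I f)}.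
  apply: (@choice _ _ spec) => f.
  have [cf|ncf] := pselect (continuous f); last by exists f.
  by have [G GP] := antiderivative f t0 cf; exists G.
pose step (Y : R -> 'rV[R]_n) t : 'rV[R]_n :=
  \row_i (y0 0 i + I (fun s => F s (Y s) 0 i) t).
pose Y k := iter k step (fun=> y0).
have stepE Z t i : step Z t 0 i = y0 0 i + I (fun s => F s (Z s) 0 i) t.
  by rewrite mxE.
have stepC (Z : R -> 'rV[R]_n) : (forall i, continuous (fun s => Z s 0 i)) ->
    forall i, continuous (fun s => step Z s 0 i).
  move=> cZ i; have [_ cI _] := IP _ (F_curve_cont _ i cZ).
  rewrite (_ : (fun s => _) = (fun s => y0 0 i + I (fun s => F s (Z s) 0 i) s)).
    by cont.
  by apply/funext => s; rewrite stepE.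
have YC k i : continuous (fun s => Y k s 0 i).
  by elim: k i => [|k ih] i; [exact: cont_cst|exact: stepC].
(* Weighted distance between the first two iterates: the first integrand is bounded by
   [|K| = 2 * L * C], which is at most [2 * L * C * E]. *)
pose C := `|K| / (2 * L).
have C0 : 0 <= C by rewrite divr_ge0// mulr_ge0// ltW.
have E_ge0 t : 0 <= E t by exact: expR_ge0.
have E_ge1 t : t0 <= t -> 1 <= E t.
  move=> tt0; rewrite -expR0 ler_expR mulr_ge0 ?subr_ge0//.
  by rewrite mulr_ge0// ltW.
have step_left (Z : R -> 'rV[R]_n) t : (forall i, continuous (fun s => Z s 0 i)) -> t <= t0 ->
    step Z t = y0.
  move=> cZ tt0; apply/rowP => i; rewrite stepE.
  by have [-> // _ _] := IP _ (F_curve_cont _ i cZ); rewrite addr0.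
have step_lip (Z Z' : R -> 'rV[R]_n) c : 0 <= c -> (forall i, continuous (fun s => Z s 0 i)) ->
    (forall i, continuous (fun s => Z' s 0 i)) ->
    (forall t, t0 <= t -> forall i, `|Z t 0 i - Z' t 0 i| <= c * E t) ->
    forall t, t0 <= t -> forall i, `|step Z t 0 i - step Z' t 0 i| <= c / 2 * E t.
  move=> c0 cZ cZ' b t tt0 i; rewrite !stepE.
  have [I0 cI DI] := IP _ (F_curve_cont _ i cZ).
  have [J0 cJ DJ] := IP _ (F_curve_cont _ i cZ').
  rewrite (_ : y0 0 i + _ - _ = I (fun s => F s (Z s) 0 i) t - I (fun s => F s (Z' s) 0 i) t); last by ring.
  apply: antideriv_lip cI cJ DI DJ _ _ tt0; rewrite ?I0 ?J0//.
    by rewrite divr_ge0.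
  move=> s /ltW t0s; have := F_lip s _ _ _ (b s t0s) i.
  by move/le_trans; apply; have := E_ge0 s => ?; rewrite le_eqVlt; apply/orP; left; apply/eqP; field.
have Ydiff k t : t0 <= t -> forall i, `|Y k.+1 t 0 i - Y k t 0 i| <= C * 2^-1 ^+ k * E t.
  elim: k t => [|k ih] t tt0 i.
    rewrite expr0 mulr1 /Y /= stepE addrAC subrr add0r.
    have [I0 cI DI] := IP _ (F_curve_cont _ i (fun j => cont_cst (T := R) (y0 0 j))).
    rewrite -[I _ t]subr0.
    apply: (@antideriv_lip _ (fun=> 0) _ (fun=> 0) C C0 _ _ cI _ DI _ _ t tt0).
    + by rewrite I0.
    + by [].
    + exact: cont_cst.
    + move=> s /ltW t0s; rewrite subr0 (le_trans (F_bound _ _))//.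
      rewrite (le_trans (ler_norm _))// (_ : 2 * L * C = `|K|); last first.
        by rewrite /C; field; rewrite gt_eqF.
      by rewrite ler_peMr// E_ge1.
  rewrite exprSr mulrA.
  apply: (step_lip (Y k.+1) (Y k)) => //; rewrite mulr_ge0// exprn_ge0//.
(* All iterates equal [y0] up to [t0], so with [Num.max t t0] the bound holds on the whole line and
   continuity of the limit at [t0] is two-sided. *)
have lims t i : exists l, forall k, `|Y k t 0 i - l| <= 2 * (C * E (Num.max t t0)) * 2^-1 ^+ k.
  apply: geometric_limit => k; have [tt0|/ltW tt0] := leP t0 t.
    rewrite (le_trans (Ydiff k t tt0 i))// le_eqVlt.
    by apply/orP; left; apply/eqP; ring.
  have Yl j : Y j t = y0 by case: j => [//|j]; exact: step_left.
  rewrite !Yl subrr normr0; apply: mulr_ge0; first exact: mulr_ge0.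
  by rewrite exprn_ge0.
have [y yP] : {y : R -> 'rV[R]_n & forall t i k,
    `|Y k t 0 i - y t 0 i| <= 2 * (C * E (Num.max t t0)) * 2^-1 ^+ k}.
  have [f fP] := choice (fun p : R * 'I_n => lims p.1 p.2).
  by exists (fun t => \row_i f (t, i)) => t i k; rewrite mxE; exact: (fP (t, i)).
have yC i : continuous (fun s => y s 0 i).
  move=> t; apply/cvgrPdist_le => e e0.
  pose M := 2 * (C * E (Num.max (t + 1) t0)).
  have M0 : 0 <= M by apply: mulr_ge0 => //; exact: mulr_ge0.
  have e3 : 0 < e / 3 by rewrite divr_gt0.
  have [k kP] := half_expr_small M (e / 3) M0 e3.
  (* [E] increases, so one [k] works for all [s <= t + 1]: convergence is uniform near [t], and the
     limit is continuous by the usual three-term estimate. *)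
  have close s : s <= t + 1 -> `|Y k s 0 i - y s 0 i| <= e / 3.
    move=> st; apply: (le_trans (yP s i k)); apply: le_trans (ltW kP).
    rewrite ler_wpM2r ?exprn_ge0// ler_pM2l// ler_wpM2l// /E ler_expR.
    have L20 : 0 <= 2 * L by rewrite mulr_ge0// ltW.
    by rewrite (ler_wpM2l L20)// lerD2r ge_max !le_max st lexx orbT.
  near=> s.
  have st : s <= t + 1 by apply/ltW; near: s; apply: lt_nbhsl; rewrite ltrDl.
  have Ys : `|Y k t 0 i - Y k s 0 i| <= e / 3.
    by near: s; apply: ((cvgrPdist_le _ _).1 (YC k i t)); lra.
  have := close t; have := close s st.
  rewrite (_ : t <= t + 1) ?lerDl// => h1 /(_ isT) h2.
  rewrite (_ : y t 0 i - y s 0 i = - (Y k t 0 i - y t 0 i) +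
    ((Y k t 0 i - Y k s 0 i) + (Y k s 0 i - y s 0 i))); last by ring.
  apply: (le_trans (ler_normD _ _)); rewrite normrN.
  by have := ler_normD (Y k t 0 i - Y k s 0 i) (Y k s 0 i - y s 0 i); lra.
have yE t i : t0 <= t -> y t 0 i = step y t 0 i.
  move=> tt0; apply/eqP; rewrite -subr_eq0 -normr_le0; apply/ler_addgt0Pl => e e0.
  rewrite addr0.
  have B0 : 0 <= 2 * (C * E t) by apply: mulr_ge0 => //; exact: mulr_ge0.
  have e2 : 0 < e / 2 by rewrite divr_gt0.
  have [k kP] := half_expr_small (2 * (C * E t)) (e / 2) B0 e2.
  have h1 := yP t i k.+1; rewrite (max_idPl tt0) exprS in h1.
  (* [step (Y k)] is [Y k.+1]. It is close to [y] by convergence and close to [step y] by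
     contraction, so [y] is a fixed point. *)
  have h2 : `|step (Y k) t 0 i - step y t 0 i| <= 2 * C * 2^-1 ^+ k / 2 * E t.
    apply: step_lip => //; first by rewrite mulr_ge0 ?exprn_ge0//; exact: mulr_ge0.
    move=> s t0s j; have := yP s j k; rewrite (max_idPl t0s).
    by rewrite (_ : 2 * (C * E s) * _ = 2 * C * 2^-1 ^+ k * E s)//; ring.
  rewrite -[step (Y k)]/(Y k.+1) in h2.
  have := ler_distD (Y k.+1 t 0 i) (y t 0 i) (step y t 0 i).
  move=> /le_trans; apply; rewrite (distrC (y t 0 i) (Y k.+1 t 0 i)).
  move: h1 h2 kP; move: (2^-1 ^+ k) (E t) (`|_|) (`|_|) => p q n1 n2.
  rewrite (_ : 2 * (C * q) * (2^-1 * p) = C * q * p); last by field.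
  rewrite (_ : 2 * C * p / 2 * q = C * q * p); last by field.
  by rewrite (_ : 2 * (C * q) * p = 2 * (C * q * p)); [lra|ring].
exists y; split => //.
- by apply/rowP => i; rewrite yE// step_left.
- move=> t t0t i; have [I0 cI DI] := IP _ (F_curve_cont _ i yC).
  have h : is_derive t (1 : R) (fun s => y0 0 i + I (fun s => F s (y s) 0 i) s)
     (F t (y t) 0 i).
    by have := DI t t0t => ?; deriv; rewrite add0r.
  apply: near_eq_is_derive h; near=> s; rewrite yE ?stepE//.
  by apply/ltW; near: s; exact: lt_nbhsr.
Unshelve. all: by end_near. Qed.

End Picard.

(** * Fields bounded and Lipschitz on boxes, uniformly in time *)

Section BoundedLipschitz.
Context {R : realType} {n : nat}.
Implicit Types (t m : R) (x y : 'rV[R]_n) (g : R -> 'rV[R]_n -> R).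

Definition in_box m x := forall i, `|x 0 i| <= m.

(** Boundedness is carried along because the Lipschitz bound of a product needs it. [e] is any bound
    on the coordinates of [x - y], so no norm has to be computed. *)
Definition bounded_lipschitz (t0 m : R) g := exists2 K : R, 0 <= K &
  forall t x y e, t0 <= t -> in_box m x -> in_box m y -> in_box e (x - y) ->
    `|g t x| <= K /\ `|g t x - g t y| <= K * e.

Variables (t0 m : R).
Hypothesis n0 : (0 < n)%N.
Local Notation BL := (bounded_lipschitz t0 m).

Lemma in_box_ge0 x e : in_box e x -> 0 <= e.
Proof. by move=> /(_ (Ordinal n0)); exact: le_trans. Qed.

Lemma BL_signal (s : R -> R) : L_infty t0 s -> BL (fun t _ => s t).
Proof.
move=> [M h]; exists `|M| => // t x y e t0t _ _ /in_box_ge0 e0.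
by rewrite subrr normr0 mulr_ge0// (le_trans (h t t0t))// ler_norm.
Qed.

Lemma BL_cst (a : R) : BL (fun _ _ => a).
Proof. by apply: BL_signal; exists `|a|. Qed.

Lemma BL_coord i : BL (fun _ x => x 0 i).
Proof.
exists (`|m| + 1); first by rewrite addr_ge0.
move=> t x y e t0t xm ym xye; split.
  by rewrite (le_trans (xm i))// (le_trans (ler_norm m))// lerDl.
have e0 := in_box_ge0 _ _ xye; have := xye i; rewrite !mxE => /le_trans; apply.
by rewrite ler_peMl// lerDr.
Qed.

Lemma BL_add g h : BL g -> BL h -> BL (fun t x => g t x + h t x).
Proof.
move=> [K K0 gK] [H H0 hH]; exists (K + H); first exact: addr_ge0.
move=> t x y e t0t xm ym xye.
have [g1 g2] := gK t x y e t0t xm ym xye.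
have [h1 h2] := hH t x y e t0t xm ym xye; split.
  by rewrite (le_trans (ler_normD _ _))// lerD.
by rewrite opprD addrACA mulrDl (le_trans (ler_normD _ _))// lerD.
Qed.

Lemma BL_opp g : BL g -> BL (fun t x => - g t x).
Proof.
move=> [K K0 gK]; exists K => // t x y e t0t xm ym xye.
by rewrite normrN -opprD normrN; exact: gK.
Qed.

Lemma BL_mul g h : BL g -> BL h -> BL (fun t x => g t x * h t x).
Proof.
move=> [K K0 gK] [H H0 hH]; exists (2 * (K * H)); first by rewrite !mulr_ge0.
move=> t x y e t0t xm ym xye; have e0 := in_box_ge0 _ _ xye.
have yxe : in_box e (y - y) by move=> i; rewrite subrr mxE normr0.
have [g1 g2] := gK t x y e t0t xm ym xye.
have [h1 h2] := hH t x y e t0t xm ym xye.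
have [g3 _] := gK t y y e t0t ym ym yxe.
split.
  rewrite normrM (le_trans (ler_pM _ _ g1 h1))// ler_peMl ?mulr_ge0//; lra.
rewrite (_ : _ - _ = (g t x - g t y) * h t x + g t y * (h t x - h t y)); last by ring.
rewrite (le_trans (ler_normD _ _))// !normrM.
rewrite (le_trans (lerD (ler_pM _ _ g2 h1) (ler_pM _ _ g3 h2)))//.
by rewrite le_eqVlt; apply/orP; left; apply/eqP; ring.
Qed.

Lemma BL_exp g k : BL g -> BL (fun t x => g t x ^+ k).
Proof.
move=> hg; elim: k => [|k ih]; first exact: BL_cst.
rewrite (_ : (fun t x => _) = (fun t x => g t x * g t x ^+ k)); first exact: BL_mul.
by apply/funext => t; apply/funext => x; rewrite exprS.
Qed.

Lemma BL_comp (h : R -> R) g :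
  (forall M, 0 <= M -> exists2 H, 0 <= H & forall a b, `|a| <= M -> `|b| <= M ->
     `|h a - h b| <= H * `|a - b|) -> BL g -> BL (fun t x => h (g t x)).
Proof.
move=> hl [K K0 gK]; have [H H0 hH] := hl K K0.
exists (`|h 0| + H * K + H * K); first by rewrite !addr_ge0 ?mulr_ge0.
move=> t x y e t0t xm ym xye; have e0 := in_box_ge0 _ _ xye.
have yxe : in_box e (y - y) by move=> i; rewrite subrr mxE normr0.
have [g1 g2] := gK t x y e t0t xm ym xye.
have [g3 _] := gK t y y e t0t ym ym yxe.
split.
  have := hH (g t x) 0 g1; rewrite normr0 subr0 => /(_ K0) h1.
  rewrite -[h (g t x)](subrK (h 0)) addrC (le_trans (ler_normD _ _))//.
  rewrite -addrA lerD// (le_trans h1)// (le_trans (ler_wpM2l H0 g1))//.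
  by rewrite lerDl mulr_ge0.
rewrite (le_trans (hH _ _ g1 g3))// (le_trans (ler_wpM2l H0 g2))//.
by rewrite mulrA ler_wpM2r// lerDr addr_ge0// mulr_ge0.
Qed.

End BoundedLipschitz.

Ltac BL := repeat first
  [ assumption | apply: BL_cst; assumption | apply: BL_coord; assumption
  | apply: BL_add | apply: BL_opp | apply: BL_mul; [assumption|..]
  | apply: BL_exp; [assumption|..] ].

Section EuclideanNorm.
Context {R : realType} {n : nat}.
Implicit Types x y : 'rV[R]_n.

Lemma coord_le_enorm x i : `|x 0 i| <= enorm x.
Proof.
rewrite /enorm -sqrtr_sqr ler_sqrt; last by apply: sumr_ge0 => j _; exact: sqr_ge0.
by rewrite (bigD1 i)//= lerDl; apply: sumr_ge0 => j _; exact: sqr_ge0.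
Qed.

Lemma enorm_ge0 x : 0 <= enorm x. Proof. exact: sqrtr_ge0. Qed.

Lemma enorm_le (e : R) x : 0 <= e -> in_box e x -> enorm x <= n%:R * e.
Proof.
move=> e0 xe; rewrite -[leRHS]ger0_norm ?mulr_ge0//.
rewrite -sqrtr_sqr ler_sqrt; last exact: sqr_ge0.
apply: (@le_trans _ _ (\sum_(i < n) e ^+ 2)).
  by apply: ler_sum => i _; rewrite -real_normK ?num_real// lerXn2r ?nnegrE.
rewrite sumr_const card_ord -[leLHS]mulr_natl exprMn ler_wpM2r ?sqr_ge0//.
by rewrite -natrX ler_nat; case: n => // k; rewrite expnS leq_pmulr// expn_gt0.
Qed.

(** The unit ball around [x0] lies in the box of half-width [enorm x0 + 1]; going from coordinates
    to the Euclidean norm costs a factor [n]. *)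
Lemma lipschitz_of_BL (t0 : R) (f : R -> 'rV[R]_n -> 'rV[R]_n) : (0 < n)%N ->
  (forall m i, bounded_lipschitz t0 m (fun t x => f t x 0 i)) ->
  locally_lipschitz_in_state t0 f.
Proof.
move=> n0 fBL x0 T; exists 1 => //; pose m := enorm x0 + 1.
have /choice [K KP] : forall i, exists K, 0 <= K /\
  forall t x y e, t0 <= t -> in_box m x -> in_box m y -> in_box e (x - y) ->
    `|f t x 0 i| <= K /\ `|f t x 0 i - f t y 0 i| <= K * e.
  by move=> i; have [K K0 hK] := fBL m i; exists K.
pose S := \sum_i K i.
have K0 i : 0 <= K i by case: (KP i).
have KS i : K i <= S by rewrite /S (bigD1 i)//= lerDl sumr_ge0.
have S0 : 0 <= S by exact: sumr_ge0.
exists (n%:R * S) => t x y /andP[t0t _] xx0 yx0.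
have near_box z : enorm (z - x0) < 1 -> in_box m z.
  move=> h i; rewrite -[z](subrK x0) mxE (le_trans (ler_normD _ _))// addrC.
  rewrite lerD ?coord_le_enorm//; apply: le_trans (ltW h); exact: coord_le_enorm.
rewrite -mulrA; apply: enorm_le; first by rewrite mulr_ge0// enorm_ge0.
move=> i; rewrite !mxE; have [_ h] := KP i.
have [_ {}h] := h t x y _ t0t (near_box _ xx0) (near_box _ yx0)
  (fun i => coord_le_enorm (x - y) i).
by rewrite (le_trans h)// ler_wpM2r// enorm_ge0.
Qed.

End EuclideanNorm.

(** * Truncation of a field to a box *)

Section Truncation.
Context {R : realType} {n : nat}.
Implicit Types (x y : 'rV[R]_n) (m a b : R).

Lemma row_norm_le x m : 0 <= m -> in_box m x -> `|x| <= m.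
Proof.
move=> m0 xm; rewrite -[`|x|]/(mx_norm x) mx_normrE; apply/bigmax_leP; split=> // -[i j] _ /=.
by rewrite ord1.
Qed.

Lemma coord_le_row_norm x i : `|x 0 i| <= `|x|.
Proof.
by rewrite -[leRHS]/(mx_norm x) mx_normrE; apply: (le_bigmax _ (fun ij => `|x ij.1 ij.2|) (0, i)).
Qed.

Definition clamp (lo hi a : R) := Num.max lo (Num.min hi a).

Lemma clamp_lip lo hi a b : `|clamp lo hi a - clamp lo hi b| <= `|a - b|.
Proof.
have max_lip c p q : `|Num.max c p - Num.max c q| <= `|p - q :> R|.
  have h1 := ler_norm (p - q); have := ler_norm (- (p - q)); rewrite normrN => h2.
  by rewrite ler_norml; case: (leP c p); case: (leP c q) => ? ?; lra.
have min_lip c p q : `|Num.min c p - Num.min c q| <= `|p - q :> R|.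
  have h1 := ler_norm (p - q); have := ler_norm (- (p - q)); rewrite normrN => h2.
  by rewrite ler_norml; case: (leP c p); case: (leP c q) => ? ?; lra.
exact: le_trans (max_lip _ _ _) (min_lip _ _ _).
Qed.

Lemma clamp_norm m a : 0 <= m -> `|clamp (- m) m a| <= m.
Proof.
move=> m0; rewrite /clamp ler_norml le_max lexx /= ge_max ge_min lexx.
by rewrite andbT; lra.
Qed.

Lemma clamp_id m a : `|a| <= m -> clamp (- m) m a = a.
Proof. by rewrite ler_norml => /andP[h1 h2]; rewrite /clamp (min_idPr h2) (max_idPr h1). Qed.

Lemma clamp01 a : 0 <= clamp 0 1 a <= 1.
Proof. by rewrite /clamp le_max lexx /= ge_max ge_min ler01 lexx. Qed.

(** Freezing time at [t0] turns continuity on the half-line into continuity on the whole line, as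
    [picard] demands. *)
Lemma continuous_maxl (t0 : R) (g : R -> R) : {within `[t0, +oo[, continuous g} ->
  continuous (fun t => g (Num.max t t0)).
Proof.
move=> /subspace_continuousP gc t.
have A s : `[t0, +oo[%classic (Num.max s t0) by rewrite /= in_itv /= le_max lexx orbT.
have cm : continuous (fun s : R => Num.max s t0).
  by move=> s; apply: continuous_max; [exact: cvg_id|exact: cst_continuous].
apply: cvg_comp (gc _ (A t)) => P PA.
have h : nbhs t (fun s => `[t0, +oo[%classic (Num.max s t0) -> P (Num.max s t0)).
  exact: cm t _ PA.
by apply: (filterS _ h) => s; apply; exact: A.
Qed.

(* [chi] is the cutoff along the solution of the truncated problem. *)
Lemma bounded_ivp (t0 m : R) (F : R -> 'rV[R]_n -> 'rV[R]_n) y0 : (0 < n)%N ->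
  1 <= m ->
  (forall i, bounded_lipschitz t0 m (fun t y => F t y 0 i)) ->
  (forall y i, {within `[t0, +oo[, continuous (fun t => F t y 0 i)}) ->
  (forall (y : R -> 'rV[R]_n) (chi : R -> R), y t0 = y0 ->
    (forall i, continuous (fun s => y s 0 i)) ->
    (forall t, t0 < t -> 0 <= chi t /\
       forall i, is_derive t (1 : R) (fun s => y s 0 i) (chi t * F t (y t) 0 i)) ->
    forall t, t0 <= t -> in_box (m - 1) (y t)) ->
  exists y : R -> 'rV[R]_n, [/\ y t0 = y0,
    forall i, continuous (fun s => y s 0 i) &
    forall t, t0 < t -> forall i,
     is_derive t (1 : R) (fun s => y s 0 i) (F t (y t) 0 i)].
Proof.
move=> n0 m1 FBL Fcont apriori; have m0 : 0 <= m by lra.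
pose clip y : 'rV[R]_n := \row_i clamp (- m) m (y 0 i).
pose chi y := clamp 0 1 (m - `|y|).
pose G t y : 'rV[R]_n := \row_i (chi y * F (Num.max t t0) (clip y) 0 i).
have clip_box y : in_box m (clip y) by move=> i; rewrite mxE clamp_norm.
have clip_id y : in_box m y -> clip y = y.
  by move=> ym; apply/rowP => i; rewrite mxE clamp_id.
have dbox x y : in_box m x -> in_box m y -> in_box (m + m) (x - y).
  move=> xm ym j; rewrite !mxE (le_trans (ler_normB _ _))//.
  by apply: lerD; [exact: xm|exact: ym].
(* Wherever [clip] alters [y] the cutoff vanishes. So [G], although globally Lipschitz, is a
   nonnegative multiple of the true field everywhere, which is what the a priori bound is about. *)
have chi_clip t y i : G t y 0 i = chi y * F (Num.max t t0) y 0 i.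
  rewrite mxE; have [/clip_id -> //|ym] := pselect (in_box m y).
  suff -> : chi y = 0 by rewrite !mul0r.
  rewrite /chi /clamp; apply/max_idPl; rewrite ge_min subr_le0.
  have [_|/ltW ymm] := leP m `|y|; first by rewrite orbT.
  by exfalso; apply: ym => j; apply: le_trans ymm; exact: coord_le_row_norm.
have /choice [K KP] : forall i, exists K, 0 <= K /\
  forall t x y e, t0 <= t -> in_box m x -> in_box m y -> in_box e (x - y) ->
    `|F t x 0 i| <= K /\ `|F t x 0 i - F t y 0 i| <= K * e.
  by move=> i; have [K K0 hK] := FBL i; exists K.
pose S := \sum_i K i.
have K0 i : 0 <= K i by case: (KP i).
have KS i : K i <= S by rewrite /S (bigD1 i)//= lerDl sumr_ge0.
have S0 : 0 <= S by exact: sumr_ge0.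
have tmax t : t0 <= Num.max t t0 by rewrite le_max lexx orbT.
(* One [S] comes from the Lipschitz bound on [F], the other from the 1-Lipschitz cutoff times the
   bound on [F]; the 1 makes the constant positive. *)
have [|||| y [y_t0 yc yD]] := @picard R n t0 (2 * S + 1) S y0 G.
- by have := S0; lra.
- move=> y i; rewrite (_ : (fun s => _) =
    (fun s => chi y * F (Num.max s t0) (clip y) 0 i)); last first.
    by apply/funext => s; rewrite mxE.
  by apply: cont_mul; [exact: cont_cst|exact: continuous_maxl (Fcont _ i)].
- move=> t x y e xye i; rewrite !mxE.
  have e0 : 0 <= e by exact: le_trans (xye (Ordinal n0)).
  have cxy : in_box e (clip x - clip y).
    by move=> j; rewrite !mxE (le_trans (clamp_lip _ _ _ _)).
  have [_ h] := KP i.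
  have [F1 F2] := h _ _ _ _ (tmax t) (clip_box x) (clip_box y) cxy.
  have {h}[F3 _] := h _ _ _ _ (tmax t) (clip_box y) (clip_box x)
    (dbox _ _ (clip_box y) (clip_box x)).
  move: F1 F2 F3; set Fx := F _ _ _ _; set Fy := F _ _ _ _ => F1 F2 F3.
  rewrite (_ : _ - _ = chi x * (Fx - Fy) + (chi x - chi y) * Fy); last by ring.
  have /andP[c0 c1] := clamp01 (m - `|x|).
  have c2 : `|chi x - chi y| <= e.
    rewrite (le_trans (clamp_lip _ _ _ _))// (_ : _ - _ = `|y| - `|x|); last by ring.
    rewrite (le_trans (ler_dist_dist _ _))// distrC row_norm_le// => j.
    by rewrite !mxE.
  rewrite (le_trans (ler_normD _ _))// !normrM (ger0_norm c0).
  have h1 : chi x * `|Fx - Fy| <= S * e.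
    by rewrite -[leRHS]mul1r ler_pM// (le_trans F2)// ler_wpM2r.
  have h2 : `|chi x - chi y| * `|Fy| <= e * S by rewrite ler_pM// (le_trans F3).
  by move: h1 h2 e0; rewrite /chi; lra.
- move=> t i; rewrite mxE normrM.
  have /andP[c0 c1] := clamp01 (m - `|y0|).
  have [_ h] := KP i.
  have [F1 _] := h _ _ _ _ (tmax t) (clip_box y0) (clip_box y0)
    (dbox _ _ (clip_box y0) (clip_box y0)).
  by rewrite -[leRHS]mul1r ler_pM// ?(le_trans F1)// ger0_norm.
have yD' t : t0 < t -> 0 <= chi (y t) /\ forall i,
    is_derive t (1 : R) (fun s => y s 0 i) (chi (y t) * F t (y t) 0 i).
  move=> t0t; split; first by case/andP: (clamp01 (m - `|y t|)).
  by move=> i; have := yD t t0t i; rewrite chi_clip (max_idPl (ltW t0t)).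
have ybox := apriori y (fun t => chi (y t)) y_t0 yc yD'.
exists y; split=> // t t0t i; have [_ /(_ i)] := yD' t t0t.
(* The a priori bound is [m - 1] rather than [m] because the cutoff descends from 1 to 0 between
   norms [m - 1] and [m]. *)
have -> : chi (y t) = 1.
  have : `|y t| <= m - 1 by apply: row_norm_le; [lra|exact: ybox (ltW t0t)].
  by move=> h; rewrite /chi /clamp (min_idPl _) ?(max_idPr ler01)//; lra.
by rewrite mul1r.
Qed.

End Truncation.

(** * The reference signals *)

Section BetaCalculus.
Context {R : realType}.
Variables (c d : R) (ref : reference R).

(** The convention x / 0 = 0 absorbs the case distinction at psi_e = 0. *)
Lemma betaE t psi : beta ref t psi = - v_d ref t * gv psi + u_d ref t * gu psi.
Proof.
rewrite /beta /beta_num /gv /gu /quot /num_v /num_u; case: eqP => [->|_].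
  by rewrite invr0 !mulr0 addr0.
by ring.
Qed.

Lemma dbetaE t psi dpsi : dbeta ref t psi dpsi =
  - dv_d ref t * gv psi - v_d ref t * dgv psi * dpsi
  + du_d ref t * gu psi + u_d ref t * dgu psi * dpsi.
Proof.
rewrite /dbeta /dbeta_num /beta_num /gv /gu /dgv /dgu /quot /dquot.
rewrite /num_v /num_u /dnum_v /dnum_u; case: eqP => [->|/eqP psi0].
  by rewrite !expr0n /= invr0 !mulr0 !mul0r subr0 !addr0.
by field.
Qed.

(** The value 0 prescribed for the derivative at psi_e = 0 is the genuine one, because [gv] and [gu]
    vanish there together with their derivatives. *)
Lemma deriv_beta t (psi : R -> R) dpsi :
  is_derive t (1 : R) (u_d ref) (du_d ref t) ->
  is_derive t (1 : R) (v_d ref) (dv_d ref t) ->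
  is_derive t (1 : R) psi dpsi ->
  is_derive t (1 : R) (fun s => beta ref s (psi s)) (dbeta ref t (psi t) dpsi).
Proof.
move=> Du Dv Dpsi.
have [_ _ Dgv _] := @gv_flat R; have [_ _ Dgu _] := @gu_flat R.
have Hv := deriv_comp Dpsi (Dgv (psi t)); have Hu := deriv_comp Dpsi (Dgu (psi t)).
rewrite (_ : (fun s => _) =
  (fun s => - v_d ref s * gv (psi s) + u_d ref s * gu (psi s))); last first.
  by apply/funext => s; rewrite betaE.
by rewrite dbetaE; deriv; ring.
Qed.

Lemma deriv_sigma t (psi : R -> R) dpsi :
  is_derive t (1 : R) (u_d ref) (du_d ref t) ->
  is_derive t (1 : R) (du_d ref) (ddu_d ref t) ->
  is_derive t (1 : R) (v_d ref) (dv_d ref t) ->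
  is_derive t (1 : R) psi dpsi ->
  is_derive t (1 : R) (fun s => sigma c d ref s (psi s)) (dsigma c d ref t (psi t) dpsi).
Proof.
move=> Du Ddu Dv Dpsi; have Db := deriv_beta t psi dpsi Du Dv Dpsi.
by rewrite /sigma /dsigma; deriv; ring.
Qed.

Lemma deriv_r_ed (k1 k2 t : R) (x : R -> 'rV[R]_4) :
  is_derive t (1 : R) (u_d ref) (du_d ref t) ->
  is_derive t (1 : R) (du_d ref) (ddu_d ref t) ->
  is_derive t (1 : R) (v_d ref) (dv_d ref t) ->
  is_derive t (1 : R) (fun s => z_e (x s)) (dz_e c d ref t (x t)) ->
  is_derive t (1 : R) (fun s => psi_e (x s)) (r_e (x t)) ->
  is_derive t (1 : R) (fun s => r_ed c d ref k1 k2 s (x s)) (dr_ed c d ref k1 k2 t (x t)).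
Proof.
move=> Du Ddu Dv Dz Dpsi.
have Ds := deriv_sigma t (fun s => psi_e (x s)) _ Du Ddu Dv Dpsi.
by rewrite /r_ed /dr_ed; deriv; ring.
Qed.

End BetaCalculus.

(** * Piecewise continuous functions of time *)

Section PiecewiseContinuity.
Context {R : realType}.
Variable t0 : R.
Implicit Types g h : R -> R.

Lemma pc_of_within g : {within `[t0, +oo[, continuous g} -> piecewise_continuous t0 g.
Proof.
move=> /subspace_continuousP gc; exists set0; first exact: locally_finite0.
have A t : t0 <= t -> `[t0, +oo[%classic t by move=> h; rewrite /= in_itv /= h.
split=> [t t0t _|t t0t|t t0t]; first exact: gc (A t t0t).
- apply: (cvgP (g t)) => P gP; have := gc t (A t t0t) P gP.
  rewrite /= !near_simpl !near_withinE; apply: filterS => s h ts.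
  by apply: h; apply: A; rewrite (le_trans t0t)// ltW.
- apply: (cvgP (g t)) => P gP; have := gc t (A t (ltW t0t)) P gP.
  rewrite /= !near_simpl !near_withinE => h.
  near=> s => st; suff : t0 <= s by move=> t0s; move: (A s t0s); near: s.
  by apply/ltW; near: s; exact: lt_nbhsr.
Unshelve. all: by end_near. Qed.

Lemma pc_add g h : piecewise_continuous t0 g -> piecewise_continuous t0 h ->
  piecewise_continuous t0 (fun t => g t + h t).
Proof.
move=> [E lE [a1 a2 a3]] [F lF [b1 b2 b3]].
exists (E `|` F); first exact: locally_finiteU.
split=> t t0t; last 2 first.
- by apply: is_cvgD; [exact: a2|exact: b2].
- by apply: is_cvgD; [exact: a3|exact: b3].
by move=> /not_orP[nE nF]; apply: cvgD; [exact: a1|exact: b1].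
Qed.

Lemma pc_mul g h : piecewise_continuous t0 g -> piecewise_continuous t0 h ->
  piecewise_continuous t0 (fun t => g t * h t).
Proof.
move=> [E lE [a1 a2 a3]] [F lF [b1 b2 b3]].
exists (E `|` F); first exact: locally_finiteU.
split=> t t0t; last 2 first.
- by apply: is_cvgM; [exact: a2|exact: b2].
- by apply: is_cvgM; [exact: a3|exact: b3].
by move=> /not_orP[nE nF]; apply: cvgM; [exact: a1|exact: b1].
Qed.

Lemma pc_cst (a : R) : piecewise_continuous t0 (fun=> a).
Proof. by apply: pc_of_within; exact: cont_cst. Qed.

Lemma pc_opp g : piecewise_continuous t0 g -> piecewise_continuous t0 (fun t => - g t).
Proof.
move=> hg; have := pc_mul _ _ (pc_cst (-1)) hg.
by under eq_fun do rewrite mulN1r.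
Qed.

Lemma pc_ext g h : (forall t, t0 <= t -> g t = h t) ->
  piecewise_continuous t0 g -> piecewise_continuous t0 h.
Proof.
move=> gh [E lE [a1 a2 a3]]; exists E => //; split=> [t t0t nE|t t0t|t t0t].
- rewrite -gh//; apply: cvg_trans (a1 t t0t nE); apply: near_eq_cvg.
  rewrite near_withinE; apply: nearW => s /=; rewrite in_itv /= andbT.
  exact: gh.
- have /cvg_ex[l hl] := a2 t t0t; apply: (cvgP l).
  apply: cvg_trans hl; apply: near_eq_cvg.
  rewrite near_withinE; apply: nearW => s /= ts.
  by apply: gh; rewrite (le_trans t0t)// ltW.
- have /cvg_ex[l hl] := a3 t t0t; apply: (cvgP l).
  apply: cvg_trans hl; apply: near_eq_cvg.
  rewrite near_withinE; near=> s => st.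
  by apply: gh; apply/ltW; near: s; exact: lt_nbhsr.
Unshelve. all: by end_near. Qed.

End PiecewiseContinuity.

Ltac PC_step := match goal with
  | |- piecewise_continuous _ (fun t => GRing.add (@?F t) (@?G t)) =>
    refine (pc_add _ F G _ _)
  | |- piecewise_continuous _ (fun t => GRing.opp (@?F t)) => refine (pc_opp _ F _)
  | |- piecewise_continuous _ (fun t => GRing.mul (@?F t) (@?G t)) =>
    refine (pc_mul _ F G _ _)
  | |- piecewise_continuous _ (fun _ => ?a) => refine (pc_cst _ a)
  | _ => assumption
  end.
Ltac PC := repeat PC_step.

(** * Boundedness of the reference and positivity of the excitation *)

Section Reference.
Context {R : realType}.

(* [exp (d t) * (f t - H / d)] does not increase. *)
Lemma stable_filter_upper (t0 d H : R) (f df : R -> R) : 0 < d ->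
  piecewise_derivative `[t0, +oo[ f df ->
  (forall t, t0 <= t -> df t <= - d * f t + H) ->
  forall t, t0 <= t -> f t <= H / d + `|f t0 - H / d|.
Proof.
move=> d0 [fc [E lE fD]] dfH t t0t; pose B := H / d.
have H_B : H = d * B by rewrite /B; field; rewrite gt_eqF.
pose G s := expR (d * s) * (f s - B).
have De s : is_derive s (1 : R) (fun s => expR (d * s)) (d * expR (d * s)).
  have h : is_derive s (1 : R) (fun s => d * s) d by deriv; ring.
  have i := deriv_comp (g := expR) h (is_derive_expR _).
  by apply: (is_derive_eq i); rewrite mulrC.
have : G t <= G t0.
  apply: (@nonincreasing_off R E G
    (fun s => expR (d * s) * (df s + d * f s - H))) => //.
  - have ec : {within `[t0, t], continuous (fun s : R => expR (d * s))}.
      by apply: deriv_cont_within => s _; exact: De.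
    have fc' : {within `[t0, t], continuous f}.
      apply: continuous_subspaceW fc => s /=; rewrite !in_itv /=.
      by case/andP=> ->.
    by rewrite /G; cont.
  - move=> s /andP[t0s st] nEs; have e := De s.
    have Df : is_derive s (1 : R) f (df s).
      by apply: fD => //; rewrite interior_itv_bndy /= in_itv /= t0s.
    split; first by rewrite /G H_B; deriv; ring.
    by rewrite mulr_ge0_le0 ?expR_ge0//; have := dfH s (ltW t0s); lra.
rewrite /G => h; have e0 := expR_gt0 (d * t).
have h2 : expR (d * t0) * (f t0 - B) <= expR (d * t) * `|f t0 - B|.
  rewrite (le_trans (ler_wpM2l (expR_ge0 _) (ler_norm _)))// ler_wpM2r//.
  by rewrite ler_expR ler_pM2l.
by have := le_trans h h2; rewrite ler_pM2l// -/B lerBlDl.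
Qed.

Record regular_reference (t0 L : R) (ref : reference R) : Prop := RegularReference {
  reg_ge1 : 1 <= L;
  reg_u : piecewise_derivative `[t0, +oo[ (u_d ref) (du_d ref);
  reg_du : piecewise_derivative `[t0, +oo[ (du_d ref) (ddu_d ref);
  reg_r : piecewise_derivative `[t0, +oo[ (r_d ref) (dr_d ref);
  reg_v : piecewise_derivative `[t0, +oo[ (v_d ref) (dv_d ref);
  reg_ddu_pc : piecewise_continuous t0 (ddu_d ref);
  reg_dv_pc : piecewise_continuous t0 (dv_d ref);
  reg_bound : forall t, t0 <= t ->
    [/\ `|u_d ref t| <= L, `|du_d ref t| <= L, `|ddu_d ref t| <= L,
        `|r_d ref t| <= L & `|dr_d ref t| <= L] /\
    (`|v_d ref t| <= L /\ `|dv_d ref t| <= L) }.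

(** The sway equation is a filter of rate [d > 0] driven by a bounded signal. Applying
    [stable_filter_upper] to [v_d] and to [- v_d] bounds [v_d]; the equation then bounds [dv_d] and
    makes it piecewise continuous. *)
Lemma regularP (a b c d t0 : R) (ref : reference R) : 0 < c -> 0 < d ->
  piecewise_derivative `[t0, +oo[ (u_d ref) (du_d ref) ->
  piecewise_derivative `[t0, +oo[ (du_d ref) (ddu_d ref) ->
  piecewise_derivative `[t0, +oo[ (r_d ref) (dr_d ref) ->
  piecewise_derivative `[t0, +oo[ (v_d ref) (dv_d ref) ->
  piecewise_continuous t0 (ddu_d ref) -> piecewise_continuous t0 (dr_d ref) ->
  (forall t, t0 <= t -> dv_d ref t = - a * dr_d ref t - b * r_d ref t
                    - c * u_d ref t * r_d ref t - d * v_d ref t) ->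
  L_infty t0 (u_d ref) -> L_infty t0 (du_d ref) -> L_infty t0 (ddu_d ref) ->
  L_infty t0 (r_d ref) -> L_infty t0 (dr_d ref) ->
  exists L, regular_reference t0 L ref.
Proof.
move=> c0 d0 hu hdu hr hv pddu pdr hdv [M1 b1] [M2 b2] [M3 b3] [M4 b4] [M5 b5].
pose H := `|a| * M5 + `|b| * M4 + c * M1 * M4.
have forcing t : t0 <= t ->
    `|- a * dr_d ref t - b * r_d ref t - c * u_d ref t * r_d ref t| <= H.
  move=> tt; rewrite /H (le_trans (ler_normB _ _))// lerD//.
    rewrite (le_trans (ler_normB _ _))// lerD// normrM ?normrN ler_wpM2l//.
      exact: b5.
    exact: b4.
  rewrite !normrM (gtr0_norm c0) ler_pM ?mulr_ge0 ?(ltW c0)//; last exact: b4.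
  by rewrite ler_wpM2l ?(ltW c0)// b1.
pose W1 := H / d + `|v_d ref t0 - H / d|.
pose W2 := H / d + `|- v_d ref t0 - H / d|.
have v1 t : t0 <= t -> v_d ref t <= W1.
  apply: (stable_filter_upper t0 d H _ (dv_d ref)) => // s t0s.
  by rewrite hdv//; have := forcing s t0s; rewrite ler_norml => /andP[]; lra.
have v2 t : t0 <= t -> - v_d ref t <= W2.
  apply: (stable_filter_upper t0 d H (fun s => - v_d ref s) (fun s => - dv_d ref s)) => //.
    have [vc [E lE vD]] := hv; split; first by cont.
    by exists E => // s s1 s2; apply: deriv_opp; exact: vD.
  move=> s t0s.
  by rewrite hdv//; have := forcing s t0s; rewrite ler_norml => /andP[]; lra.
pose V := `|W1| + `|W2|.
have vb t : t0 <= t -> `|v_d ref t| <= V.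
  move=> t0t; have := v1 t t0t; have := v2 t t0t; rewrite ler_norml.
  have := ler_norm W1; have := ler_norm W2; rewrite /V.
  by have := normr_ge0 W1; have := normr_ge0 W2; lra.
have dvb t : t0 <= t -> `|dv_d ref t| <= H + d * V.
  move=> t0t; rewrite hdv// (le_trans (ler_normB _ _))// lerD ?forcing//.
  by rewrite normrM (gtr0_norm d0) ler_pM2l// vb.
pose L := 1 + `|M1| + `|M2| + `|M3| + `|M4| + `|M5| + `|V| + `|H + d * V|.
exists L; have LP (x : R) : x <= `|x| by exact: ler_norm.
split => //.
- by rewrite /L -!addrA lerDl !addr_ge0.
- apply: (@pc_ext _ _ (fun t => - a * dr_d ref t - b * r_d ref t
                    - c * u_d ref t * r_d ref t - d * v_d ref t)).
    by move=> t t0t; rewrite hdv.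
  have [/pc_of_within ? _] := hu; have [/pc_of_within ? _] := hr.
  by have [/pc_of_within ? _] := hv; PC.
- have n1 := normr_ge0 M1; have n2 := normr_ge0 M2; have n3 := normr_ge0 M3.
  have n4 := normr_ge0 M4; have n5 := normr_ge0 M5; have n6 := normr_ge0 V.
  have n7 := normr_ge0 (H + d * V).
  move=> t t0t; have := b1 t t0t; have := b2 t t0t; have := b3 t t0t.
  have := b4 t t0t; have := b5 t t0t; have := vb t t0t; have := dvb t t0t.
  move: (LP M1) (LP M2) (LP M3) (LP M4) (LP M5) (LP V) (LP (H + d * V)).
  by rewrite /L; clear -n1 n2 n3 n4 n5 n6 n7 => *; split; [split|split]; lra.
Qed.

(** The excitation is nonnegative, so its nonzero lower limit is positive. Being a supremum of
    infima over neighbourhoods of +oo, it is witnessed by a single neighbourhood, which contains a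
    half-line. *)
Lemma excitationP (ref : reference R) : persistent_excitation ref ->
  exists e T, 0 < e /\ forall t, T <= t -> e <= `|u_d ref t| + `|r_d ref t|.
Proof.
rewrite /persistent_excitation limf_einfE; set S := ereal_sup _ => S0.
have S1 : (ereal_inf [set (`|u_d ref t| + `|r_d ref t|)%:E | t in setT] <= S)%E.
  by apply: ereal_sup_ubound; exists setT => //; exact: filterT.
have {S1}S0 : (0 < S)%E.
  rewrite lt_neqAle eq_sym S0 /=; apply: le_trans S1.
  by apply: le_ereal_inf_tmp => _ [t _ <-]; rewrite lee_fin addr_ge0.
have [_ [A [M [_ MA]] <-] infA] := ereal_sup_gt S0.
have [e e0 eA] : exists2 e : R, 0 < e & forall t, A t -> e <= `|u_d ref t| + `|r_d ref t|.
  have lb t : A t -> (ereal_inf [set (`|u_d ref t| + `|r_d ref t|)%:E | t in A] <=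
      (`|u_d ref t| + `|r_d ref t|)%:E)%E.
    by move=> At; apply: ereal_inf_lbound; exists t.
  move: infA lb; case: ereal_inf => [r| |] //.
  - by rewrite lte_fin => r0 lb; exists r => // t At; have := lb t At; rewrite lee_fin.
  - by move=> _ lb; exists 1 => // t At; have := lb t At; rewrite leye_eq.
exists e, (M + 1); split=> // t Mt; apply: eA; apply: MA.
by rewrite (lt_le_trans _ Mt)// ltrDl.
Qed.

End Reference.

(** * The strict Lyapunov function *)

Section UniformBounds.
Context {R : realType} {T : Type}.
Variable ok : T -> Prop.
Implicit Types f g h : T -> R.

(** Landau's O with one constant for all [ok] points. It yields constants that do not depend on the
    state or on the box size without computing them. *)
Definition bounded_by f g := exists2 C : R, 0 <= C & forall p, ok p -> `|g p| <= C * f p.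

Lemma bounded_by_le f g : (forall p, ok p -> `|g p| <= f p) -> bounded_by f g.
Proof. by move=> h; exists 1 => // p /h; rewrite mul1r. Qed.

Lemma bounded_by_cst (a : R) : bounded_by (fun=> 1) (fun=> a).
Proof. by exists `|a| => // p _; rewrite mulr1. Qed.

Lemma bounded_by_weaken f f' g : (forall p, ok p -> f p <= f' p) ->
  bounded_by f g -> bounded_by f' g.
Proof.
move=> ff' [C C0 h]; exists C => // p okp.
by rewrite (le_trans (h p okp))// ler_wpM2l// ff'.
Qed.

Lemma bounded_by_add f g h : bounded_by f g -> bounded_by f h ->
  bounded_by f (fun p => g p + h p).
Proof.
move=> [C C0 hg] [D D0 hh]; exists (C + D); first exact: addr_ge0.
by move=> p okp; rewrite (le_trans (ler_normD _ _))// mulrDl lerD ?hg ?hh.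
Qed.

Lemma bounded_by_opp f g : bounded_by f g -> bounded_by f (fun p => - g p).
Proof. by move=> [C C0 hg]; exists C => // p okp; rewrite normrN hg. Qed.

Lemma bounded_by_mul f f' g h : bounded_by f g -> bounded_by f' h ->
  bounded_by (fun p => f p * f' p) (fun p => g p * h p).
Proof.
move=> [C C0 hg] [D D0 hh]; exists (C * D); first exact: mulr_ge0.
by move=> p okp; rewrite normrM mulrACA ler_pM ?hg ?hh.
Qed.

End UniformBounds.

Section Lyapunov.
Context {R : realType}.

(* [dat_u], [dat_du], ... are the values at one instant of the reference and of
   its derivatives, [dat_sg] is the value of sigma, [dat_e] stands for r_e - r_ed. *)
Record datum := Datum { dat_m : R; dat_z : R; dat_psi : R; dat_e : R; dat_ub : R;
  dat_u : R; dat_du : R; dat_ddu : R; dat_r : R; dat_dr : R; dat_sg : R }.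

Variables (c d k1 k2 k3 k4 : R).
Hypotheses (c0 : 0 < c) (d0 : 0 < d).
Hypotheses (k10 : 0 < k1) (k20 : 0 < k2) (k30 : 0 < k3) (k40 : 0 < k4).

(* [drive], [energy] and [cross] are w, V and U in the notation of the header. *)
Definition drive p := c * dat_du p + d * dat_u p.
Definition ddrive p := c * dat_ddu p + d * dat_du p.
(** The yaw velocity r = r_e + r_d, with r_e written as e + r_ed. *)
Definition yaw p := dat_r p + (dat_e p - k1 * dat_sg p * dat_z p - k2 * dat_psi p).
Definition z_rate p := dat_sg p * dat_psi p - yaw p * dat_ub p.
Definition psi_rate p := - k1 * dat_sg p * dat_z p - k2 * dat_psi p + dat_e p.
Definition e_rate p := - dat_psi p - k4 * dat_e p.
Definition ub_rate p := k1 * dat_z p * yaw p - k3 * dat_ub p.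

Definition energy p := 2^-1 * (k1 * dat_z p ^+ 2 + dat_psi p ^+ 2 + dat_e p ^+ 2 + dat_ub p ^+ 2).
Definition denergy p := - k2 * dat_psi p ^+ 2 - k4 * dat_e p ^+ 2 - k3 * dat_ub p ^+ 2.

Lemma denergy_correct p :
  k1 * dat_z p * z_rate p + dat_psi p * psi_rate p + dat_e p * e_rate p + dat_ub p * ub_rate p = denergy p.
Proof. by rewrite /denergy /z_rate /psi_rate /e_rate /ub_rate; ring. Qed.

(* Chosen so that [weight m * drive ^ 2] absorbs [k1 ^ 2 * r_d * drive * z ^ 3] for
   [`|z| <= m]. *)
Definition weight (m : R) := 1 + k1 ^+ 2 * m ^+ 2.

(** psi_e' contains [- k1 w z_e] and ubar_e' contains [k1 r_d z_e], so the first two products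
    generate the negative terms in w^2 z_e^2 and r_d^2 z_e^2. The derivative of the last term
    cancels the product of u_d and u_d' in half of w^2, leaving the pure square of u_d that
    excitation controls. *)
Definition cross p := weight (dat_m p) * drive p * dat_z p * dat_psi p - dat_r p * dat_z p * dat_ub p
  + 2^-1 * k1 * c * d * dat_u p ^+ 2 * dat_z p ^+ 2.

Definition dcross p :=
  weight (dat_m p) * (ddrive p * dat_z p * dat_psi p + drive p * z_rate p * dat_psi p + drive p * dat_z p * psi_rate p)
  - (dat_dr p * dat_z p * dat_ub p + dat_r p * z_rate p * dat_ub p + dat_r p * dat_z p * ub_rate p)
  + k1 * c * d * (dat_u p * dat_du p * dat_z p ^+ 2 + dat_u p ^+ 2 * dat_z p * z_rate p).

Definition damped_l1 p := `|dat_psi p| + `|dat_e p| + `|dat_ub p|.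
Definition damped_sq p := dat_psi p ^+ 2 + dat_e p ^+ 2 + dat_ub p ^+ 2.

Variables (L delta : R).
Hypotheses (L1 : 1 <= L) (delta0 : 0 < delta).

(** The last clause, sigma = w + O(m psi_e), is all that is retained of beta and v_d. *)
Definition admissible p :=
  [/\ 1 <= dat_m p, [/\ `|dat_z p| <= dat_m p, `|dat_psi p| <= dat_m p, `|dat_e p| <= dat_m p & `|dat_ub p| <= dat_m p],
   [/\ `|dat_u p| <= L, `|dat_du p| <= L, `|dat_ddu p| <= L, `|dat_r p| <= L
     & `|dat_dr p| <= L] &
   `|dat_sg p - drive p| <= L * dat_m p * `|dat_psi p| ].

Local Notation "g \in_O f" := (bounded_by admissible (fun p => f p) g)
  (at level 70).

Let m_ge1 p : admissible p -> 1 <= dat_m p. Proof. by case. Qed.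
Let m_ge0 p : admissible p -> 0 <= dat_m p.
Proof. by move/m_ge1; apply: le_trans. Qed.

Let q_ge0 p : 0 <= damped_l1 p. Proof. by rewrite /damped_l1 !addr_ge0. Qed.

Let signal (f : datum -> R) : (forall p, admissible p -> `|f p| <= L) ->
  bounded_by admissible (fun=> 1) f.
Proof. by move=> h; exists L; [exact: le_trans L1|move=> p /h; rewrite mulr1]. Qed.

Let pow_le p i j : admissible p -> (i <= j)%N -> dat_m p ^+ i <= dat_m p ^+ j.
Proof. by move=> /m_ge1 m1 ij; rewrite ler_weXn2l. Qed.

Let bb_pow (f : datum -> R) i j : (i <= j)%N ->
  bounded_by admissible (fun p => dat_m p ^+ i) f ->
  bounded_by admissible (fun p => dat_m p ^+ j) f.
Proof. by move=> ij; apply: bounded_by_weaken => p okp; exact: pow_le. Qed.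

Let bb0 (f : datum -> R) j : bounded_by admissible (fun=> 1) f ->
  bounded_by admissible (fun p => dat_m p ^+ j) f.
Proof. by move=> h; apply: (@bb_pow _ 0%N); rewrite //; apply: bounded_by_weaken h. Qed.

Let bb_powM (f g : datum -> R) i j :
  bounded_by admissible (fun p => dat_m p ^+ i) f ->
  bounded_by admissible (fun p => dat_m p ^+ j) g ->
  bounded_by admissible (fun p => dat_m p ^+ (i + j)) (fun p => f p * g p).
Proof.
move=> hf hg; apply: bounded_by_weaken (bounded_by_mul _ _ _ _ _ hf hg) => p _.
by rewrite exprD.
Qed.

Let bb_powMl (f g h : datum -> R) i j :
  bounded_by admissible (fun p => dat_m p ^+ i) f ->
  bounded_by admissible (fun p => dat_m p ^+ j * h p) g ->
  bounded_by admissible (fun p => dat_m p ^+ (i + j) * h p) (fun p => f p * g p).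
Proof.
move=> hf hg; apply: bounded_by_weaken (bounded_by_mul _ _ _ _ _ hf hg) => p _.
by rewrite exprD mulrA.
Qed.

Let bb_q1 (f : datum -> R) : (forall p, `|f p| <= damped_l1 p) ->
  bounded_by admissible (fun p => dat_m p ^+ 0 * damped_l1 p) f.
Proof. by move=> h; apply: bounded_by_le => p _; rewrite expr0 mul1r. Qed.

Let bz : bounded_by admissible (fun p => dat_m p ^+ 1) dat_z.
Proof. by apply: bounded_by_le => p [_ [h _ _ _] _ _]; rewrite expr1. Qed.
Let bpsi : bounded_by admissible (fun p => dat_m p ^+ 1) dat_psi.
Proof. by apply: bounded_by_le => p [_ [_ h _ _] _ _]; rewrite expr1. Qed.
Let be : bounded_by admissible (fun p => dat_m p ^+ 1) dat_e.
Proof. by apply: bounded_by_le => p [_ [_ _ h _] _ _]; rewrite expr1. Qed.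
Let bu : bounded_by admissible (fun=> 1) dat_u.
Proof. by apply: signal => p [_ _ []]. Qed.
Let bdu : bounded_by admissible (fun=> 1) dat_du.
Proof. by apply: signal => p [_ _ []]. Qed.
Let bddu : bounded_by admissible (fun=> 1) dat_ddu.
Proof. by apply: signal => p [_ _ []]. Qed.
Let br : bounded_by admissible (fun=> 1) dat_r.
Proof. by apply: signal => p [_ _ []]. Qed.
Let bdr : bounded_by admissible (fun=> 1) dat_dr.
Proof. by apply: signal => p [_ _ []]. Qed.
Let b1M (f g : datum -> R) : bounded_by admissible (fun=> 1) f ->
  bounded_by admissible (fun=> 1) g -> bounded_by admissible (fun=> 1) (fun p => f p * g p).
Proof.
move=> hf hg; apply: bounded_by_weaken (bounded_by_mul _ _ _ _ _ hf hg) => p _.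
by rewrite mulr1.
Qed.
Let bw : bounded_by admissible (fun=> 1) drive.
Proof. by apply: bounded_by_add; apply: b1M => //; exact: bounded_by_cst. Qed.
Let bdw : bounded_by admissible (fun=> 1) ddrive.
Proof. by apply: bounded_by_add; apply: b1M => //; exact: bounded_by_cst. Qed.
Let bweight : bounded_by admissible (fun p => dat_m p ^+ 2) (fun p => weight (dat_m p)).
Proof.
apply: bounded_by_add; first by apply: bb0; exact: bounded_by_cst.
apply: (bb_powM _ _ 0 2); first by apply: bb0; exact: bounded_by_cst.
by apply: bounded_by_le => p okp; rewrite ger0_norm// exprn_ge0// m_ge0.
Qed.

Let s p := dat_sg p - drive p.
Let bs : bounded_by admissible (fun p => dat_m p ^+ 1 * damped_l1 p) s.
Proof.
exists L; first exact: le_trans L1.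
move=> p okp; have [_ _ _ h] := okp; rewrite (le_trans h)// expr1 mulrA.
rewrite ler_wpM2l// ?mulr_ge0 ?m_ge0 ?(le_trans _ L1)//.
by rewrite /damped_l1 -addrA lerDl addr_ge0.
Qed.

Let bsg : bounded_by admissible (fun p => dat_m p ^+ 2) dat_sg.
Proof.
rewrite (_ : dat_sg = fun p => (dat_sg p - drive p) + drive p); last first.
  by apply/funext => p; rewrite subrK.
apply: bounded_by_add; last exact: bb0.
exists L; first exact: le_trans L1.
move=> p okp; have [_ [_ h1 _ _] _ h] := okp; rewrite (le_trans h)// expr2 -mulrA.
rewrite ler_wpM2l ?(le_trans _ L1)// ler_wpM2l// m_ge0//.
Qed.

Let byaw : bounded_by admissible (fun p => dat_m p ^+ 3) yaw.
Proof.
apply: bounded_by_add; first exact: bb0.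
apply: bounded_by_add; last first.
  apply: bounded_by_opp; apply: (@bb_pow _ (0 + 1)%N) => //.
  by apply: bb_powM => //; apply: bb0; exact: bounded_by_cst.
apply: bounded_by_add; first exact: (@bb_pow _ 1%N).
apply: bounded_by_opp; apply: (@bb_powM _ _ 2%N 1%N) => //.
by apply: (@bb_powM _ _ 0%N 2%N) => //; apply: bb0; exact: bounded_by_cst.
Qed.

Let qpsi p : `|dat_psi p| <= damped_l1 p. Proof. by rewrite /damped_l1 -addrA lerDl addr_ge0. Qed.
Let qe p : `|dat_e p| <= damped_l1 p. Proof. by rewrite /damped_l1 addrAC lerDr addr_ge0. Qed.
Let qub p : `|dat_ub p| <= damped_l1 p. Proof. by rewrite /damped_l1 lerDr addr_ge0. Qed.

Let bdz : bounded_by admissible (fun p => dat_m p ^+ 3 * damped_l1 p) z_rate.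
Proof.
apply: bounded_by_add.
  apply: bounded_by_weaken (bb_powMl _ _ _ _ _ bsg (bb_q1 _ qpsi)) => p okp.
  by rewrite ler_wpM2r// pow_le.
by apply: bounded_by_opp; apply: (@bb_powMl _ _ _ 3%N 0%N byaw (bb_q1 _ qub)).
Qed.

(** The two kinds of error terms: a damped coordinate times z_e, to be split by Young's inequality,
    or times another damped coordinate, to be absorbed directly. *)
Let X p := `|dat_z p| * damped_l1 p + damped_l1 p ^+ 2.
Let X_ge0 p : 0 <= X p. Proof. by rewrite /X addr_ge0 ?mulr_ge0 ?sqr_ge0. Qed.

(* Collects the terms of [dcross] containing psi_e, e or ubar_e ([s] is O(psi_e)). *)
Let err p := dat_z p * (weight (dat_m p) * (ddrive p * dat_psi p)) + weight (dat_m p) * (drive p * z_rate p) * dat_psi p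
  - dat_z p * (weight (dat_m p) * (k1 * (drive p * (dat_z p * s p))))
  + dat_z p * (weight (dat_m p) * (drive p * (dat_e p - k2 * dat_psi p)))
  - dat_z p * (dat_dr p * dat_ub p) - dat_r p * z_rate p * dat_ub p
  - dat_z p * (k1 * (dat_r p * (dat_z p * (dat_e p - k2 * dat_psi p))))
  + dat_z p * (k1 ^+ 2 * (dat_r p * (dat_z p * (dat_z p * s p)))) + dat_z p * (k3 * (dat_r p * dat_ub p))
  + dat_z p * (k1 * (c * (d * (dat_u p * (dat_u p * z_rate p))))).

Let main p := - weight (dat_m p) * k1 * drive p ^+ 2 * dat_z p ^+ 2 - k1 * dat_r p ^+ 2 * dat_z p ^+ 2
  + k1 ^+ 2 * dat_r p * drive p * dat_z p ^+ 3 + k1 * c * d * dat_u p * dat_du p * dat_z p ^+ 2.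

Let dcrossE p : dcross p = main p + err p.
Proof.
rewrite /dcross /main /err /s /psi_rate /ub_rate.
move: (z_rate p) (ddrive p) (drive p) (weight _) => a1 a2 a3 a4.
by rewrite /yaw; ring.
Qed.

Let main_le p : admissible p ->
  main p <= - (2^-1 * k1) * (d ^+ 2 * dat_u p ^+ 2 + dat_r p ^+ 2) * dat_z p ^+ 2.
Proof.
move=> okp; have [_ [zm _ _ _] _ _] := okp.
have zm2 : dat_z p ^+ 2 <= dat_m p ^+ 2.
  by rewrite -[dat_z p ^+ 2]real_normK ?num_real// lerXn2r ?nnegrE// m_ge0.
have h1 : 0 <= k1 ^+ 3 * drive p ^+ 2 * dat_z p ^+ 2 * (dat_m p ^+ 2 - dat_z p ^+ 2).
  by rewrite mulr_ge0 ?subr_ge0// mulr_ge0 ?sqr_ge0// mulr_ge0 ?sqr_ge0// exprn_ge0// ltW.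
have h2 : 0 <= k1 * dat_z p ^+ 2 * (dat_r p - k1 * drive p * dat_z p) ^+ 2.
  by rewrite mulr_ge0 ?sqr_ge0// mulr_ge0 ?sqr_ge0// ltW.
have h3 : 0 <= k1 * dat_z p ^+ 2 * (c * dat_du p) ^+ 2.
  by rewrite mulr_ge0 ?sqr_ge0// mulr_ge0 ?sqr_ge0// ltW.
have h4 : 0 <= k1 * dat_z p ^+ 2 * (drive p) ^+ 2.
  by rewrite mulr_ge0 ?sqr_ge0// mulr_ge0 ?sqr_ge0// ltW.
have h5 : 0 <= k1 * dat_z p ^+ 2 * (dat_r p) ^+ 2.
  by rewrite mulr_ge0 ?sqr_ge0// mulr_ge0 ?sqr_ge0// ltW.
have h6 : 0 <= k1 ^+ 3 * drive p ^+ 2 * dat_z p ^+ 2 * dat_z p ^+ 2.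
  by rewrite mulr_ge0 ?sqr_ge0// mulr_ge0 ?sqr_ge0// mulr_ge0 ?sqr_ge0// exprn_ge0// ltW.
rewrite -subr_ge0.
(* The cubic term is completed to the square of [r_d - k1 w z_e]: half of r_d^2 pays for one end,
   the k1^2 m^2 in [weight] for the other. The square of [c u_d'] is what remains of half of w^2
   besides the square of [d u_d]. *)
have -> : - (2^-1 * k1) * (d ^+ 2 * dat_u p ^+ 2 + dat_r p ^+ 2) * dat_z p ^+ 2 - main p =
  k1 ^+ 3 * drive p ^+ 2 * dat_z p ^+ 2 * (dat_m p ^+ 2 - dat_z p ^+ 2)
  + 2^-1 * (k1 * dat_z p ^+ 2 * (dat_r p - k1 * drive p * dat_z p) ^+ 2)
  + 2^-1 * (k1 * dat_z p ^+ 2 * (c * dat_du p) ^+ 2)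
  + 2^-1 * (k1 * dat_z p ^+ 2 * (drive p) ^+ 2)
  + 2^-1 * (k1 ^+ 3 * drive p ^+ 2 * dat_z p ^+ 2 * dat_z p ^+ 2).
  by rewrite /main /weight /drive; field.
move: h1 h2 h3 h4 h6; lra.
Qed.

Let bX1 (g : datum -> R) j : (j <= 5)%N ->
  bounded_by admissible (fun p => dat_m p ^+ j * damped_l1 p) g ->
  bounded_by admissible (fun p => dat_m p ^+ 5 * X p) (fun p => dat_z p * g p).
Proof.
move=> j5 [C C0 h]; exists C => // p okp.
rewrite normrM (le_trans (ler_wpM2l (normr_ge0 _) (h p okp)))//.
rewrite (_ : `|dat_z p| * _ = C * (dat_m p ^+ j * (`|dat_z p| * damped_l1 p))); last by ring.
rewrite ler_wpM2l// ler_pM ?exprn_ge0 ?mulr_ge0 ?m_ge0 ?pow_le//.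
by rewrite lerDl sqr_ge0.
Qed.

Let bX2 (g h : datum -> R) j : (j <= 5)%N ->
  bounded_by admissible (fun p => dat_m p ^+ j * damped_l1 p) g -> (forall p, `|h p| <= damped_l1 p) ->
  bounded_by admissible (fun p => dat_m p ^+ 5 * X p) (fun p => g p * h p).
Proof.
move=> j5 [C C0 hg] hh; exists C => // p okp.
rewrite normrM (le_trans (ler_pM _ _ (hg p okp) (hh p)))//.
rewrite (_ : _ * damped_l1 p = C * (dat_m p ^+ j * (damped_l1 p) ^+ 2)); last by ring.
rewrite ler_wpM2l// ler_pM ?exprn_ge0 ?sqr_ge0 ?m_ge0 ?pow_le//.
by rewrite lerDr mulr_ge0.
Qed.

Let bcst (a : R) : bounded_by admissible (fun p => dat_m p ^+ 0) (fun=> a).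
Proof. by apply: bb0; exact: bounded_by_cst. Qed.

Let b0l (f g : datum -> R) j : bounded_by admissible (fun=> 1) f ->
  bounded_by admissible (fun p => dat_m p ^+ j * damped_l1 p) g ->
  bounded_by admissible (fun p => dat_m p ^+ j * damped_l1 p) (fun p => f p * g p).
Proof. by move=> /(bb0 _ 0%N) hf hg; exact: (bb_powMl _ _ _ 0%N j hf hg). Qed.

Let bsub : bounded_by admissible (fun p => dat_m p ^+ 0 * damped_l1 p) (fun p => dat_e p - k2 * dat_psi p).
Proof.
apply: bounded_by_add; first exact: bb_q1.
by apply: bounded_by_opp; apply: b0l; [exact: bounded_by_cst|exact: bb_q1].
Qed.

Let err_bound : bounded_by admissible (fun p => dat_m p ^+ 5 * X p) err.
Proof.
have cst (a : R) := bounded_by_cst admissible a.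
have bz1 (g : datum -> R) j : bounded_by admissible (fun p => dat_m p ^+ j * damped_l1 p) g ->
    bounded_by admissible (fun p => dat_m p ^+ j.+1 * damped_l1 p) (fun p => dat_z p * g p).
  by move=> h; exact: (bb_powMl _ _ _ 1%N j bz h).
have bw2 (g : datum -> R) j : bounded_by admissible (fun p => dat_m p ^+ j * damped_l1 p) g ->
    bounded_by admissible (fun p => dat_m p ^+ j.+2 * damped_l1 p) (fun p => weight (dat_m p) * g p).
  by move=> h; exact: (bb_powMl _ _ _ 2%N j bweight h).
do 9?[apply: bounded_by_add]; try apply: bounded_by_opp.
- by apply: (bX1 _ 2%N) => //; apply: bw2; apply: b0l => //; exact: bb_q1.
(* The worst term: [weight] is O(m^2) and [z_rate] is O(m^3) times a damped coordinate, which fixes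
   the exponent 5. *)
- by apply: (bX2 _ _ 5%N) => //; apply: bw2; apply: b0l.
- by apply: (bX1 _ 4%N) => //; apply: bw2; do 2?[apply: b0l => //]; exact: bz1.
- by apply: (bX1 _ 2%N) => //; apply: bw2; exact: b0l.
- by apply: (bX1 _ 0%N) => //; apply: b0l => //; exact: bb_q1.
- by apply: (bX2 _ _ 3%N) => //; exact: b0l.
- by apply: (bX1 _ 1%N) => //; do 2?[apply: b0l => //]; exact: bz1.
- apply: (bX1 _ 3%N) => //; do 2?[apply: b0l => //].
  by apply: (bz1 _ 2%N); apply: (bz1 _ 1%N).
- by apply: (bX1 _ 0%N) => //; do 2?[apply: b0l => //]; exact: bb_q1.
- by apply: (bX1 _ 3%N) => //; do 5?[apply: b0l => //].
Qed.

Lemma damped_sq_ge0 p : 0 <= damped_sq p. Proof. by rewrite /damped_sq !addr_ge0 ?sqr_ge0. Qed.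

Let q_le_Q p : damped_l1 p ^+ 2 <= 3 * damped_sq p.
Proof.
rewrite /damped_l1 /damped_sq -[dat_psi p ^+ 2]real_normK ?num_real// -[dat_e p ^+ 2]real_normK ?num_real//.
rewrite -[dat_ub p ^+ 2]real_normK ?num_real//.
move: `|dat_psi p| `|dat_e p| `|dat_ub p| => a1 a2 a3.
have := sqr_ge0 (a1 - a2); have := sqr_ge0 (a1 - a3); have := sqr_ge0 (a2 - a3).
by rewrite -subr_ge0 => *; nra.
Qed.

Let energyE p : energy p = 2^-1 * (k1 * dat_z p ^+ 2 + damped_sq p).
Proof. by rewrite /energy /damped_sq; ring. Qed.

Let cross_bound : bounded_by admissible (fun p => dat_m p ^+ 5 * (dat_z p ^+ 2 + damped_sq p)) cross.
Proof.
have ineq (a b A B : R) : `|a| <= A -> `|b| <= B -> `|a * b| <= A ^+ 2 + B ^+ 2.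
  move=> h1 h2; rewrite normrM (le_trans (ler_pM _ _ h1 h2))//.
  by have := sqr_ge0 (A - B); have := sqr_ge0 A; have := sqr_ge0 B; nra.
have Y0 p : 0 <= dat_z p ^+ 2 + damped_sq p by rewrite addr_ge0 ?sqr_ge0 ?damped_sq_ge0.
have up (f : datum -> R) j : (j <= 5)%N ->
    bounded_by admissible (fun p => dat_m p ^+ j * (dat_z p ^+ 2 + damped_sq p)) f ->
    bounded_by admissible (fun p => dat_m p ^+ 5 * (dat_z p ^+ 2 + damped_sq p)) f.
  move=> j5; apply: bounded_by_weaken => p okp.
  by rewrite ler_wpM2r// pow_le.
have base (f : datum -> R) : (forall p, `|f p| <= dat_z p ^+ 2 + damped_sq p) ->
    bounded_by admissible (fun p => dat_m p ^+ 0 * (dat_z p ^+ 2 + damped_sq p)) f.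
  by move=> h; apply: bounded_by_le => p _; rewrite expr0 mul1r.
rewrite (_ : cross = fun p => weight (dat_m p) * (drive p * (dat_z p * dat_psi p))
  - dat_r p * (dat_z p * dat_ub p)
  + 2^-1 * k1 * c * d * (dat_u p * (dat_u p * (dat_z p * dat_z p)))); last first.
  by apply/funext => p; rewrite /cross; ring.
have sqK (a : R) : `|a| ^+ 2 = a ^+ 2 by rewrite real_normK ?num_real.
have c0l (f g : datum -> R) j : bounded_by admissible (fun=> 1) f ->
    bounded_by admissible (fun p => dat_m p ^+ j * (dat_z p ^+ 2 + damped_sq p)) g ->
    bounded_by admissible (fun p => dat_m p ^+ j * (dat_z p ^+ 2 + damped_sq p)) (fun p => f p * g p).
  by move=> /(bb0 _ 0%N) hf hg; exact: (bb_powMl _ _ _ 0%N j hf hg).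
apply: bounded_by_add; first apply: bounded_by_add.
- apply: (up _ 2%N) => //; apply: (bb_powMl _ _ _ 2%N 0%N bweight).
  apply: c0l => //; apply: base => p.
  rewrite (le_trans (ineq _ _ _ _ (lexx _) (lexx _)))// !sqK /damped_sq.
  by have := sqr_ge0 (dat_e p); have := sqr_ge0 (dat_ub p); lra.
- apply: bounded_by_opp; apply: (up _ 0%N) => //; apply: c0l => //; apply: base => p.
  rewrite (le_trans (ineq _ _ _ _ (lexx _) (lexx _)))// !sqK /damped_sq.
  by have := sqr_ge0 (dat_e p); have := sqr_ge0 (dat_psi p); lra.
- apply: (up _ 0%N) => //.
  apply: (c0l (fun=> 2^-1 * k1 * c * d)); first exact: bounded_by_cst.
  do 2![apply: (c0l dat_u) => //].
  apply: base => p; rewrite normrM -[leLHS]expr2 sqK lerDl.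
  exact: damped_sq_ge0.
Qed.

(** [K] and [mu] precede the point, hence are uniform in the box size. This is possible because the
    dissipation of z_e comes from [cross], which does not carry the factor m^10. *)
Lemma strict_lyapunov : exists K mu : R, [/\ 1 <= K, 0 < mu &
  forall p, admissible p ->
    let W := K * dat_m p ^+ 10 * energy p + cross p in
    [/\ energy p <= W, W <= 2 * K * dat_m p ^+ 10 * energy p &
     delta <= `|dat_u p| + `|dat_r p| ->
     K * dat_m p ^+ 10 * denergy p + dcross p <= - mu * energy p] ].
Proof.
have [C C0 errC] := err_bound; have [D D0 crossD] := cross_bound.
pose kap := Num.min k2 (Num.min k3 k4).
have kap0 : 0 < kap by rewrite /kap !lt_min k20 k30 k40.
have [kap2 kap3 kap4] : [/\ kap <= k2, kap <= k3 & kap <= k4].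
  by rewrite /kap !ge_min !lexx !orbT.
pose dd := Num.min 1 (d ^+ 2).
have dd0 : 0 < dd by rewrite /dd lt_min ltr01 exprn_gt0.
have [dd1 dd2] : dd <= 1 /\ dd <= d ^+ 2 by rewrite /dd !ge_min !lexx !orbT.
(* Excitation gives u_d^2 + r_d^2 >= delta^2 / 2, [dd] compares this with d^2 u_d^2 + r_d^2, and
   [main_le] brings another k1 / 2. *)
pose nu := 4^-1 * k1 * dd * delta ^+ 2.
have nu0 : 0 < nu by rewrite /nu !mulr_gt0// ?exprn_gt0// invr_gt0.
pose eta := 2 * (k1^-1 + 1).
have ki0 : 0 < k1^-1 by rewrite invr_gt0.
have eta_pos : 0 < eta by rewrite /eta mulr_gt0// addr_gt0.
(* The first summand beats the Young remainder of [err], with 3 from [q_le_Q], and leaves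
   [- damped_sq] over. The second dominates [cross]. The last keeps [energy] below [W]. *)
pose K := kap^-1 * (3 * (C + C ^+ 2 / (2 * nu)) + 1) + D * eta + 1.
have t1 : 0 <= kap^-1 * (3 * (C + C ^+ 2 / (2 * nu)) + 1).
  by rewrite mulr_ge0 ?invr_ge0 ?(ltW kap0)// addr_ge0// mulr_ge0// addr_ge0// mulr_ge0 ?sqr_ge0// invr_ge0 mulr_ge0// ltW.
have t2 : 0 <= D * eta by rewrite mulr_ge0// ltW.
(* The final balance is [- nu z^2 / 2 - damped_sq], to be compared with [energy], which is half of
   [k1 z^2 + damped_sq]. *)
pose mu := Num.min (nu / k1) 2.
have mu0 : 0 < mu by rewrite /mu lt_min; apply/andP; split; [exact: divr_gt0|lra].
have [mu1 mu2] : mu <= nu / k1 /\ mu <= 2 by rewrite /mu !ge_min !lexx !orbT.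
exists K, mu; split => //; first by rewrite /K; lra.
move=> p okp W; have m1 := m_ge1 _ okp.
set m5 := dat_m p ^+ 5; have m51 : 1 <= m5 by rewrite /m5 exprn_ege1.
have m10 : dat_m p ^+ 10 = m5 ^+ 2 by rewrite /m5 -exprM.
have m5s : m5 <= m5 ^+ 2 by rewrite expr2 ler_peMr// (le_trans _ m51).
have V0 : 0 <= energy p.
  by rewrite energyE mulr_ge0 ?invr_ge0// addr_ge0 ?damped_sq_ge0// mulr_ge0 ?sqr_ge0// ltW.
have zQ : dat_z p ^+ 2 + damped_sq p <= eta * energy p.
  have -> : eta * energy p = dat_z p ^+ 2 + damped_sq p + (k1 * dat_z p ^+ 2 + k1^-1 * damped_sq p).
    by rewrite energyE /eta; field; rewrite gt_eqF.
  have k1z : 0 <= k1 * dat_z p ^+ 2 by rewrite mulr_ge0 ?sqr_ge0// ltW.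
  have kQ : 0 <= k1^-1 * damped_sq p by rewrite mulr_ge0 ?damped_sq_ge0// ltW.
  by rewrite lerDl addr_ge0.
have cr : `|cross p| <= D * eta * m5 ^+ 2 * energy p.
  rewrite (le_trans (crossD p okp))// -/m5.
  rewrite [leRHS](_ : _ = D * (m5 ^+ 2 * (eta * energy p))); last by ring.
  rewrite ler_wpM2l//.
  have h1 : m5 * (dat_z p ^+ 2 + damped_sq p) <= m5 * (eta * energy p).
    by rewrite ler_wpM2l// (le_trans _ m51).
  have h2 : m5 * (eta * energy p) <= m5 ^+ 2 * (eta * energy p).
    by rewrite ler_wpM2r// mulr_ge0// ltW.
  exact: le_trans h1 h2.
have m5s1 : 1 <= m5 ^+ 2 by exact: le_trans m5s.
have KD : D * eta * m5 ^+ 2 * energy p + energy p <= K * m5 ^+ 2 * energy p.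
  have : 0 <= kap^-1 * (3 * (C + C ^+ 2 / (2 * nu)) + 1) * (m5 ^+ 2 * energy p).
    by rewrite mulr_ge0// mulr_ge0// sqr_ge0.
  have : 0 <= (m5 ^+ 2 - 1) * energy p by rewrite mulr_ge0// subr_ge0.
  by rewrite /K; move: (kap^-1 * _) (D * eta) (m5 ^+ 2) (energy p) => *; lra.
move: cr; rewrite ler_norml => /andP[cr1 cr2].
split; rewrite /W ?m10; [lra|lra|] => exc.
have main_nu : main p <= - nu * dat_z p ^+ 2.
  apply: (le_trans (main_le p okp)).
  rewrite ler_wpM2r ?sqr_ge0// !mulNr lerN2 /nu.
  have h1 : delta ^+ 2 <= 2 * (dat_u p ^+ 2 + dat_r p ^+ 2).
    rewrite (@le_trans _ _ ((`|dat_u p| + `|dat_r p|) ^+ 2))//.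
      by rewrite lerXn2r ?nnegrE// ltW.
    rewrite -[dat_u p ^+ 2]real_normK ?num_real// -[dat_r p ^+ 2]real_normK ?num_real//.
    by have := sqr_ge0 (`|dat_u p| - `|dat_r p|); move: `|dat_u p| `|dat_r p| => a1 a2; nra.
  have h2 : dd * (dat_u p ^+ 2 + dat_r p ^+ 2) <= d ^+ 2 * dat_u p ^+ 2 + dat_r p ^+ 2.
    by rewrite mulrDr lerD ?ler_wpM2r ?sqr_ge0// ler_piMl ?sqr_ge0.
  have h3 : dd * delta ^+ 2 <= 2 * (d ^+ 2 * dat_u p ^+ 2 + dat_r p ^+ 2).
    rewrite (le_trans (ler_wpM2l (ltW dd0) h1))// mulrCA ler_wpM2l//.
  have := ler_wpM2l (ltW k10) h3.
  rewrite (_ : 4^-1 * k1 * dd * _ = 4^-1 * (k1 * (dd * delta ^+ 2))); last by ring.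
  by move: (dd * _) => a1; lra.
have err_le : err p <= 2^-1 * nu * dat_z p ^+ 2 + 3 * (C + C ^+ 2 / (2 * nu)) * m5 ^+ 2 * damped_sq p.
  apply: (le_trans (ler_norm _)); apply: (le_trans (errC p okp)); rewrite -/m5 /X.
  (* Young's inequality as a completed square. The constant [C * m5] is squared here, which is the
     origin of m^10. *)
  have h1 : C * m5 * (`|dat_z p| * damped_l1 p) <= 2^-1 * nu * dat_z p ^+ 2 + C ^+ 2 / (2 * nu) * m5 ^+ 2 * damped_l1 p ^+ 2.
    rewrite -subr_ge0 -[dat_z p ^+ 2]real_normK ?num_real//.
    have -> : 2^-1 * nu * `|dat_z p| ^+ 2 + C ^+ 2 / (2 * nu) * m5 ^+ 2 * damped_l1 p ^+ 2 -
      C * m5 * (`|dat_z p| * damped_l1 p) = (2 * nu)^-1 * (nu * `|dat_z p| - C * m5 * damped_l1 p) ^+ 2.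
      by field; rewrite gt_eqF.
    by rewrite mulr_ge0 ?sqr_ge0// invr_ge0 mulr_ge0// ltW.
  have h2 : C * m5 * damped_l1 p ^+ 2 <= C * m5 ^+ 2 * damped_l1 p ^+ 2.
    by rewrite ler_wpM2r ?sqr_ge0// ler_wpM2l.
  have h3 : (C + C ^+ 2 / (2 * nu)) * m5 ^+ 2 * damped_l1 p ^+ 2 <=
     (C + C ^+ 2 / (2 * nu)) * m5 ^+ 2 * (3 * damped_sq p).
    rewrite ler_wpM2l// mulr_ge0 ?sqr_ge0// addr_ge0// mulr_ge0 ?sqr_ge0//.
    by rewrite invr_ge0 mulr_ge0// ltW.
  by move: h1 h2 h3; move: (C ^+ 2 / _) => C2; lra.
have dV : denergy p <= - kap * damped_sq p.
  rewrite /denergy /damped_sq.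
  have := ler_wpM2r (sqr_ge0 (dat_psi p)) kap2; have := ler_wpM2r (sqr_ge0 (dat_e p)) kap4.
  by have := ler_wpM2r (sqr_ge0 (dat_ub p)) kap3; lra.
have KdV : K * m5 ^+ 2 * denergy p <=
    - (3 * (C + C ^+ 2 / (2 * nu)) + 1) * m5 ^+ 2 * damped_sq p.
  have Km0 : 0 <= K * m5 ^+ 2 by rewrite mulr_ge0 ?sqr_ge0// /K; lra.
  rewrite (le_trans (ler_wpM2l Km0 dV))//.
  rewrite (_ : _ * (- kap * _) = - (kap * K * m5 ^+ 2 * damped_sq p)); last by ring.
  rewrite !mulNr lerN2 ler_wpM2r ?damped_sq_ge0// ler_wpM2r ?sqr_ge0//.
  rewrite /K; set T := 3 * _ + 1.
  rewrite (_ : kap * _ = T + kap * (D * eta + 1)); last by field; rewrite gt_eqF.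
  by rewrite lerDl mulr_ge0// ?(ltW kap0)//; lra.
rewrite dcrossE energyE.
have hz : mu * (k1 * dat_z p ^+ 2) <= nu * dat_z p ^+ 2.
  rewrite mulrA ler_wpM2r ?sqr_ge0//.
  by move: mu1; rewrite ler_pdivlMr.
have hQ : mu * damped_sq p <= 2 * damped_sq p by rewrite ler_wpM2r// damped_sq_ge0.
have hm : damped_sq p <= m5 ^+ 2 * damped_sq p by rewrite ler_peMl// damped_sq_ge0.
move: main_nu err_le KdV hz hQ hm; move: (main p) (err p) (K * _ * _) (dat_z p ^+ 2) (damped_sq p).
move: (3 * _) => T *; lra.
Qed.

End Lyapunov.

(** * Decay along trajectories *)

Section AlongTrajectories.
Context {R : realType}.
Variables (c d k1 k2 k3 k4 : R).

Lemma deriv_energy (p : R -> datum) t :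
  is_derive t (1 : R) (fun s => dat_z (p s)) (z_rate k1 k2 (p t)) ->
  is_derive t (1 : R) (fun s => dat_psi (p s)) (psi_rate k1 k2 (p t)) ->
  is_derive t (1 : R) (fun s => dat_e (p s)) (e_rate k4 (p t)) ->
  is_derive t (1 : R) (fun s => dat_ub (p s)) (ub_rate k1 k2 k3 (p t)) ->
  is_derive t (1 : R) (fun s => energy k1 (p s)) (denergy k2 k3 k4 (p t)).
Proof.
move=> Dz Dpsi De Dub; rewrite -(denergy_correct k1 k2 k3 k4) /energy; deriv.
by field.
Qed.

Lemma deriv_cross (p : R -> datum) t m0 : (forall s, dat_m (p s) = m0) ->
  is_derive t (1 : R) (fun s => dat_z (p s)) (z_rate k1 k2 (p t)) ->
  is_derive t (1 : R) (fun s => dat_psi (p s)) (psi_rate k1 k2 (p t)) ->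
  is_derive t (1 : R) (fun s => dat_ub (p s)) (ub_rate k1 k2 k3 (p t)) ->
  is_derive t (1 : R) (fun s => dat_u (p s)) (dat_du (p t)) ->
  is_derive t (1 : R) (fun s => dat_du (p s)) (dat_ddu (p t)) ->
  is_derive t (1 : R) (fun s => dat_r (p s)) (dat_dr (p t)) ->
  is_derive t (1 : R) (fun s => cross c d k1 (p s)) (dcross c d k1 k2 k3 (p t)).
Proof.
move=> pm Dz Dpsi Dub Du Ddu Dr.
rewrite (_ : (fun s => _) = (fun s => weight k1 m0 *
  (c * dat_du (p s) + d * dat_u (p s)) * dat_z (p s) * dat_psi (p s)
  - dat_r (p s) * dat_z (p s) * dat_ub (p s)
  + 2^-1 * k1 * c * d * dat_u (p s) ^+ 2 * dat_z (p s) ^+ 2)); last first.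
  by apply/funext => s; rewrite /cross pm.
rewrite /dcross pm; deriv; rewrite /drive /ddrive.
by move: (z_rate _ _ _) (psi_rate _ _ _) (ub_rate _ _ _ _) (weight _ _) => *; field.
Qed.

Variables (t0 L : R) (ref : reference R).
Hypotheses (c0 : 0 < c) (d0 : 0 < d).
Hypotheses (k10 : 0 < k1) (k20 : 0 < k2) (k30 : 0 < k3) (k40 : 0 < k4).
Hypothesis reg : regular_reference t0 L ref.

Local Notation f := (closed_loop c d ref k1 k2 k3 k4).

Definition datum_at (m0 t : R) (x : 'rV[R]_4) : datum :=
  Datum m0 (z_e x) (psi_e x) (r_e x - r_ed c d ref k1 k2 t x) (ubar_e x)
    (u_d ref t) (du_d ref t) (ddu_d ref t) (r_d ref t) (dr_d ref t)
    (sigma c d ref t (psi_e x)).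

Definition energy_at t x := energy k1 (datum_at 0 t x).

Lemma energy_ge0 t x : 0 <= energy_at t x.
Proof.
rewrite /energy_at /energy mulr_ge0 ?invr_ge0// !addr_ge0 ?sqr_ge0// mulr_ge0 ?sqr_ge0//.
exact: ltW.
Qed.

Lemma yaw_datum_at m0 t x : yaw k1 k2 (datum_at m0 t x) = r_e x + r_d ref t.
Proof. by rewrite /yaw /= /r_ed; ring. Qed.

Lemma closed_loopE m0 t x (p := datum_at m0 t x) :
  [/\ z_e (f t x) = z_rate k1 k2 p, psi_e (f t x) = psi_rate k1 k2 p,
      r_e (f t x) = dr_ed c d ref k1 k2 t x + e_rate k4 p &
      ubar_e (f t x) = ub_rate k1 k2 k3 p].
Proof.
rewrite /z_e /psi_e /r_e /ubar_e /closed_loop /error_system !mxE /= /z_rate /ub_rate.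
rewrite -/(z_e x) -/(psi_e x) -/(r_e x) -/(ubar_e x) /p yaw_datum_at; split.
- by rewrite /dz_e /=; ring.
- by rewrite /psi_rate /= /r_ed; ring.
- by rewrite /tau2_e /e_rate /=; ring.
- by rewrite /tau1_e /=; ring.
Qed.

Lemma cont_flat (g dg : R -> R) : flat_at_0 g dg -> continuous g.
Proof. by case=> _ _ Dg _ x; exact: deriv_cont (Dg x). Qed.

Lemma cont_sigma (A : set R) (fpsi : R -> R) :
  {within A, continuous (u_d ref)} -> {within A, continuous (du_d ref)} ->
  {within A, continuous (v_d ref)} -> {within A, continuous fpsi} ->
  {within A, continuous (fun s => sigma c d ref s (fpsi s))}.
Proof.
move=> cu cdu cv cpsi.
have cgv : {within A, continuous (fun s => gv (fpsi s))}.
  by apply: cont_comp => //; apply: cont_flat gv_flat.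
have cgu : {within A, continuous (fun s => gu (fpsi s))}.
  by apply: cont_comp => //; apply: cont_flat gu_flat.
rewrite (_ : (fun s => _) = (fun s => d * (- v_d ref s * gv (fpsi s)
  + u_d ref s * gu (fpsi s)) + c * du_d ref s + 2^-1 * d * v_d ref s * fpsi s
  + d * u_d ref s)); last by apply/funext => s; rewrite /sigma betaE.
by cont.
Qed.

Lemma cont_r_ed (A : set R) (x : R -> 'rV[R]_4) :
  {within A, continuous (u_d ref)} -> {within A, continuous (du_d ref)} ->
  {within A, continuous (v_d ref)} ->
  {within A, continuous (fun s => z_e (x s))} ->
  {within A, continuous (fun s => psi_e (x s))} ->
  {within A, continuous (fun s => r_ed c d ref k1 k2 s (x s))}.
Proof.
move=> cu cdu cv cz cpsi; have cs := cont_sigma A _ cu cdu cv cpsi.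
by rewrite /r_ed; cont.
Qed.

Lemma energy_cont (A : set R) (p : R -> datum) :
  {within A, continuous (fun s => dat_z (p s))} ->
  {within A, continuous (fun s => dat_psi (p s))} ->
  {within A, continuous (fun s => dat_e (p s))} ->
  {within A, continuous (fun s => dat_ub (p s))} ->
  {within A, continuous (fun s => energy k1 (p s))}.
Proof. by move=> ? ? ? ?; rewrite /energy; cont. Qed.

Lemma cross_cont (A : set R) (p : R -> datum) m0 : (forall s, dat_m (p s) = m0) ->
  {within A, continuous (fun s => dat_z (p s))} ->
  {within A, continuous (fun s => dat_psi (p s))} ->
  {within A, continuous (fun s => dat_ub (p s))} ->
  {within A, continuous (fun s => dat_u (p s))} ->
  {within A, continuous (fun s => dat_du (p s))} ->
  {within A, continuous (fun s => dat_r (p s))} ->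
  {within A, continuous (fun s => cross c d k1 (p s))}.
Proof.
move=> pm ? ? ? ? ? ?.
rewrite (_ : (fun s => _) = (fun s => weight k1 m0 *
  (c * dat_du (p s) + d * dat_u (p s)) * dat_z (p s) * dat_psi (p s)
  - dat_r (p s) * dat_z (p s) * dat_ub (p s)
  + 2^-1 * k1 * c * d * dat_u (p s) ^+ 2 * dat_z (p s) ^+ 2)); last first.
  by apply/funext => s; rewrite /cross pm.
by cont.
Qed.

Lemma within_co_segment (T s t : R) (g : R -> R) : t0 <= s -> t < T ->
  {within `[t0, T[, continuous g} -> {within `[s, t], continuous g}.
Proof.
move=> t0s tT; apply: continuous_subspaceW => r /=; rewrite !in_itv /= => /andP[sr rt].
by rewrite (le_trans t0s sr) (le_lt_trans rt tT).
Qed.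

(** A sum in place of 2 max (1/k1, 1): then [eta * energy] exceeds the sum of the squared
    coordinates by an explicit sum of squares. *)
Definition eta := 2 * (k1^-1 + 1).

Lemma eta_pos : 0 < eta.
Proof. by rewrite mulr_gt0// addr_gt0// invr_gt0. Qed.

Lemma coord_le_energy (p : datum) m0 : 0 <= m0 -> eta * energy k1 p <= m0 ^+ 2 ->
  [/\ `|dat_z p| <= m0, `|dat_psi p| <= m0, `|dat_e p| <= m0 & `|dat_ub p| <= m0].
Proof.
move=> m00.
have -> : eta * energy k1 p = dat_z p ^+ 2 + dat_psi p ^+ 2 + dat_e p ^+ 2 + dat_ub p ^+ 2
    + (k1 * dat_z p ^+ 2 + k1^-1 * dat_psi p ^+ 2 + k1^-1 * dat_e p ^+ 2 + k1^-1 * dat_ub p ^+ 2).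
  by rewrite /energy /eta; field; rewrite gt_eqF.
have k1V : 0 < k1^-1 by rewrite invr_gt0.
have sq (a : R) : 0 <= a ^+ 2 by exact: sqr_ge0.
have h1 := mulr_ge0 (ltW k10) (sq (dat_z p)); have h2 := mulr_ge0 (ltW k1V) (sq (dat_psi p)).
have h3 := mulr_ge0 (ltW k1V) (sq (dat_e p)); have h4 := mulr_ge0 (ltW k1V) (sq (dat_ub p)).
have := sq (dat_z p); have := sq (dat_psi p); have := sq (dat_e p); have := sq (dat_ub p).
have root (a : R) : a ^+ 2 <= m0 ^+ 2 -> `|a| <= m0.
  by rewrite -[a ^+ 2]real_normK ?num_real// ler_pXn2r ?nnegrE.
by move=> ? ? ? ? h; split; apply: root; lra.
Qed.

(** sigma - w consists of three terms, which gives 3 d L. The additional L makes the same constant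
    bound the reference signals, as [admissible] uses one constant for both. *)
Definition gain := L * (1 + 3 * d).

Lemma sigma_close t a m0 : t0 <= t -> 1 <= m0 -> `|a| <= m0 ->
  `|sigma c d ref t a - (c * du_d ref t + d * u_d ref t)| <= gain * m0 * `|a|.
Proof.
move=> t0t m1 am; have L1 := reg_ge1 _ _ _ reg.
have [[uL _ _ _ _] [vL _]] := reg_bound _ _ _ reg t t0t.
have [gv2 _ _ _] := @gv_flat R; have [gu2 _ _ _] := @gu_flat R.
have a0 := normr_ge0 a; have aa : `|a| ^+ 2 <= m0 * `|a| by rewrite expr2 ler_wpM2r.
have b1 : `|v_d ref t * gv a| <= L * (m0 * `|a|).
  by rewrite normrM ler_pM// (le_trans (gv2 a)).
have b2 : `|u_d ref t * gu a| <= L * (m0 * `|a|).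
  by rewrite normrM ler_pM// (le_trans (gu2 a)).
have b3 : `|v_d ref t * a| <= L * (m0 * `|a|).
  by rewrite normrM ler_pM// ler_peMl.
have -> : sigma c d ref t a - (c * du_d ref t + d * u_d ref t) =
  d * (- (v_d ref t * gv a) + u_d ref t * gu a + 2^-1 * (v_d ref t * a)).
  by rewrite /sigma betaE; ring.
rewrite normrM (gtr0_norm d0).
have b4 : `|- (v_d ref t * gv a) + u_d ref t * gu a + 2^-1 * (v_d ref t * a)| <=
    3 * (L * (m0 * `|a|)).
  rewrite (le_trans (ler_normD _ _))// (le_trans (lerD (ler_normD _ _) (lexx _)))//.
  rewrite normrN [`|2^-1 * _|]normrM (ger0_norm (x := 2^-1)) ?invr_ge0//.
  by have := normr_ge0 (v_d ref t * a); lra.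
rewrite (le_trans (ler_wpM2l (ltW d0) b4))//.
have -> : gain * m0 * `|a| = L * (m0 * `|a|) + d * (3 * (L * (m0 * `|a|))).
  by rewrite /gain; ring.
by rewrite lerDr mulr_ge0 ?(le_trans _ L1)// mulr_ge0// (le_trans _ m1).
Qed.

Lemma gain_ge : L <= gain.
Proof.
rewrite /gain ler_peMr ?lerDl ?(le_trans _ (reg_ge1 _ _ _ reg))//.
by rewrite mulr_ge0// ltW.
Qed.

Lemma admissible_at t x m0 : t0 <= t -> 1 <= m0 -> eta * energy_at t x <= m0 ^+ 2 ->
  admissible c d gain (datum_at m0 t x).
Proof.
move=> t0t m1 h; have m00 : 0 <= m0 by exact: le_trans m1.
have [hz hpsi he hub] := coord_le_energy (datum_at m0 t x) m0 m00 h.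
have gL := gain_ge.
have [[h1 h2 h3 h4 h5] _] := reg_bound _ _ _ reg t t0t.
by split => //; [split; apply: le_trans gL|exact: sigma_close].
Qed.

Variables (K mu delta t1 : R).
Hypotheses (K1 : 1 <= K) (mu0 : 0 < mu) (t01 : t0 <= t1).
Hypothesis excited : forall t, t1 <= t -> delta <= `|u_d ref t| + `|r_d ref t|.
Hypothesis strict : forall p : datum, admissible c d gain p ->
  let W := K * dat_m p ^+ 10 * energy k1 p + cross c d k1 p in
  [/\ energy k1 p <= W, W <= 2 * K * dat_m p ^+ 10 * energy k1 p &
   delta <= `|dat_u p| + `|dat_r p| ->
   K * dat_m p ^+ 10 * denergy k2 k3 k4 p + dcross c d k1 k2 k3 p <= - mu * energy k1 p].

(** Combines W' <= - mu V with W <= 2 K m^10 V. *)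
Definition rate m0 := mu / (2 * K * m0 ^+ 10).

Section Trajectory.
Variables (T : R) (x : R -> 'rV[R]_4).
Hypothesis t0T : t0 < T.
Hypothesis traj : trajectory f `[t0, T[ x.

Let ref_within (g dg : R -> R) : piecewise_derivative `[t0, +oo[ g dg ->
  {within `[t0, T[, continuous g}.
Proof.
move=> [gc _]; apply: continuous_subspaceW gc => r /=.
by rewrite !in_itv /= => /andP[->].
Qed.

Let zc : {within `[t0, T[, continuous (fun s => z_e (x s))}.
Proof. by case: (traj (@Ordinal 4 0 isT)). Qed.
Let psic : {within `[t0, T[, continuous (fun s => psi_e (x s))}.
Proof. by case: (traj (@Ordinal 4 1 isT)). Qed.
Let rc : {within `[t0, T[, continuous (fun s => r_e (x s))}.
Proof. by case: (traj (@Ordinal 4 2 isT)). Qed.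
Let ubc : {within `[t0, T[, continuous (fun s => ubar_e (x s))}.
Proof. by case: (traj (@Ordinal 4 3 isT)). Qed.
Let uc := ref_within _ _ (reg_u _ _ _ reg).
Let duc := ref_within _ _ (reg_du _ _ _ reg).
Let rdc := ref_within _ _ (reg_r _ _ _ reg).
Let vc := ref_within _ _ (reg_v _ _ _ reg).

Let ec : {within `[t0, T[, continuous
  (fun s => r_e (x s) - r_ed c d ref k1 k2 s (x s))}.
Proof. by have h := cont_r_ed _ x uc duc vc zc psic; cont. Qed.

Lemma trajectory_derivatives : exists2 E : set R, locally_finite E &
  forall t, t0 < t -> t < T -> ~ E t -> forall m0, let p s := datum_at m0 s (x s) in
   is_derive t (1 : R) (fun s => energy k1 (p s)) (denergy k2 k3 k4 (p t)) /\
   is_derive t (1 : R) (fun s => cross c d k1 (p s)) (dcross c d k1 k2 k3 (p t)).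
Proof.
have [_ [E0 l0 D0]] := traj (@Ordinal 4 0 isT).
have [_ [E1 l1 D1]] := traj (@Ordinal 4 1 isT).
have [_ [E2 l2 D2]] := traj (@Ordinal 4 2 isT).
have [_ [E3 l3 D3]] := traj (@Ordinal 4 3 isT).
have [_ [E4 l4 D4]] := reg_u _ _ _ reg; have [_ [E5 l5 D5]] := reg_du _ _ _ reg.
have [_ [E6 l6 D6]] := reg_r _ _ _ reg; have [_ [E7 l7 D7]] := reg_v _ _ _ reg.
exists (E0 `|` (E1 `|` (E2 `|` (E3 `|` (E4 `|` (E5 `|` (E6 `|` E7))))))).
  by do 7![apply: locally_finiteU => //].
move=> t t0t tT /not_orP[n0 /not_orP[n1 /not_orP[n2 /not_orP[n3 /not_orP[n4
  /not_orP[n5 /not_orP[n6 n7]]]]]]] m0 p.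
have It : (`[t0, T[%classic)° t by rewrite interior_itv_bnd /= in_itv /= t0t tT.
have Iy : (`[t0, +oo[%classic)° t by rewrite interior_itv_bndy /= in_itv /= t0t.
have {D0}Dz := D0 t It n0; have {D1}Dpsi := D1 t It n1.
have {D2}Dr := D2 t It n2; have {D3}Dub := D3 t It n3.
have {D4}Du := D4 t Iy n4; have {D5}Ddu := D5 t Iy n5.
have {D6}Drd := D6 t Iy n6; have {D7}Dv := D7 t Iy n7.
have [Ez Epsi Er Eub] := closed_loopE m0 t (x t).
rewrite -/(z_e _) Ez in Dz; rewrite -/(psi_e _) Epsi in Dpsi.
rewrite -/(r_e _) Er in Dr; rewrite -/(ubar_e _) Eub in Dub.
have De : is_derive t (1 : R) (fun s => r_e (x s) - r_ed c d ref k1 k2 s (x s))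
    (e_rate k4 (datum_at m0 t (x t))).
  have Dred : is_derive t (1 : R) (fun s => r_ed c d ref k1 k2 s (x s))
      (dr_ed c d ref k1 k2 t (x t)).
    apply: deriv_r_ed => //.
    - by apply: (deriv_eq Dz); rewrite /z_rate yaw_datum_at /dz_e /=; ring.
    - by apply: (deriv_eq Dpsi); rewrite /psi_rate /= /r_ed; ring.
  by apply: (deriv_eq (deriv_add Dr (deriv_opp Dred))); ring.
by split; [apply: deriv_energy|apply: (deriv_cross p t m0)].
Qed.

Lemma energy_nonincreasing s t : t0 <= s -> s <= t -> t < T -> energy_at t (x t) <= energy_at s (x s).
Proof.
move=> t0s st tT; have [E lE D] := trajectory_derivatives.
pose G s := energy_at s (x s); pose dG s := denergy k2 k3 k4 (datum_at 0 s (x s)).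
apply: (nonincreasing_off E G dG s t st lE).
  by apply: within_co_segment t0s tT _; apply: energy_cont.
move=> r /andP[sr rt] nE; split.
  by have [] := D r (le_lt_trans t0s sr) (lt_trans rt tT) nE 0.
rewrite /dG /denergy.
have := mulr_ge0 (ltW k20) (sqr_ge0 (dat_psi (datum_at 0 r (x r)))).
have := mulr_ge0 (ltW k40) (sqr_ge0 (dat_e (datum_at 0 r (x r)))).
have := mulr_ge0 (ltW k30) (sqr_ge0 (dat_ub (datum_at 0 r (x r)))).
by lra.
Qed.

(** Since V does not increase, its bound at [p] keeps the trajectory in the box of size [m0]. The
    first estimate serves to reach V <= 1: its waiting time is polynomial in the energy, with no
    logarithm. The second gives the rate afterwards. *)
Lemma strict_decay m0 p t : t1 <= p -> p <= t -> t < T -> 1 <= m0 ->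
  eta * energy_at p (x p) <= m0 ^+ 2 ->
  mu * (t - p) * energy_at t (x t) <= 2 * K * m0 ^+ 10 * energy_at p (x p) /\
  energy_at t (x t) <= 2 * K * m0 ^+ 10 * energy_at p (x p) * expR (- rate m0 * (t - p)).
Proof.
move=> t1p pt tT m1 etaV; have eta_gt0 := eta_pos; have t0p := le_trans t01 t1p.
have m100 : 0 < 2 * K * m0 ^+ 10.
  by rewrite mulr_gt0 ?mulr_gt0 ?exprn_gt0 ?(lt_le_trans _ K1) ?(lt_le_trans _ m1).
pose P s := datum_at m0 s (x s).
pose W s := K * m0 ^+ 10 * energy k1 (P s) + cross c d k1 (P s).
pose dW s := K * m0 ^+ 10 * denergy k2 k3 k4 (P s) + dcross c d k1 k2 k3 (P s).
have Wc : {within `[p, t], continuous W}.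
  apply: within_co_segment t0p tT _.
  have Vc : {within `[t0, T[, continuous (fun s => energy k1 (P s))}.
    exact: energy_cont.
  have Uc : {within `[t0, T[, continuous (fun s => cross c d k1 (P s))}.
    exact: (cross_cont _ P m0).
  by rewrite /W; cont.
have facts s : p <= s -> s <= t ->
    [/\ energy_at s (x s) <= W s, W s <= 2 * K * m0 ^+ 10 * energy_at s (x s) & dW s <= - mu * energy_at s (x s)].
  move=> ps st; have t0s := le_trans t0p ps.
  have Vs : eta * energy_at s (x s) <= m0 ^+ 2.
    by apply: le_trans etaV; rewrite ler_pM2l//; apply: energy_nonincreasing => //; apply: le_lt_trans tT.
  have [h1 h2 h3] := strict _ (admissible_at s (x s) m0 t0s m1 Vs).
  by split => //; apply: h3; apply: excited; exact: le_trans ps.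
have [E lE D] := trajectory_derivatives.
have DW s : p < s -> s < t -> ~ E s -> is_derive s (1 : R) W (dW s).
  move=> ps st nE; have [D1 D2] := D s (le_lt_trans t0p ps) (lt_trans st tT) nE m0.
  by rewrite /W /dW; deriv; ring.
have [_ Wp _] := facts p (lexx p) pt; have [Wt _ _] := facts t pt (lexx t).
split.
- have : W t + mu * energy_at t (x t) * t <= W p + mu * energy_at t (x t) * p.
    (* [t] is frozen: on [p, t] the energy is at least its final value, so W decreases at least at
       the constant speed mu V(t). *)
    pose G s := W s + mu * energy_at t (x t) * s.
    apply: (nonincreasing_off E G (fun s => dW s + mu * energy_at t (x t)) p t pt lE).
      rewrite /G; have lc : {within `[p, t], continuous (fun s : R => s)}.
        by apply: continuous_subspaceT => s; exact: cvg_id.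
      by cont.
    move=> s /andP[ps st] nE; have Ds := DW s ps st nE.
    split; first by rewrite /G; deriv; ring.
    have [_ _ h] := facts s (ltW ps) (ltW st).
    have : mu * energy_at t (x t) <= mu * energy_at s (x s).
      by rewrite ler_pM2l//; apply: energy_nonincreasing => //; [exact: le_trans (ltW ps)|exact: ltW].
    by lra.
  by have := energy_ge0 t (x t); lra.
- have De s : is_derive s (1 : R) (fun s => expR (rate m0 * s)) (rate m0 * expR (rate m0 * s)).
    have h : is_derive s (1 : R) (fun s => rate m0 * s) (rate m0) by deriv; ring.
    have i := deriv_comp (g := expR) h (is_derive_expR _).
    by apply: (deriv_eq i); rewrite mulrC.
  have : W t * expR (rate m0 * t) <= W p * expR (rate m0 * p).
    pose G s := W s * expR (rate m0 * s).
    pose dG s := expR (rate m0 * s) * (dW s + rate m0 * W s).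
    apply: (nonincreasing_off E G dG p t pt lE).
      rewrite /G; have expc : {within `[p, t], continuous (fun s : R => expR (rate m0 * s))}.
        by apply: deriv_cont_within => s _; exact: De.
      by cont.
    move=> s /andP[ps st] nE; have Ds := DW s ps st nE; have Des := De s.
    split; first by rewrite /G /dG; deriv; ring.
    rewrite /dG; have [_ h1 h2] := facts s (ltW ps) (ltW st).
    rewrite mulr_ge0_le0 ?expR_ge0//.
    have : rate m0 * W s <= mu * energy_at s (x s).
      have -> : mu * energy_at s (x s) = rate m0 * (2 * K * m0 ^+ 10 * energy_at s (x s)).
        by rewrite /rate mulrA divfK// gt_eqF.
      by rewrite ler_pM2l// /rate divr_gt0.
    by lra.
  have ep := expR_gt0 (rate m0 * t).
  rewrite (_ : - rate m0 * (t - p) = rate m0 * p - rate m0 * t); last by ring.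
  rewrite expRD expRN mulrA ler_pdivlMr// => h.
  rewrite (le_trans _ (ler_wpM2r (expR_ge0 _) Wp))// (le_trans _ h)//.
  by rewrite ler_pM2r.
Qed.

Lemma energy_exponential_decay t :
  let V0 := energy_at t0 (x t0) in let M := 2 * K * (1 + eta) ^+ 10 in
  let gam := rate (1 + eta) in
  t0 <= t -> t < T ->
  energy_at t (x t) <= M * V0 * expR (gam * (t1 - t0 + 2 * K * (1 + eta * V0) ^+ 10 * V0 / mu))
    * expR (- gam * (t - t0)).
Proof.
move=> V0 M gam t0t tT; have eta_gt0 := eta_pos; have V00 : 0 <= V0 by exact: energy_ge0.
have K0 : 0 < K by exact: lt_le_trans K1.
have eta1 : 1 <= 1 + eta by rewrite lerDl ltW.
have M1 : 1 <= M.
  rewrite /M; apply: mulr_ege1; last by rewrite exprn_ege1.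
  by apply: mulr_ege1 => //; lra.
have gam0 : 0 < gam.
  rewrite /gam /rate; apply: divr_gt0 => //; apply: mulr_gt0; first exact: mulr_gt0.
  by rewrite exprn_gt0// (lt_le_trans _ eta1).
set N := 2 * K * (1 + eta * V0) ^+ 10 * V0.
have N0 : 0 <= N.
  apply: mulr_ge0 => //; apply: mulr_ge0; first by rewrite mulr_ge0// ltW.
  by rewrite exprn_ge0// addr_ge0// mulr_ge0// ltW.
(* The waiting time for which the first estimate of [strict_decay], started at [t1], reads N V <=
   N. *)
set T0 := N / mu; have T00 : 0 <= T0 by rewrite divr_ge0// ltW.
have [tt2|t2t] := leP t (t1 + T0).
  (* Up to [t1 + T0] monotonicity of V suffices, because the claimed bound is still at least V0
     there. *)
  rewrite -mulrA -expRD (le_trans (energy_nonincreasing t0 t (lexx _) t0t tT))//.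
  rewrite -/V0 -[leLHS]mul1r -mulrA ler_pM// ler_peMr// -expR0 ler_expR.
  rewrite (_ : _ + _ = gam * (t1 + T0 - t)); last by ring.
  by rewrite mulr_ge0 ?subr_ge0// ltW.
set t2 := t1 + T0 in t2t.
have t12 : t1 <= t2 by rewrite /t2 lerDl.
have t2T := lt_trans t2t tT.
have V2 : energy_at t2 (x t2) <= V0 by apply: energy_nonincreasing => //; exact: le_trans t12.
have V21 : energy_at t2 (x t2) <= 1.
  (* For V0 = 0 also N = 0, and N V <= N could not be divided by N. *)
  have [V0z|V0p] := leP V0 0; first by rewrite (le_trans V2)// (le_trans V0z).
  have V1 : energy_at t1 (x t1) <= V0 by apply: energy_nonincreasing => //; exact: le_lt_trans t2T.
  have m1 : 1 <= 1 + eta * V0 by rewrite lerDl mulr_ge0// ltW.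
  have e1 : eta * energy_at t1 (x t1) <= (1 + eta * V0) ^+ 2.
    rewrite (le_trans (ler_wpM2l (ltW eta_pos) V1))//.
    by have : 0 <= eta * V0 by [rewrite mulr_ge0// ltW]; move: (eta * V0) => q; nra.
  have [h _] := strict_decay (1 + eta * V0) t1 t2 (lexx _) t12 t2T m1 e1.
  have Np : 0 < N.
    apply: mulr_gt0 => //; apply: mulr_gt0; first exact: mulr_gt0.
    by rewrite exprn_gt0// (lt_le_trans _ m1).
  have : N * energy_at t2 (x t2) <= N.
    apply: le_trans (_ : 2 * K * (1 + eta * V0) ^+ 10 * energy_at t1 (x t1) <= _); last first.
      rewrite /N ler_wpM2l//; apply: mulr_ge0; first by rewrite mulr_ge0// ltW.
      by rewrite exprn_ge0// (le_trans _ m1).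
    apply: le_trans h; have -> : mu * (t2 - t1) = N; last exact: lexx.
    by rewrite /t2 addrAC subrr add0r mulrC divfK// gt_eqF.
  by rewrite -[leRHS]mulr1 ler_pM2l.
(* With V <= 1 the box size becomes [1 + eta], whatever the initial state; the rate [gam] is built
   on it. *)
have e2 : eta * energy_at t2 (x t2) <= (1 + eta) ^+ 2.
  rewrite (le_trans (ler_wpM2l (ltW eta_pos) V21))//.
  by move: eta_pos; move: eta => q; nra.
have [_ h] := strict_decay (1 + eta) t2 t t12 (ltW t2t) tT eta1 e2.
apply: (le_trans h); rewrite -/M -/gam -[leRHS]mulrA -expRD.
rewrite (_ : _ + - gam * (t - t0) = - gam * (t - t2)); last by rewrite /t2; ring.
by rewrite ler_wpM2r ?expR_ge0// ler_wpM2l// (le_trans _ M1).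
Qed.

End Trajectory.

End AlongTrajectories.

(** * The closed loop as a system *)

Section Row4.
Context {R : realType}.

Definition row4 (a0 a1 a2 a3 : R) : 'rV[R]_4 :=
  \row_(i < 4) nth 0 [:: a0; a1; a2; a3] i.

Lemma row4E a0 a1 a2 a3 (x := row4 a0 a1 a2 a3) :
  [/\ z_e x = a0, psi_e x = a1, r_e x = a2 & ubar_e x = a3].
Proof. by rewrite /z_e /psi_e /r_e /ubar_e !mxE. Qed.

(** [P] ranges over functions of time and state, so the same case analysis handles values, bounds,
    continuity and Lipschitz estimates. *)
Lemma row4_coord (P : (R -> 'rV[R]_4 -> R) -> Prop) (g0 g1 g2 g3 : R -> 'rV[R]_4 -> R) :
  P g0 -> P g1 -> P g2 -> P g3 ->
  forall i, P (fun t x => row4 (g0 t x) (g1 t x) (g2 t x) (g3 t x) 0 i).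
Proof.
move=> h0 h1 h2 h3 [[|[|[|[|//]]]] i4].
- by rewrite (_ : (fun t x => _) = g0)//; apply/funext => t; apply/funext => x; rewrite mxE.
- by rewrite (_ : (fun t x => _) = g1)//; apply/funext => t; apply/funext => x; rewrite mxE.
- by rewrite (_ : (fun t x => _) = g2)//; apply/funext => t; apply/funext => x; rewrite mxE.
- by rewrite (_ : (fun t x => _) = g3)//; apply/funext => t; apply/funext => x; rewrite mxE.
Qed.

Lemma row4_surj (x : 'rV[R]_4) : x = row4 (z_e x) (psi_e x) (r_e x) (ubar_e x).
Proof.
by apply/rowP => -[[|[|[|[|//]]]] i4]; rewrite mxE /=; congr (x _ _); apply/val_inj.
Qed.

End Row4.

Section ClosedLoopSystem.
Context {R : realType}.
Variables (c d k1 k2 k3 k4 t0 L : R) (ref : reference R).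
Hypothesis reg : regular_reference t0 L ref.

Local Notation f := (closed_loop c d ref k1 k2 k3 k4).

Lemma closed_loop0 t : f t 0 = 0.
Proof.
apply/rowP => i; rewrite [RHS]mxE; move: i.
apply: (row4_coord (fun F => F t 0 = 0) (dz_e c d ref) (fun _ x => r_e x)
  (tau2_e c d ref k1 k2 k4) (tau1_e ref k1 k3)); rewrite /tau2_e /tau1_e /dr_ed /r_ed;
  by rewrite /dz_e /z_e /psi_e /r_e /ubar_e !mxE; ring.
Qed.

Let pcu : piecewise_continuous t0 (u_d ref).
Proof. by have [h _] := reg_u _ _ _ reg; exact: (pc_of_within _ _ h). Qed.
Let pcdu : piecewise_continuous t0 (du_d ref).
Proof. by have [h _] := reg_du _ _ _ reg; exact: (pc_of_within _ _ h). Qed.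
Let pcr : piecewise_continuous t0 (r_d ref).
Proof. by have [h _] := reg_r _ _ _ reg; exact: (pc_of_within _ _ h). Qed.
Let pcv : piecewise_continuous t0 (v_d ref).
Proof. by have [h _] := reg_v _ _ _ reg; exact: (pc_of_within _ _ h). Qed.
Let pcddu := reg_ddu_pc _ _ _ reg.
Let pcdv := reg_dv_pc _ _ _ reg.

Lemma pc_sigma a : piecewise_continuous t0 (fun t => sigma c d ref t a).
Proof. by rewrite /sigma; under eq_fun do rewrite betaE; PC. Qed.

Lemma pc_dsigma a b : piecewise_continuous t0 (fun t => dsigma c d ref t a b).
Proof. by rewrite /dsigma; under eq_fun do rewrite dbetaE; PC. Qed.

Lemma pc_closed_loop x i : piecewise_continuous t0 (fun t => f t x 0 i).
Proof.
have ps := pc_sigma (psi_e x); have pds := pc_dsigma (psi_e x) (r_e x).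
move: i; apply: (row4_coord (fun F => piecewise_continuous t0 (fun t => F t x))
  (dz_e c d ref) (fun _ x => r_e x) (tau2_e c d ref k1 k2 k4) (tau1_e ref k1 k3)).
- by rewrite /dz_e; PC.
- by PC.
- by rewrite /tau2_e /dr_ed /r_ed /dz_e; PC.
- by rewrite /tau1_e; PC.
Qed.

Lemma flat_lip (g dg : R -> R) : flat_at_0 g dg -> forall M, 0 <= M ->
  exists2 H, 0 <= H & forall a b, `|a| <= M -> `|b| <= M -> `|g a - g b| <= H * `|a - b|.
Proof.
move=> [_ dgle Dg _] M M0; exists (2 * M); first by rewrite mulr_ge0.
move=> a b aM bM; wlog ab : a b aM bM / a <= b.
  have [ab|/ltW ba] := leP a b; first exact.
  by move=> /(_ _ _ bM aM ba); rewrite distrC [`|b - a|]distrC.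
rewrite distrC (distrC a) (ger0_norm (x := b - a)) ?subr_ge0// mulrBr.
have Dl t : is_derive t (1 : R) (fun s => 2 * M * s) (2 * M) by deriv; ring.
apply: (@le_deriv_bound R g dg (fun s => 2 * M * s) (fun=> 2 * M)) => //.
- by apply: (@deriv_cont_within _ _ _ dg).
- by apply: (@deriv_cont_within _ _ _ (fun=> 2 * M)).
- move=> t /andP[at_ tb]; rewrite (le_trans (dgle t))// ler_wpM2l//.
  by move: aM bM; rewrite !ler_norml => /andP[? ?] /andP[? ?]; lra.
Qed.

Lemma dflat_lip (g dg : R -> R) : flat_at_0 g dg -> forall M, 0 <= M ->
  exists2 H, 0 <= H & forall a b, `|a| <= M -> `|b| <= M -> `|dg a - dg b| <= H * `|a - b|.
Proof. by move=> [_ _ _ h] M _; exists 5. Qed.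

Section Lipschitz.
Variable m0 : R.
Local Notation BL := (@bounded_lipschitz R 4 t0 m0).
Let n0 : (0 < 4)%N. Proof. by []. Qed.

Let blu : BL (fun t _ => u_d ref t).
Proof. by apply: BL_signal => //; exists L => t /(reg_bound _ _ _ reg)[[]]. Qed.
Let bldu : BL (fun t _ => du_d ref t).
Proof. by apply: BL_signal => //; exists L => t /(reg_bound _ _ _ reg)[[]]. Qed.
Let blddu : BL (fun t _ => ddu_d ref t).
Proof. by apply: BL_signal => //; exists L => t /(reg_bound _ _ _ reg)[[]]. Qed.
Let blr : BL (fun t _ => r_d ref t).
Proof. by apply: BL_signal => //; exists L => t /(reg_bound _ _ _ reg)[[]]. Qed.
Let blv : BL (fun t _ => v_d ref t).
Proof. by apply: BL_signal => //; exists L => t /(reg_bound _ _ _ reg)[_ []]. Qed.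
Let bldv : BL (fun t _ => dv_d ref t).
Proof. by apply: BL_signal => //; exists L => t /(reg_bound _ _ _ reg)[_ []]. Qed.
Let blz : BL (fun _ x => z_e x). Proof. exact: BL_coord. Qed.
Let blpsi : BL (fun _ x => psi_e x). Proof. exact: BL_coord. Qed.
Let blre : BL (fun _ x => r_e x). Proof. exact: BL_coord. Qed.
Let blub : BL (fun _ x => ubar_e x). Proof. exact: BL_coord. Qed.

Lemma BL_sigma : BL (fun t x => sigma c d ref t (psi_e x)).
Proof.
have gvl : BL (fun t x => gv (psi_e x)) by apply: BL_comp => //; exact: flat_lip gv_flat.
have gul : BL (fun t x => gu (psi_e x)) by apply: BL_comp => //; exact: flat_lip gu_flat.
rewrite (_ : (fun t x => _) = (fun t x => d * (- v_d ref t * gv (psi_e x)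
  + u_d ref t * gu (psi_e x)) + c * du_d ref t + 2^-1 * d * v_d ref t * psi_e x
  + d * u_d ref t)); first by BL.
by apply/funext => t; apply/funext => x; rewrite /sigma betaE.
Qed.

Lemma BL_dsigma : BL (fun t x => dsigma c d ref t (psi_e x) (r_e x)).
Proof.
have gvl : BL (fun t x => gv (psi_e x)) by apply: BL_comp => //; exact: flat_lip gv_flat.
have gul : BL (fun t x => gu (psi_e x)) by apply: BL_comp => //; exact: flat_lip gu_flat.
have dgvl : BL (fun t x => dgv (psi_e x)) by apply: BL_comp => //; exact: dflat_lip gv_flat.
have dgul : BL (fun t x => dgu (psi_e x)) by apply: BL_comp => //; exact: dflat_lip gu_flat.
rewrite (_ : (fun t x => _) = (fun t x => d * (- dv_d ref t * gv (psi_e x)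
  - v_d ref t * dgv (psi_e x) * r_e x
  + du_d ref t * gu (psi_e x) + u_d ref t * dgu (psi_e x) * r_e x)
  + c * ddu_d ref t + 2^-1 * d * (dv_d ref t * psi_e x + v_d ref t * r_e x)
  + d * du_d ref t)); first by BL.
by apply/funext => t; apply/funext => x; rewrite /dsigma dbetaE.
Qed.

Lemma BL_closed_loop i : BL (fun t x => f t x 0 i).
Proof.
have bs := BL_sigma; have bds := BL_dsigma.
move: i; apply: (row4_coord (fun F => BL F)
  (dz_e c d ref) (fun _ x => r_e x) (tau2_e c d ref k1 k2 k4) (tau1_e ref k1 k3)).
- by rewrite /dz_e; BL.
- by [].
- by rewrite /tau2_e /dr_ed /r_ed /dz_e; BL.
- by rewrite /tau1_e; BL.
Qed.

End Lipschitz.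

Lemma closed_loop_system : system t0 f.
Proof.
split; [by move=> t _; exact: closed_loop0|exact: pc_closed_loop|].
by apply: lipschitz_of_BL => // m0 i; exact: BL_closed_loop.
Qed.

End ClosedLoopSystem.

(** * Global trajectories of the closed loop *)

Section GlobalExistence.
Context {R : realType}.
Variables (c d k1 k2 k3 k4 t0 L : R) (ref : reference R).
Hypotheses (k10 : 0 < k1) (k20 : 0 < k2) (k30 : 0 < k3) (k40 : 0 < k4).
Hypothesis reg : regular_reference t0 L ref.

Local Notation f := (closed_loop c d ref k1 k2 k3 k4).

(* In the coordinates (z_e, psi_e, r_e - r_ed, ubar_e) the right-hand side is
   continuous in time, since u_d'' and v_d' no longer occur. *)
Definition shifted_datum (t : R) (y : 'rV[R]_4) : datum :=
  Datum 0 (z_e y) (psi_e y) (r_e y) (ubar_e y)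
    (u_d ref t) (du_d ref t) (ddu_d ref t) (r_d ref t) (dr_d ref t)
    (sigma c d ref t (psi_e y)).

Definition shifted_field (t : R) (y : 'rV[R]_4) : 'rV[R]_4 :=
  let p := shifted_datum t y in
  row4 (z_rate k1 k2 p) (psi_rate k1 k2 p) (e_rate k4 p) (ub_rate k1 k2 k3 p).

Lemma BL_shifted_field m0 i :
  bounded_lipschitz t0 m0 (fun t y => shifted_field t y 0 i).
Proof.
have n0 : (0 < 4)%N by [].
have bs := BL_sigma c d t0 L ref reg m0.
have br : @bounded_lipschitz R 4 t0 m0 (fun t _ => r_d ref t).
  by apply: BL_signal => //; exists L => t /(reg_bound _ _ _ reg)[[]].
have bz : bounded_lipschitz t0 m0 (fun _ y => @z_e R y) by exact: BL_coord.
have bpsi : bounded_lipschitz t0 m0 (fun _ y => @psi_e R y) by exact: BL_coord.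
have be : bounded_lipschitz t0 m0 (fun _ y => @r_e R y) by exact: BL_coord.
have bub : bounded_lipschitz t0 m0 (fun _ y => @ubar_e R y) by exact: BL_coord.
have byaw : bounded_lipschitz t0 m0 (fun t y => yaw k1 k2 (shifted_datum t y)).
  by rewrite /yaw /=; BL.
move: i; apply: (row4_coord (fun F => bounded_lipschitz t0 m0 F)).
- by rewrite /z_rate /=; BL.
- by rewrite /psi_rate /=; BL.
- by rewrite /e_rate /=; BL.
- by rewrite /ub_rate /=; BL.
Qed.

Lemma shifted_field_cont y i :
  {within `[t0, +oo[, continuous (fun t => shifted_field t y 0 i)}.
Proof.
have [uc _] := reg_u _ _ _ reg; have [duc _] := reg_du _ _ _ reg.
have [rc _] := reg_r _ _ _ reg; have [vc _] := reg_v _ _ _ reg.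
have sc := cont_sigma c d ref `[t0, +oo[ (fun=> psi_e y) uc duc vc (cont_cst _).
move: i; apply: (row4_coord (fun F => {within `[t0, +oo[, continuous (fun t => F t y)})
  (fun t y => z_rate k1 k2 (shifted_datum t y)) (fun t y => psi_rate k1 k2 (shifted_datum t y))
  (fun t y => e_rate k4 (shifted_datum t y)) (fun t y => ub_rate k1 k2 k3 (shifted_datum t y))).
- by rewrite /z_rate /yaw /=; cont.
- by rewrite /psi_rate /=; cont.
- by rewrite /e_rate /=; cont.
- by rewrite /ub_rate /yaw /=; cont.
Qed.

(** The factor [chi >= 0] multiplies V' and preserves its sign, so the bound holds for the truncated
    problem before its solution is known to solve the original one. *)
Lemma shifted_stays_bounded (y : R -> 'rV[R]_4) (chi : R -> R) :
  (forall i, continuous (fun s => y s 0 i)) ->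
  (forall t, t0 < t -> 0 <= chi t /\
     forall i, is_derive t (1 : R) (fun s => y s 0 i) (chi t * shifted_field t (y t) 0 i)) ->
  forall t, t0 <= t ->
    in_box (1 + eta k1 * energy k1 (shifted_datum t0 (y t0))) (y t).
Proof.
move=> yc yD t t0t; set V0 := energy _ _.
pose G s := energy k1 (shifted_datum s (y s)).
pose dG s := chi s * denergy k2 k3 k4 (shifted_datum s (y s)).
have GV : G t <= V0.
  apply: (nonincreasing_off set0 G dG t0 t t0t locally_finite0).
    apply: continuous_subspaceT.
    have zc : continuous (fun s => z_e (y s)) := yc _.
    have psic : continuous (fun s => psi_e (y s)) := yc _.
    have ec : continuous (fun s => r_e (y s)) := yc _.
    have ubc : continuous (fun s => ubar_e (y s)) := yc _.
    by rewrite /G /energy /=; cont.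
  move=> s /andP[t0s st] _; have [chi0 D] := yD s t0s.
  set p := shifted_datum s (y s).
  have [Ez Epsi Ee Eub] := row4E (z_rate k1 k2 p) (psi_rate k1 k2 p) (e_rate k4 p) (ub_rate k1 k2 k3 p).
  have Dz : is_derive s (1 : R) (fun s => z_e (y s)) (chi s * z_rate k1 k2 p).
    by rewrite -Ez; exact: D.
  have Dpsi : is_derive s (1 : R) (fun s => psi_e (y s)) (chi s * psi_rate k1 k2 p).
    by rewrite -Epsi; exact: D.
  have De : is_derive s (1 : R) (fun s => r_e (y s)) (chi s * e_rate k4 p).
    by rewrite -Ee; exact: D.
  have Dub : is_derive s (1 : R) (fun s => ubar_e (y s)) (chi s * ub_rate k1 k2 k3 p).
    by rewrite -Eub; exact: D.
  split.
    rewrite /G /dG -(denergy_correct k1 k2 k3 k4) /energy; deriv.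
    by rewrite -/p; move: (z_rate _ _ p) (psi_rate _ _ p) (e_rate _ p) (ub_rate _ _ _ p) => *; rewrite /p /=; field.
  rewrite /dG mulr_ge0_le0// /denergy.
  have := mulr_ge0 (ltW k20) (sqr_ge0 (dat_psi p)).
  have := mulr_ge0 (ltW k40) (sqr_ge0 (dat_e p)).
  by have := mulr_ge0 (ltW k30) (sqr_ge0 (dat_ub p)); rewrite /p; lra.
have e0 := eta_pos k1 k10.
have V00 : 0 <= V0.
  rewrite /V0 /energy mulr_ge0 ?invr_ge0// !addr_ge0 ?sqr_ge0// mulr_ge0 ?sqr_ge0//.
  exact: ltW.
have eV : 0 <= eta k1 * V0 by rewrite mulr_ge0// ltW.
have [||h1 h2 h3 h4] := coord_le_energy k1 k10 (shifted_datum t (y t)) (1 + eta k1 * V0).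
- by rewrite addr_ge0.
- by rewrite (le_trans (ler_wpM2l (ltW e0) GV))//; move: (eta k1 * V0) eV => q; nra.
- rewrite /in_box (row4_surj (y t)).
  by apply: (row4_coord (fun F => `|F t (y t)| <= _) (fun _ y => z_e y)
   (fun _ y => psi_e y) (fun _ y => r_e y) (fun _ y => ubar_e y)).
Qed.

Lemma global_trajectory (x0 : 'rV[R]_4) :
  exists2 x, x t0 = x0 & trajectory f `[t0, +oo[ x.
Proof.
pose red t x := r_ed c d ref k1 k2 t x.
pose y0 := row4 (z_e x0) (psi_e x0) (r_e x0 - red t0 x0) (ubar_e x0).
pose V0 := energy k1 (shifted_datum t0 y0).
have V00 : 0 <= V0.
  rewrite /V0 /energy mulr_ge0 ?invr_ge0// !addr_ge0 ?sqr_ge0// mulr_ge0 ?sqr_ge0//.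
  exact: ltW.
have eV : 0 <= eta k1 * V0 by rewrite mulr_ge0// ltW// eta_pos.
have [|||||y [y_t0 yc yD]] := @bounded_ivp R 4 t0 (1 + eta k1 * V0 + 1) shifted_field y0.
- by [].
- by rewrite lerDr addr_ge0.
- by move=> i; exact: BL_shifted_field.
- exact: shifted_field_cont.
- move=> y chi y_t0 yc yD t t0t; rewrite addrK /V0 -y_t0.
  exact: shifted_stays_bounded yc yD t t0t.
pose x t := row4 (z_e (y t)) (psi_e (y t)) (r_e (y t) + red t (y t)) (ubar_e (y t)).
have xE t : [/\ z_e (x t) = z_e (y t), psi_e (x t) = psi_e (y t),
    r_e (x t) = r_e (y t) + red t (y t) & ubar_e (x t) = ubar_e (y t)] by exact: row4E.
(* The shift reads only z_e and psi_e, which it leaves unchanged, so it may be evaluated at [x] or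
   at [y]. *)
have redE t (a b : 'rV[R]_4) : z_e a = z_e b -> psi_e a = psi_e b -> red t a = red t b.
  by rewrite /red /r_ed => -> ->.
exists x.
  rewrite [RHS]row4_surj /x y_t0; have [-> -> -> ->] := row4E (z_e x0) (psi_e x0) (r_e x0 - red t0 x0) (ubar_e x0).
  have [hz hpsi _ _] := row4E (z_e x0) (psi_e x0) (r_e x0 - red t0 x0) (ubar_e x0).
  by rewrite (redE t0 y0 x0)// subrK.
have [uc [E4 l4 D4]] := reg_u _ _ _ reg; have [duc [E5 l5 D5]] := reg_du _ _ _ reg.
have [vc [E7 l7 D7]] := reg_v _ _ _ reg.
have zc : {within `[t0, +oo[, continuous (fun s => z_e (y s))}.
  exact: (continuous_subspaceT (yc _)).
have psic : {within `[t0, +oo[, continuous (fun s => psi_e (y s))}.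
  exact: (continuous_subspaceT (yc _)).
have ec : {within `[t0, +oo[, continuous (fun s => r_e (y s))}.
  exact: (continuous_subspaceT (yc _)).
have ubc : {within `[t0, +oo[, continuous (fun s => ubar_e (y s))}.
  exact: (continuous_subspaceT (yc _)).
have redc := cont_r_ed c d k1 k2 ref `[t0, +oo[ y uc duc vc zc psic.
(* Undoing the shift differentiates r_ed, which brings in the kinks of u_d, u_d' and v_d; the
   solution [y] has none after [t0]. *)
have lE : locally_finite (E4 `|` (E5 `|` E7)) by do 2![apply: locally_finiteU => //].
have derivs t : t0 < t -> ~ (E4 `|` (E5 `|` E7)) t ->
  [/\ is_derive t (1 : R) (fun s => z_e (x s)) (z_e (f t (x t))),
      is_derive t (1 : R) (fun s => psi_e (x s)) (psi_e (f t (x t))),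
      is_derive t (1 : R) (fun s => r_e (x s)) (r_e (f t (x t))) &
      is_derive t (1 : R) (fun s => ubar_e (x s)) (ubar_e (f t (x t)))].
  move=> t0t /not_orP[n4 /not_orP[n5 n7]].
  have Iy : (`[t0, +oo[%classic)° t by rewrite interior_itv_bndy /= in_itv /= t0t.
  have Du := D4 t Iy n4; have Ddu := D5 t Iy n5; have Dv := D7 t Iy n7.
  have [xz xpsi xr xub] := xE t.
  have pE : datum_at c d k1 k2 ref 0 t (x t) = shifted_datum t (y t).
    rewrite /datum_at -/(red t (x t)) (redE t (x t) (y t))//.
    by rewrite xz xpsi xr xub addrK.
  have [Ez Epsi Er Eub] := closed_loopE c d k1 k2 k3 k4 ref 0 t (x t).
  rewrite pE in Ez Epsi Er Eub; rewrite Ez Epsi Er Eub.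
  have [Fz Fpsi Fe Fub] := row4E (z_rate k1 k2 (shifted_datum t (y t)))
    (psi_rate k1 k2 (shifted_datum t (y t))) (e_rate k4 (shifted_datum t (y t)))
    (ub_rate k1 k2 k3 (shifted_datum t (y t))).
  have fE (g h : R -> R) : (forall s, g s = h s) -> g = h by move/funext.
  have Dz : is_derive t (1 : R) (fun s => z_e (x s)) (z_rate k1 k2 (shifted_datum t (y t))).
    rewrite (fE (fun s => z_e (x s)) (fun s => z_e (y s))); last by move=> s; have [] := xE s.
    exact: (deriv_eq (yD t t0t _) Fz).
  have Dpsi : is_derive t (1 : R) (fun s => psi_e (x s)) (psi_rate k1 k2 (shifted_datum t (y t))).
    rewrite (fE (fun s => psi_e (x s)) (fun s => psi_e (y s))); last by move=> s; have [] := xE s.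
    exact: (deriv_eq (yD t t0t _) Fpsi).
  have De : is_derive t (1 : R) (fun s => r_e (y s)) (e_rate k4 (shifted_datum t (y t))).
    exact: (deriv_eq (yD t t0t _) Fe).
  have Dub : is_derive t (1 : R) (fun s => ubar_e (x s)) (ub_rate k1 k2 k3 (shifted_datum t (y t))).
    rewrite (fE (fun s => ubar_e (x s)) (fun s => ubar_e (y s))); last by move=> s; have [] := xE s.
    exact: (deriv_eq (yD t t0t _) Fub).
  split=> //.
  have Dred : is_derive t (1 : R) (fun s => red s (x s)) (dr_ed c d ref k1 k2 t (x t)).
    apply: deriv_r_ed => //.
    - apply: (deriv_eq Dz); rewrite -pE /z_rate yaw_datum_at /dz_e /=; ring.
    - apply: (deriv_eq Dpsi); rewrite -pE /psi_rate /= /r_ed; ring.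
  rewrite (fE (fun s => r_e (x s)) (fun s => red s (x s) + r_e (y s))).
    exact: deriv_add.
  by move=> s; have [hz hpsi -> _] := xE s; rewrite (redE s (x s) (y s))// addrC.
have conts : [/\ {within `[t0, +oo[, continuous (fun s => z_e (x s))},
  {within `[t0, +oo[, continuous (fun s => psi_e (x s))},
  {within `[t0, +oo[, continuous (fun s => r_e (x s))} &
  {within `[t0, +oo[, continuous (fun s => ubar_e (x s))}].
  have fE (g h : R -> R) : (forall s, g s = h s) -> g = h by move/funext.
  rewrite (fE (fun s => z_e (x s)) (fun s => z_e (y s))); last by move=> s; have [] := xE s.
  rewrite (fE (fun s => psi_e (x s)) (fun s => psi_e (y s))); last by move=> s; have [] := xE s.
  rewrite (fE (fun s => ubar_e (x s)) (fun s => ubar_e (y s))); last by move=> s; have [] := xE s.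
  rewrite (fE (fun s => r_e (x s)) (fun s => r_e (y s) + red s (y s))); last by move=> s; have [] := xE s.
  by split=> //; rewrite /red; cont.
have [C0 C1 C2 C3] := conts.
have Dt t : (`[t0, +oo[%classic)° t -> t0 < t.
  by rewrite interior_itv_bndy /= in_itv /= andbT.
case=> -[|[|[|[|//]]]] i4; rewrite (bool_irrelevance i4 isT); split=> //;
  exists (E4 `|` (E5 `|` E7)) => // t /Dt t0t nE; have [] := derivs t t0t nE => //.
Qed.

End GlobalExistence.

(** * The class kappa bound *)

Section ClassKappaBound.
Context {R : realType}.
Variables (c d k1 k2 k3 k4 t0 L : R) (ref : reference R).
Hypotheses (c0 : 0 < c) (d0 : 0 < d) (k10 : 0 < k1) (k20 : 0 < k2).
Hypothesis reg : regular_reference t0 L ref.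

Definition growth := k1 * (gain d L + (c + d) * L) + k2.

Let L0 : 0 <= L. Proof. exact: le_trans (reg_ge1 _ _ _ reg). Qed.
Let gain0 : 0 <= gain d L. Proof. exact: le_trans (gain_ge _ _ _ _ d0 reg). Qed.
Lemma growth_ge0 : 0 <= growth.
Proof.
rewrite /growth addr_ge0 ?(ltW k20)// mulr_ge0 ?(ltW k10)// addr_ge0//.
by rewrite mulr_ge0// addr_ge0// ltW.
Qed.

(** sigma is quadratic in psi_e, whence (1 + a)^2; the isolated factor [a] makes the bound linear
    near 0, which a rho vanishing at 0 relies on. *)
Lemma r_ed_bound t x a : t0 <= t -> `|z_e x| <= a -> `|psi_e x| <= a ->
  `|r_ed c d ref k1 k2 t x| <= growth * (a * (1 + a) ^+ 2).
Proof.
move=> t0t za psia; have a0 : 0 <= a by exact: le_trans psia.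
have a1 : 1 <= 1 + a by rewrite lerDl.
have a12 : 1 <= (1 + a) ^+ 2 by rewrite exprn_ege1.
have psia1 : `|psi_e x| <= 1 + a by rewrite (le_trans psia)// lerDr.
have h1 := sigma_close c d t0 L ref d0 reg t _ _ t0t a1 psia1.
have h2 : gain d L * (1 + a) * `|psi_e x| <= gain d L * (1 + a) ^+ 2.
  by rewrite expr2 mulrA ler_wpM2l// mulr_ge0// (le_trans _ a1).
have [[uL duL _ _ _] _] := reg_bound _ _ _ reg t t0t.
have h3 : `|c * du_d ref t + d * u_d ref t| <= (c + d) * L.
  rewrite (le_trans (ler_normD _ _))// mulrDl !normrM (gtr0_norm c0) (gtr0_norm d0).
  by rewrite lerD// ler_pM2l.
have cdL : 0 <= (c + d) * L by rewrite mulr_ge0// addr_ge0// ltW.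
have h4 : `|sigma c d ref t (psi_e x)| <= (gain d L + (c + d) * L) * (1 + a) ^+ 2.
  rewrite -[sigma _ _ _ _ _](subrK (c * du_d ref t + d * u_d ref t)).
  rewrite (le_trans (ler_normD _ _))// mulrDl lerD//.
    exact: le_trans h1 h2.
  by rewrite (le_trans h3)// ler_peMr.
have h5 : `|z_e x * sigma c d ref t (psi_e x)| <=
    a * ((gain d L + (c + d) * L) * (1 + a) ^+ 2).
  by rewrite normrM ler_pM.
have h6 : `|psi_e x| <= a * (1 + a) ^+ 2 by rewrite (le_trans psia)// ler_peMr.
rewrite /r_ed (le_trans (ler_normB _ _))//.
rewrite (_ : - k1 * _ * _ = - (k1 * (z_e x * sigma c d ref t (psi_e x)))); last by ring.
rewrite normrN (normrM k1) (normrM k2) (gtr0_norm k10) (gtr0_norm k20).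
apply: le_trans (lerD (ler_wpM2l (ltW k10) h5) (ler_wpM2l (ltW k20) h6)) _.
by rewrite le_eqVlt /growth; apply/orP; left; apply/eqP; ring.
Qed.

Let sqr_le (a b : R) : 0 <= a -> a <= b -> a ^+ 2 <= b ^+ 2.
Proof. by move=> a0 ab; rewrite lerXn2r ?nnegrE// (le_trans a0). Qed.

(** Distortion of the change of variable between r_e and e, in either direction. *)
Let stretch (a : R) := (1 + growth) * (a * (1 + a) ^+ 2).

Let le_stretch a : 0 <= a -> a <= stretch a.
Proof.
move=> a0; have g0 := growth_ge0; rewrite /stretch.
have h : a <= a * (1 + a) ^+ 2 by rewrite ler_peMr// exprn_ege1// lerDl.
rewrite mulrDl mul1r (le_trans h)// lerDl mulr_ge0// (le_trans a0)//.
Qed.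

Lemma energy_le_enorm t x : t0 <= t ->
  energy_at c d k1 k2 ref t x <= 2^-1 * (k1 + 3) * stretch (enorm x) ^+ 2.
Proof.
move=> t0t; set n := enorm x; have n0 : 0 <= n := enorm_ge0 x.
have nb := le_stretch n n0; have b0 := le_trans n0 nb.
have hz : `|z_e x| <= n := coord_le_enorm x _.
have hpsi : `|psi_e x| <= n := coord_le_enorm x _.
have hr : `|r_e x| <= n := coord_le_enorm x _.
have hub : `|ubar_e x| <= n := coord_le_enorm x _.
have he : `|r_e x - r_ed c d ref k1 k2 t x| <= stretch n.
  rewrite (le_trans (ler_normB _ _))// /stretch mulrDl mul1r lerD ?r_ed_bound//.
  by rewrite (le_trans hr)// ler_peMr// exprn_ege1// lerDl.
have sq (a : R) : `|a| <= stretch n -> a ^+ 2 <= stretch n ^+ 2.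
  by move=> h; rewrite -[a ^+ 2]real_normK ?num_real// lerXn2r ?nnegrE.
have s1 := sq _ (le_trans hz nb); have s2 := sq _ (le_trans hpsi nb).
have s3 := sq _ he; have s4 := sq _ (le_trans hub nb).
rewrite /energy_at /energy /= -mulrA ler_wpM2l ?invr_ge0//.
by have := ler_wpM2l (ltW k10) s1; move: (stretch n ^+ 2) s2 s3 s4 => b; lra.
Qed.

Lemma enorm_le_energy t x a : t0 <= t -> 0 <= a -> eta k1 * energy_at c d k1 k2 ref t x <= a ^+ 2 ->
  enorm x <= 4 * stretch a.
Proof.
move=> t0t a0 h.
have [hz hpsi he hub] := coord_le_energy k1 k10 (datum_at c d k1 k2 ref 0 t x) a a0 h.
have ab := le_stretch a a0; have b0 := le_trans a0 ab.
have hr : `|r_e x| <= stretch a.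
  rewrite -[r_e x](subrK (r_ed c d ref k1 k2 t x)) (le_trans (ler_normD _ _))//.
  rewrite /stretch mulrDl mul1r lerD ?r_ed_bound// (le_trans he)//.
  by rewrite ler_peMr// exprn_ege1// lerDl.
apply: (@enorm_le R 4) => //; rewrite /in_box (row4_surj x).
by apply: (row4_coord (fun F => `|F t x| <= stretch a) (fun _ y => z_e y)
   (fun _ y => psi_e y) (fun _ y => r_e y) (fun _ y => ubar_e y));
  rewrite ?(le_trans hz)// ?(le_trans hpsi)// (le_trans hub).
Qed.

Lemma class_kappa_mul (g : R -> R) : {within `[0, +oo[, continuous g} ->
  (forall s, 0 <= s -> 0 < g s) ->
  (forall s s', 0 <= s -> s <= s' -> g s <= g s') ->
  class_kappa (fun s => s * g s).
Proof.
move=> gc g0 gi; split; last by rewrite mul0r.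
  have ic : {within `[0, +oo[, continuous (fun s : R => s)}.
    by apply: continuous_subspaceT => s; exact: cvg_id.
  by cont.
move=> s s' s0 ss'; have s'0 := le_lt_trans s0 ss'.
apply: (@le_lt_trans _ _ (s * g s')); first by rewrite ler_wpM2l// gi// ltW.
by rewrite ltr_pM2r// g0// ltW.
Qed.

Variables (k30 : 0 < k3) (k40 : 0 < k4) (K mu delta t1 : R).
Hypotheses (K1 : 1 <= K) (mu0 : 0 < mu) (t01 : t0 <= t1).
Hypothesis excited : forall t, t1 <= t -> delta <= `|u_d ref t| + `|r_d ref t|.
Hypothesis strict : forall p : datum, admissible c d (gain d L) p ->
  let W := K * dat_m p ^+ 10 * energy k1 p + cross c d k1 p in
  [/\ energy k1 p <= W, W <= 2 * K * dat_m p ^+ 10 * energy k1 p &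
   delta <= `|dat_u p| + `|dat_r p| ->
   K * dat_m p ^+ 10 * denergy k2 k3 k4 p + dcross c d k1 k2 k3 p <= - mu * energy k1 p].

Let M := 2 * K * (1 + eta k1) ^+ 10.
Let gam := rate K mu (1 + eta k1).

(* [level s] bounds [eta] times the initial energy, and the energy is at most 1
   after [delay]. *)
Let level (s : R) := eta k1 * (2^-1 * (k1 + 3) * stretch s ^+ 2).
Let delay (v : R) := t1 - t0 + 2 * K * (1 + v) ^+ 10 * v / (eta k1 * mu).
(** The chain of estimates divided by [s]: [4 * (1 + growth)] returns to the Euclidean norm,
    [Num.sqrt M] comes from the decay, the next square root with [(1 + growth) * (1 + s) ^+ 2] is
    the initial [stretch], and the exponential pays for the delay. Roots and halves appear since the
    energy is quadratic. *)
Let kappa_gain (s : R) := 4 * (1 + growth) * Num.sqrt M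
  * Num.sqrt (eta k1 * (2^-1 * (k1 + 3))) * (1 + growth) * (1 + s) ^+ 2
  * (1 + Num.sqrt (eta k1 * (2^-1 * (k1 + 3))) * stretch s) ^+ 2
  * expR (2^-1 * gam * delay (level s)).

Let K0 : 0 < K. Proof. exact: lt_le_trans K1. Qed.
Let eta_gt0 : 0 < eta k1. Proof. exact: eta_pos. Qed.
Let M0 : 0 < M.
Proof.
by rewrite /M; apply: mulr_gt0; [exact: mulr_gt0|rewrite exprn_gt0// addr_gt0].
Qed.
Lemma gam_gt0 : 0 < gam. Proof. exact: divr_gt0. Qed.

Let kap0 : 0 < eta k1 * (2^-1 * (k1 + 3)).
Proof. by rewrite mulr_gt0// mulr_gt0 ?invr_gt0// addr_gt0. Qed.

Let stretch_ge0 s : 0 <= s -> 0 <= stretch s.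
Proof. by move=> s0; exact: le_trans (le_stretch s s0). Qed.

Let stretch_le s s' : 0 <= s -> s <= s' -> stretch s <= stretch s'.
Proof.
move=> s0 ss'; have g0 := growth_ge0; have s'0 := le_trans s0 ss'.
rewrite /stretch; apply: ler_wpM2l; first by rewrite addr_ge0.
apply: ler_pM => //; first by rewrite exprn_ge0// addr_ge0.
by rewrite lerXn2r ?nnegrE ?addr_ge0// lerD2l.
Qed.

Let level_ge0 s : 0 <= level s.
Proof.
rewrite /level mulr_ge0 ?(ltW eta_gt0)// mulr_ge0 ?sqr_ge0//.
by rewrite mulr_ge0 ?invr_ge0// addr_ge0// ltW.
Qed.

Let level_le s s' : 0 <= s -> s <= s' -> level s <= level s'.
Proof.
move=> s0 ss'; rewrite /level ler_pM2l// ler_pM2l ?mulr_gt0 ?invr_gt0 ?addr_gt0//.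
by apply: sqr_le; [exact: stretch_ge0|exact: stretch_le].
Qed.

Let delay_le v v' : 0 <= v -> v <= v' -> delay v <= delay v'.
Proof.
move=> v0 vv'; have v'0 := le_trans v0 vv'; rewrite /delay lerD2l.
apply: ler_wpM2r; first by rewrite invr_ge0 mulr_ge0// ltW.
rewrite -2!(mulrA (2 * K)); apply: ler_wpM2l; first by rewrite mulr_ge0// ltW.
apply: ler_pM => //; first by rewrite exprn_ge0// addr_ge0.
by rewrite lerXn2r ?nnegrE ?addr_ge0// lerD2l.
Qed.

Lemma kappa_gain_class : class_kappa (fun s => s * kappa_gain s).
Proof.
have g0 := growth_ge0; have gm := gam_gt0.
have C0 : 0 < 4 * (1 + growth) * Num.sqrt M
  * Num.sqrt (eta k1 * (2^-1 * (k1 + 3))) * (1 + growth).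
  have h : 0 < 1 + growth by rewrite (lt_le_trans ltr01)// lerDl.
  by rewrite !mulr_gt0// sqrtr_gt0.
have sq0 := sqrtr_ge0 (eta k1 * (2^-1 * (k1 + 3))).
apply: class_kappa_mul.
- have ic : {within `[0, +oo[, continuous (fun s : R => s)}.
    by apply: continuous_subspaceT => s; exact: cvg_id.
  have stc : {within `[0, +oo[, continuous stretch} by rewrite /stretch; cont.
  have ec : {within `[0, +oo[, continuous (fun s => expR (2^-1 * gam * delay (level s)))}.
    apply: (cont_comp expR); first exact: continuous_expR.
    by rewrite /delay /level; cont.
  by rewrite /kappa_gain; cont.
- move=> s s0; rewrite /kappa_gain mulr_gt0 ?expR_gt0// mulr_gt0 ?exprn_gt0//.
    by rewrite mulr_gt0// exprn_gt0// (lt_le_trans ltr01)// lerDl.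
  by rewrite (lt_le_trans ltr01)// lerDl mulr_ge0// stretch_ge0.
- move=> s s' s0 ss'; have s'0 := le_trans s0 ss'; rewrite /kappa_gain.
  have st0 := stretch_ge0 s s0; have st'0 := stretch_ge0 s' s'0.
  have h1 : (1 + s) ^+ 2 <= (1 + s') ^+ 2 by rewrite lerXn2r ?nnegrE ?addr_ge0// lerD2l.
  have h2 : (1 + Num.sqrt (eta k1 * (2^-1 * (k1 + 3))) * stretch s) ^+ 2 <=
      (1 + Num.sqrt (eta k1 * (2^-1 * (k1 + 3))) * stretch s') ^+ 2.
    apply: sqr_le; first by rewrite addr_ge0// mulr_ge0.
    by rewrite lerD2l ler_wpM2l// stretch_le.
  have h3 : expR (2^-1 * gam * delay (level s)) <= expR (2^-1 * gam * delay (level s')).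
    rewrite ler_expR ler_pM2l ?mulr_gt0 ?invr_gt0// delay_le// level_le//.
  apply: ler_pM; rewrite ?expR_ge0//.
    by rewrite mulr_ge0 ?sqr_ge0// mulr_ge0 ?sqr_ge0// ltW.
  apply: ler_pM; rewrite ?sqr_ge0//.
    by rewrite mulr_ge0 ?sqr_ge0// ltW.
  by rewrite ler_pM2l.
Qed.

Lemma trajectory_bound (T : R) (x : R -> 'rV[R]_4) t :
  trajectory (closed_loop c d ref k1 k2 k3 k4) `[t0, T[ x -> t0 <= t -> t < T ->
  enorm (x t) <= enorm (x t0) * kappa_gain (enorm (x t0)) * expR (- (gam / 2) * (t - t0)).
Proof.
move=> traj t0t tT; set s := enorm (x t0); have s0 : 0 <= s := enorm_ge0 _.
have g0 := growth_ge0; have gm := gam_gt0.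
set V0 := energy_at c d k1 k2 ref t0 (x t0); set Vt := energy_at c d k1 k2 ref t (x t).
have V00 : 0 <= V0 by exact: energy_ge0.
have Vt0 : 0 <= Vt by exact: energy_ge0.
have VtV0 : Vt <= V0 by apply: (energy_nonincreasing _ _ _ _ _ _ _ _ _ k20 k30 k40 reg T x traj).
have etaV0 : eta k1 * V0 <= level s.
  by rewrite /level ler_pM2l//; apply: energy_le_enorm.
have decay : Vt <= M * V0 * expR (gam * delay (level s)) * expR (- gam * (t - t0)).
  have := energy_exponential_decay c d k1 k2 k3 k4 t0 L ref d0 k10 k20 k30 k40 reg
    K mu delta t1 K1 mu0 t01 excited strict T x traj t t0t tT.
  rewrite -/V0 -/Vt -/M -/gam => /le_trans; apply.
  apply: ler_wpM2r; first exact: expR_ge0.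
  apply: ler_wpM2l; first by rewrite mulr_ge0// ltW.
  rewrite ler_expR ler_pM2l//.
  apply: le_trans (delay_le (eta k1 * V0) (level s) _ etaV0); last first.
    by rewrite mulr_ge0// ltW.
  rewrite /delay lerD2l le_eqVlt; apply/orP; left; apply/eqP; field.
  by rewrite !gt_eqF.
pose b := Num.sqrt (eta k1 * (2^-1 * (k1 + 3))) * stretch s.
have b0 : 0 <= b by rewrite mulr_ge0 ?sqrtr_ge0// stretch_ge0.
have b2 : b ^+ 2 = level s.
  by rewrite /b exprMn sqr_sqrtr; [rewrite /level; ring|exact: ltW].
pose E := expR (2^-1 * gam * delay (level s)) * expR (- (gam / 2) * (t - t0)).
have E0 : 0 <= E by rewrite mulr_ge0// expR_ge0.
have E2 : E ^+ 2 = expR (gam * delay (level s)) * expR (- gam * (t - t0)).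
  rewrite /E exprMn -!expRM_natl; congr (expR _ * expR _); by field.
(* Two bounds on the root of eta V. The decaying one is used for the linear factor of [stretch a],
   the constant [b] for the factor [(1 + a) ^+ 2]. *)
pose a := Num.min b (Num.sqrt M * b * E).
have sM := sqrtr_ge0 M.
have a0 : 0 <= a by rewrite /a le_min b0 /= mulr_ge0// mulr_ge0.
have etaVt : eta k1 * Vt <= a ^+ 2.
  rewrite /a /Num.min; case: ifP => _.
    by rewrite b2 (le_trans _ etaV0)// ler_pM2l.
  rewrite [_ ^+ 2]exprMn [(_ * b) ^+ 2]exprMn sqr_sqrtr ?(ltW M0)// b2 E2.
  apply: (le_trans (ler_wpM2l (ltW eta_gt0) decay)).
  rewrite (_ : eta k1 * _ = M * (eta k1 * V0) * (expR (gam * delay (level s)) * expR (- gam * (t - t0)))); last by ring.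
  apply: ler_wpM2r; first by rewrite mulr_ge0// expR_ge0.
  by rewrite ler_pM2l.
have h := enorm_le_energy t (x t) a t0t a0 etaVt; apply: (le_trans h).
have ab : a <= b by rewrite /a ge_min lexx.
have aE : a <= Num.sqrt M * b * E by rewrite /a ge_min lexx orbT.
have h2 : a * (1 + a) ^+ 2 <= Num.sqrt M * b * E * (1 + b) ^+ 2.
  apply: ler_pM => //; first exact: sqr_ge0.
  by apply: sqr_le; [rewrite addr_ge0|rewrite lerD2l].
have h3 : 4 * stretch a <= 4 * ((1 + growth) * (Num.sqrt M * b * E * (1 + b) ^+ 2)).
  by rewrite ler_wpM2l// ler_wpM2l// addr_ge0.
apply: (le_trans h3); rewrite le_eqVlt; apply/orP; left; apply/eqP.
rewrite /kappa_gain -/b /E {1}/b {1}/stretch.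
by move: (Num.sqrt M) (Num.sqrt _) (expR _) (expR _) => *; ring.
Qed.

End ClassKappaBound.

Theorem theorem2 (R : realType) (a b c d t0 : R) (ref : reference R)
    (ha : a != 0) (hb : b != 0) (hc : 0 < c) (hd : 0 < d)
    (hu : piecewise_derivative `[t0, +oo[ (u_d ref) (du_d ref))
    (hdu : piecewise_derivative `[t0, +oo[ (du_d ref) (ddu_d ref))
    (hr : piecewise_derivative `[t0, +oo[ (r_d ref) (dr_d ref))
    (hv : piecewise_derivative `[t0, +oo[ (v_d ref) (dv_d ref))
    (hddu_pc : piecewise_continuous t0 (ddu_d ref))
    (hdr_pc : piecewise_continuous t0 (dr_d ref))
    (hdv : forall t, t0 <= t ->
       dv_d ref t = - a * dr_d ref t - b * r_d ref t
                    - c * u_d ref t * r_d ref t - d * v_d ref t)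
    (hLu : L_infty t0 (u_d ref)) (hLdu : L_infty t0 (du_d ref))
    (hLddu : L_infty t0 (ddu_d ref))
    (hLr : L_infty t0 (r_d ref)) (hLdr : L_infty t0 (dr_d ref))
    (hPE : persistent_excitation ref)
    (k1 k2 k3 k4 : R)
    (hk1 : 0 < k1) (hk2 : 0 < k2) (hk3 : 0 < k3) (hk4 : 0 < k4) :
  GKES t0 (closed_loop c d ref k1 k2 k3 k4).
Proof.
have [L reg] := regularP a b c d t0 ref hc hd hu hdu hr hv hddu_pc hdr_pc hdv
  hLu hLdu hLddu hLr hLdr.
have [delta [T1 [delta0 exc]]] := excitationP ref hPE.
(* Excitation is known for late times only; before [t1] the energy merely does not increase, and
   [t1 - t0] is part of the delay. *)
pose t1 := Num.max t0 T1.
have t01 : t0 <= t1 by rewrite /t1 le_max lexx.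
have excited t : t1 <= t -> delta <= `|u_d ref t| + `|r_d ref t|.
  by move=> t1t; apply: exc; apply: le_trans t1t; rewrite /t1 le_max lexx orbT.
have gain1 : 1 <= gain d L.
  exact: le_trans (reg_ge1 _ _ _ reg) (gain_ge _ _ _ _ hd reg).
have [K [mu [K1 mu0 strict]]] :=
  strict_lyapunov c d k1 k2 k3 k4 hd hk1 hk2 hk3 hk4 (gain d L) delta gain1 delta0.
split; first exact: closed_loop_system reg.
have kc := kappa_gain_class c d k1 k2 t0 L ref hc hd hk1 hk2 reg K mu t1 K1 mu0.
eexists _, (rate K mu (1 + eta k1) / 2); split; first exact: kc.
  by rewrite divr_gt0// (gam_gt0 k1 hk1 K mu K1 mu0).
move=> x0; split; first exact: global_trajectory reg x0.
move=> T x t0T x_t0 traj t t0t tT; rewrite -x_t0.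
exact: (trajectory_bound c d k1 k2 k3 k4 t0 L ref hc hd hk1 hk2 reg hk3 hk4
  K mu delta t1 K1 mu0 t01 excited strict T x t traj t0t tT).
Qed.
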